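(* Let $\alpha>1/2$, $c_+,c_-\in(0,\infty)$, $v_+\in\mathfrak{D}_{\alpha,c_+}$ and $v_-\in\mathfrak{D}_{\alpha,c_-}$. Let $(Z_n)_{n\ge0}$ be the one-sided oscillating random walk on $\mathbb{R}$: the time-homogeneous Markov process with, for Borel $B\subseteq\mathbb{R}$, $$\mathbb{P}[Z_{n+1}\in B\mid Z_n=x]=\begin{cases}\int_B w_+(z-x)\,dz & \text{if }x>0,\\ \int_B w_-(z-x)\,dz&\text{if }x<0,\end{cases}\qquad w_+(y)=v_+(-y),\quad w_-(y)=v_-(y),$$ (with an arbitrary non-trivial choice of transition law at $x=0$). For $a>0$ let $\tau_a:=\min\{n\ge0:|Z_n|\le a\}$, and let $x\notin[-a,a]$. (i) If $\alpha\ge1$, then $\mathbb{E}_x[\tau_a^q]<\infty$ if $q<\alpha$ and $\mathbb{E}_x[\tau_a^q]=\infty$ if $q>\alpha$. (ii) If $\alpha\in(1/2,1)$, then $\mathbb{E}_x[\tau_a^q]<\infty$ if $q<2-\frac1\alpha$ and $\mathbb{E}_x[\tau_a^q]=\infty$ if $q>2-\frac1\alpha$.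
   Context: $\mathbb{R}_+=[0,\infty)$; $\min\emptyset:=+\infty$; $\mathbb{E}_x$ denotes expectation given $Z_0=x$. For a probability density $v:\mathbb{R}\to\mathbb{R}_+$ and $\alpha,c\in(0,\infty)$, write $v\in\mathfrak{D}_{\alpha,c}$ if there is a function $c(\cdot):\mathbb{R}_+\to(0,\infty)$ with $\sup_y c(y)<\infty$ and $\lim_{y\to\infty}c(y)=c$ such that $v(y)=c(y)y^{-1-\alpha}$ for $y>0$ and $v(y)=0$ for $y\le 0$. *)

(* Defs.v *)
From HB Require Import structures.
From mathcomp Require Import all_boot all_order all_algebra.
From mathcomp Require Import all_classical all_reals all_analysis.

Set Implicit Arguments.
Unset Strict Implicit.
Unset Printing Implicit Defensive.

Import Order.TTheory GRing.Theory Num.Theory.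
Import numFieldNormedType.Exports.

Local Open Scope classical_set_scope.
Local Open Scope ring_scope.

Definition probability_density (R : realType) (v : R -> R) : Prop :=
  [/\ measurable_fun [set: R] v,
      forall y, 0 <= v y
    & (\int[lebesgue_measure]_y (v y)%:E = 1)%E].

(* Only the values of [cf] on [0, +oo[ matter. *)
Definition classD (R : realType) (alpha c : R) (v : R -> R) : Prop :=
  probability_density v /\
  exists cf : R -> R,
    [/\ forall y, 0 <= y -> 0 < cf y,
        has_ubound [set cf y | y in `[0, +oo[],
        cf y @[y --> +oo] --> c,
        forall y, 0 < y -> v y = cf y * y `^ (- 1 - alpha)
      & forall y, y <= 0 -> v y = 0].

Definition w_plus (R : realType) (v_plus : R -> R) (y : R) : R := v_plus (- y).
Definition w_minus (R : realType) (v_minus : R -> R) (y : R) : R := v_minus y.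

(* The law [K 0] is arbitrary, except that it is not the trivial law at 0 under
   which the walk never leaves 0. *)
Definition one_sided_oscillating_kernel (R : realType)
    (v_plus v_minus : R -> R) (K : R.-pker R ~> R) : Prop :=
  [/\ forall x B, 0 < x -> measurable B ->
        K x B = (\int[lebesgue_measure]_(z in B) (w_plus v_plus (z - x))%:E)%E,
      forall x B, x < 0 -> measurable B ->
        K x B = (\int[lebesgue_measure]_(z in B) (w_minus v_minus (z - x))%:E)%E
    & K 0 [set 0] != 1%E].

Definition natural_filtration (R : realType) (d : measure_display)
    (T : measurableType d) (Z : nat -> T -> R) (n : nat) : set (set T) :=
  <<s \bigcup_(k in [set k | (k <= n)%N])
        preimage_set_system [set: T] (Z k) measurable >>.

(* The second clause is P[Z_{n+1} \in B | Z_0, ..., Z_n] = K(Z_n, B) a.s.,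
   spelled out through the defining property of conditional probability. *)
Definition markov_chain_from (R : realType) (d : measure_display)
    (T : measurableType d) (P : probability T R) (K : R.-pker R ~> R) (x : R)
    (Z : nat -> {RV P >-> R}) : Prop :=
  P [set w | Z 0%N w = x] = 1%E /\
  forall (n : nat) (A : set T) (B : set R),
    natural_filtration Z n A -> measurable B ->
    P (A `&` (Z n.+1 @^-1` B)) = (\int[P]_(w in A) K (Z n w) B)%E.

(* [ereal_inf set0 = +oo]; a nonempty set of naturals contains its infimum. *)
Definition hitting_time (R : realType) (T : Type) (Z : nat -> T -> R) (a : R)
    (w : T) : \bar R :=
  ereal_inf [set (n%:R)%:E | n in [set n : nat | `|Z n w| <= a]].

(* E[tau^q]; here [+oo `^ q = +oo] for q != 0, including q < 0, and
   [+oo `^ 0 = 1]. *)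
Definition moment (R : realType) (d : measure_display) (T : measurableType d)
    (P : probability T R) (tau : T -> \bar R) (q : R) : \bar R :=
  (\int[P]_w (tau w `^ q))%E.

(* Main.v *)
Require Import Defs.
From HB Require Import structures.
From mathcomp Require Import all_boot all_order all_algebra.
From mathcomp Require Import all_classical all_reals all_analysis.
From mathcomp Require Import measurable_realfun ring lra.

Set Implicit Arguments.
Unset Strict Implicit.
Unset Printing Implicit Defensive.

Import Order.TTheory GRing.Theory Num.Theory.
Import numFieldNormedType.Exports.

Local Open Scope classical_set_scope.
Local Open Scope ring_scope.

(* The distance |Z| to the origin jumps from [z] to [|z - y|], where [y] has the
   density [v_plus] or [v_minus]; both have the tail [y `^ (- 1 - alpha)], so the
   drift of [|Z| `^ g] far from the origin does not depend on the side.  For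
   [1 / 2 < alpha < 1] this drift is of order [|z| `^ (g - alpha)], with a
   constant which vanishes for [g = 2 * alpha - 1], is negative below this
   exponent and positive between it and [alpha].

   Upper tails.  For [alpha <= 1] and [g < 2 * alpha - 1], truncate [|Z| `^ g] at
   the level [y = n `^ alpha^-1]: before the hitting time the drift is at most
   [- eps * y `^ (g - alpha)], which gives [P(tau > n) = O(n `^ (- (g / alpha)))].
   For [alpha > 1] the jumps have a finite mean, so that |Z| moves inwards at a
   positive speed [delta], and [(|Z_k| + T + delta * (n - k)) `^ g], killed at the
   hitting time, is a supermartingale for [1 < g < alpha], which gives
   [P(tau > n) = O(n `^ (- g))].

   Lower tails.  From a level [y = C * n `^ s^-1] with [s <= 1] and [s < alpha] the
   chain survives [n] steps with probability at least 1/2, by subadditivity of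
   [x `^ s].  This level is reached by a single jump with probability of order
   [y `^ (- alpha)] and, for [alpha < 1] and [g > 2 * alpha - 1], with probability
   of order [y `^ (- g)], since [|Z| `^ g] is then a submartingale far from the
   origin. *)

(** The side of the origin fixes the jump law and killing depends only on [|Z|], so each tail bound
    is an induction on the number of steps of [survival], fed by inequalities for one integral
    against [v_plus] and one against [v_minus]; no stopping theorem enters. The obstacle is the zone
    between [a] and the distance from which the drift estimates hold. The upper bounds add a
    constant, or a shift [T], to the potential: it is lost at killing, which has probability bounded
    below in that zone. The lower bounds concede an additive constant there. For [alpha < 1] only
    the exponent [beta = 2 * alpha - 1] is integrated explicitly; the others are compared with it
    through the tangent at 1 of [s^(g / beta)]. For [alpha = 1] the truncated mean of a jump grows
    without bound, and this alone makes the drift negative. The critical exponent [2 - 1 / alpha] is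
    [beta / alpha]: a level [y] of order [n^(1 / alpha)] turns [y^(- g)] into [n^(- g / alpha)]. *)

Section powers.
Context {R : realType}.
Implicit Types (x y z s t p g theta eta : R).

Lemma powRDp x s t : 0 < x -> x `^ (s + t) = x `^ s * x `^ t.
Proof. by move=> x0; rewrite powRD// (gt_eqF x0) implybT. Qed.

Lemma powR_invK p x : 0 < p -> 0 <= x -> (x `^ p^-1) `^ p = x.
Proof. by move=> p0 x0; rewrite -powRrM mulVf ?powRr1 ?gt_eqF. Qed.

(** Weighted Young inequality for the product of [s^theta] and 1, with conjugate exponents
    [theta^-1] and [(1 - theta)^-1]. *)
Lemma powR_le_tangent theta s : 0 <= s -> 0 < theta <= 1 ->
  s `^ theta <= theta * s + (1 - theta).
Proof.
move=> s0 /andP[t0]; rewrite le_eqVlt => /predU1P[->|t1].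
  by rewrite powRr1// subrr addr0 mul1r.
have t1' : 0 < 1 - theta by rewrite subr_gt0.
have := @conjugate_powR R (s `^ theta) 1 theta^-1 (1 - theta)^-1
  (powR_ge0 _ _) ler01.
rewrite !invrK -powRrM mulfV ?gt_eqF// powRr1// powR1 mulr1 mul1r.
rewrite !invr_gt0 => /(_ t0 t1'); rewrite addrC subrK => /(_ erefl).
by rewrite [s * _]mulrC.
Qed.

(** The concave case with exponent [theta^-1], applied to [s^theta] and solved for [s^theta]. *)
Lemma powR_ge_tangent theta s : 0 <= s -> 1 <= theta ->
  theta * s + (1 - theta) <= s `^ theta.
Proof.
move=> s0 t1; have t0 : 0 < theta by lra.
have := @powR_le_tangent theta^-1 (s `^ theta) (powR_ge0 _ _).
rewrite invr_gt0 t0 invf_le1// t1 => /(_ isT).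
rewrite -powRrM mulfV ?gt_eqF// powRr1// => h.
have : theta * s <= theta * (theta^-1 * s `^ theta + (1 - theta^-1)).
  by rewrite ler_pM2l.
rewrite mulrDr mulrA mulfV ?gt_eqF// mul1r mulrBr mulfV ?gt_eqF// mulr1; lra.
Qed.

(** Each share [t] of the sum [x + y] lies in [0, 1], where [t <= t^s], and the two shares add up to
    1. *)
Lemma powR_subadditive s x y : 0 <= s <= 1 -> 0 <= x -> 0 <= y ->
  (x + y) `^ s <= x `^ s + y `^ s.
Proof.
move=> /andP[s0 s1]; rewrite le_eqVlt => /predU1P[<- y0|x0].
  by rewrite add0r ler_wpDl// powR_ge0.
rewrite le_eqVlt => /predU1P[<-|y0].
  by rewrite addr0 ler_wpDr// powR_ge0.
have xy0 : 0 < x + y by rewrite addr_gt0.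
have key u : 0 < u -> u <= x + y -> u / (x + y) * (x + y) `^ s <= u `^ s.
  move=> u0 uxy; rewrite -[in leRHS](divfK (lt0r_neq0 xy0) u).
  rewrite powRM; [|by rewrite divr_ge0// ltW|exact: ltW].
  rewrite ler_pM2r ?powR_gt0//; apply: ger1_powR => //.
  by rewrite divr_gt0//= ler_pdivrMr// mul1r.
have -> : (x + y) `^ s = x / (x + y) * (x + y) `^ s + y / (x + y) * (x + y) `^ s.
  by rewrite -mulrDl -mulrDl mulfV ?gt_eqF// mul1r.
by rewrite lerD// key// ?lerDl ?lerDr ltW.
Qed.

Lemma le_powR s x y : 0 <= s -> 0 <= x -> x <= y -> x `^ s <= y `^ s.
Proof. by move=> s0 x0 xy; rewrite ge0_ler_powR// nnegrE// (le_trans x0). Qed.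

(* Compare [(1 + x) `^ g] with its tangent where [|x|] is small and with
   [|x| `^ g] elsewhere. *)
Lemma powR_expansion g eta : 1 < g -> 0 < eta ->
  exists2 C : R, 0 < C & forall x, -1 <= x ->
    (1 + x) `^ g <= 1 + g * x + eta * `|x| + C * `|x| `^ g.
Proof.
move=> g1 eta0; have g0 : 0 < g by lra.
have : {for (1 : R), continuous (fun x : R => x `^ (g - 1))}.
  apply: differentiable_continuous; apply/derivable1_diffP.
  by apply: derivable_powR; rewrite in_itv/= ltr01.
move=> /cvgrPdist_le /(_ (eta / g)).
rewrite divr_gt0// => /(_ isT) [r /= r0]; rewrite powR1 => hr.
pose r' := Num.min (r / 2) 1.
have r'0 : 0 < r' by rewrite lt_min divr_gt0//= ltr01.
(* When [|x| > r'], [1 + x] is at most [(1 + r'^-1) * |x|] and [|x|] is at most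
   [r'^(1 - g) * |x|^g]: the two summands pay for [(1 + x)^g] and for [- g * x]. *)
pose C := (1 + r'^-1) `^ g + g * r' `^ (1 - g).
have C1 : 0 < (1 + r'^-1) `^ g by rewrite powR_gt0// addr_gt0// invr_gt0.
have C2 : 0 < g * r' `^ (1 - g) by rewrite mulr_gt0// powR_gt0.
exists C; first by rewrite addr_gt0.
move=> x x1; have [xr|rx] := leP `|x| r'.
  have x1' : 0 <= 1 + x by lra.
  have -> : (1 + x) `^ g = (1 + x) * (1 + x) `^ (g - 1).
    by rewrite mulr_powRB1.
  (* convexity: the tangent at [1 + x] lies below the graph at [1] *)
  have tang : (1 + x) `^ g - g * x * (1 + x) `^ (g - 1) <= 1.
    move: x1'; rewrite le_eqVlt => /predU1P[x0|x0].
      by rewrite -x0 !powR0 ?subr_eq0 ?gt_eqF// mulr0 subr0 ler01.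
    have h := @powR_ge_tangent g (1 + x)^-1 _ (ltW g1).
    have x0' : 0 <= (1 + x)^-1 by rewrite invr_ge0 ltW.
    have : (g * (1 + x)^-1 + (1 - g)) * (1 + x) `^ g <= 1.
      rewrite (le_trans (ler_wpM2r (powR_ge0 _ _) (h x0')))//.
      by rewrite -powRM// ?(ltW x0)// mulVf ?gt_eqF// powR1.
    apply: le_trans; rewrite -!(@mulr_powRB1 _ (1 + x) g)// ?(ltW x0)//.
    have -> : (g * (1 + x)^-1 + (1 - g)) * ((1 + x) * (1 + x) `^ (g - 1)) =
      (g * ((1 + x)^-1 * (1 + x)) + (1 - g) * (1 + x)) * (1 + x) `^ (g - 1).
      by ring.
    rewrite mulVf ?gt_eqF//; lra.
  rewrite mulr_powRB1//.
  have : `|(1 + x) `^ (g - 1) - 1| <= eta / g.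
    rewrite distrC; apply: hr => /=.
    rewrite opprD addrA subrr add0r normrN; apply: le_lt_trans xr _.
    by rewrite gt_min; apply/orP; left; rewrite ltr_pdivrMr//; lra.
  rewrite ler_pdivlMr// => h.
  have h2 : g * x * ((1 + x) `^ (g - 1) - 1) <= eta * `|x|.
    rewrite (le_trans (ler_norm _))// !normrM (gtr0_norm g0) mulrAC mulrC.
    by rewrite mulrC; apply: ler_wpM2r => //; rewrite mulrC.
  have : 0 <= C * `|x| `^ g by rewrite mulr_ge0 ?powR_ge0// ltW// addr_gt0.
  lra.
have x0 : 0 < `|x| by apply: lt_trans rx.
have h1 : (1 + x) `^ g <= (1 + r'^-1) `^ g * `|x| `^ g.
  rewrite -powRM// ?addr_ge0// ?invr_ge0 ?(ltW r'0)//.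
  apply: le_powR; [exact: ltW|lra|].
  rewrite mulrDl mul1r addrC lerD ?ler_norm// mulrC ler_pdivlMr// mul1r.
  exact: ltW.
have h2 : g * `|x| <= g * r' `^ (1 - g) * `|x| `^ g.
  rewrite -mulrA ler_pM2l//.
  rewrite -[leLHS](_ : `|x| `^ (1 - g) * `|x| `^ g = `|x|); last first.
    by rewrite -powRD ?subrK ?powRr1//; apply/implyP => _; rewrite gt_eqF.
  apply: ler_wpM2r; first exact: powR_ge0.
  rewrite (_ : 1 - g = - (g - 1)); last by ring.
  rewrite 2!powRN lef_pV2 ?posrE ?powR_gt0//.
  by apply: le_powR; [lra|exact: ltW|exact: ltW].
have h3 : - (g * x) <= g * `|x|.
  by rewrite -mulrN ler_pM2l// -normrN ler_norm.
have h4 : 0 <= eta * `|x| by rewrite mulr_ge0// ltW.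
rewrite /C mulrDl; lra.
Qed.

End powers.

(** * Measurability and nonnegativity side conditions *)

Lemma measurable_powRc {R : realType} d (T : measurableType d) (D : set T)
    (f : T -> R) (p : R) :
  measurable_fun D f -> measurable_fun D (fun x => f x `^ p).
Proof. by move=> mf; exact: (measurableT_comp (measurable_powR p)). Qed.

Lemma measurable_normc {R : realType} d (T : measurableType d) (D : set T)
    (f : T -> R) :
  measurable_fun D f -> measurable_fun D (fun x => `|f x|).
Proof. by move=> mf; exact: measurableT_comp. Qed.

Lemma indic_ge0 {R : realType} T (A : set T) (x : T) : 0 <= (\1_A x : R).
Proof. by rewrite indicE ler0n. Qed.

(** A real number, so that it can multiply test functions of the distance; the factor [beyond a |z|]
    kills the walk in [- a, a]. *)
Definition beyond {R : realType} (a r : R) : R := (a < r)%R%:R.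

Lemma beyond_ge0 {R : realType} (a r : R) : 0 <= beyond a r.
Proof. exact: ler0n. Qed.

Lemma beyond_le1 {R : realType} (a r : R) : beyond a r <= 1.
Proof. by rewrite /beyond lern1 leq_b1. Qed.

Lemma measurable_beyond {R : realType} d (T : measurableType d) (f : T -> R)
    (a : R) :
  measurable_fun [set: T] f -> measurable_fun [set: T] (fun x => beyond a (f x)).
Proof.
move=> mf; rewrite (_ : (fun x => _) = \1_(f @^-1` `]a, +oo[)); last first.
  apply/funext => x; rewrite indicE /beyond; congr ((nat_of_bool _)%:R).
  by apply/idP/idP; rewrite inE/= in_itv/= andbT.
by apply: measurable_indic; rewrite -[X in measurable X]setTI; exact: mf.
Qed.

Ltac solve_mfun := repeat first
  [ match goal with H : ?P |- ?P => exact H end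
  | match goal with
    | |- measurable_fun _ (fun _ => ?c) => exact: measurable_cst
    | |- measurable_fun _ (fun x => x) => exact: measurable_id
    | |- measurable_fun _ (\1_ _) => exact: measurable_indic
    | |- measurable_fun _ (fun x => \1_ _ x) => exact: measurable_indic
    | |- measurable_fun _ (fun x => beyond _ (@?f x)) => apply: measurable_beyond
    | |- measurable_fun _ (fun x => (@?f x) `^ _) => apply: measurable_powRc
    | |- measurable_fun _ (fun x => `|@?f x|) => apply: measurable_normc
    | |- measurable_fun _ (fun x => (@?f x) - (@?g x)) => apply: measurable_funB
    | |- measurable_fun _ (fun x => (@?f x) + (@?g x)) => apply: measurable_funD
    | |- measurable_fun _ (fun x => (@?f x) * (@?g x)) => apply: measurable_funM
    | |- measurable_fun _ (fun x => Num.min (@?f x) (@?g x)) => apply: measurable_minr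
    end ].

Ltac solve_ge0 := repeat
  match goal with
  | H : is_true (0 <= ?x) |- is_true (0 <= ?x) => exact H
  | |- is_true (0 <= _ `^ _) => exact: powR_ge0
  | |- is_true (0 <= `|_|) => exact: normr_ge0
  | |- is_true (0 <= \1_ _ _) => exact: indic_ge0
  | |- is_true (0 <= beyond _ _) => exact: beyond_ge0
  | |- is_true (0 <= _ + _) => apply: addr_ge0
  | |- is_true (0 <= _ * _) => apply: mulr_ge0
  | |- is_true (0 <= 1) => exact: ler01
  | |- is_true (0 <= _%:R) => exact: ler0n
  | |- is_true (0 <= _) => first [solve [apply: ltW; assumption] | solve [auto 3]]
  end.

Ltac solve_side :=
  match goal with
  | H : ?P |- ?P => exact H
  | |- is_true true => exact isT
  | |- measurable_fun _ _ => try solve [cbv beta; solve_mfun]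
  | |- forall y, _ -> is_true (0 <= _) => try solve [intros; cbv beta; solve_ge0]
  | |- is_true (0 <= _) => try solve [solve_ge0]
  | _ => idtac
  end.

(** The expectation of [f] at a jump of density [v], kept in the extended reals: monotonicity and
    additivity then hold for nonnegative measurable [f] without integrability conditions. *)
Definition jump_mean {R : realType} (v f : R -> R) : \bar R :=
  (\int[lebesgue_measure]_(y in `]0%R, +oo[) (f y * v y)%:E)%E.

Arguments jump_mean {R} (v f)%_ring_scope.

(** * Monotonicity and linearity of the mean over one jump *)

Section jump_mean_theory.
Context {R : realType} (v : R -> R).
Hypotheses (mv : measurable_fun [set: R] v) (v0 : forall y, 0 <= v y).
Implicit Types f g : R -> R.
Local Notation E := (jump_mean v).

Let mfv f : measurable_fun [set: R] f ->
  measurable_fun (`]0, +oo[ : set R) (fun y => (f y * v y)%:E).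
Proof.
by move=> mf; apply/measurable_EFinP/measurable_funTS; exact: measurable_funM.
Qed.

Let fv0 f : (forall y, 0 < y -> 0 <= f y) ->
  forall y, (`]0, +oo[%classic : set R) y -> (0 <= (f y * v y)%:E)%E.
Proof.
move=> f0 y /=; rewrite in_itv/= andbT => y0.
by rewrite lee_fin mulr_ge0// f0.
Qed.

Lemma jump_mean_ge0 f : (forall y, 0 < y -> 0 <= f y) -> (0 <= E f)%E.
Proof. by move=> f0; apply: integral_ge0; exact: fv0. Qed.

Lemma le_jump_mean f g :
  measurable_fun [set: R] f -> measurable_fun [set: R] g ->
  (forall y, 0 < y -> 0 <= f y) -> (forall y, 0 < y -> f y <= g y) ->
  (E f <= E g)%E.
Proof.
move=> mf mg f0 fg; apply: ge0_le_integral => //.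
- exact: fv0.
- exact: mfv.
- exact: mfv.
- move=> y /=; rewrite in_itv/= andbT => y0.
  by rewrite lee_fin ler_wpM2r// fg.
Qed.

Lemma jump_meanD f g :
  measurable_fun [set: R] f -> measurable_fun [set: R] g ->
  (forall y, 0 < y -> 0 <= f y) -> (forall y, 0 < y -> 0 <= g y) ->
  E (fun y => f y + g y) = (E f + E g)%E.
Proof.
move=> mf mg f0 g0; rewrite /jump_mean -ge0_integralD//.
- by apply: eq_integral => y _; rewrite mulrDl.
- exact: fv0.
- exact: mfv.
- exact: fv0.
- exact: mfv.
Qed.

Lemma jump_meanZ k f : measurable_fun [set: R] f ->
  (forall y, 0 < y -> 0 <= f y) -> 0 <= k ->
  E (fun y => k * f y) = (k%:E * E f)%E.
Proof.
move=> mf f0 k0; rewrite /jump_mean -ge0_integralZl_EFin//.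
- by apply: eq_integral => y _; rewrite -EFinM mulrA.
- exact: fv0.
- exact: mfv.
Qed.

Lemma eq_jump_mean f g : (forall y, 0 < y -> f y = g y) -> E f = E g.
Proof.
move=> fg; apply: eq_integral => y; rewrite inE/= in_itv/= andbT => y0.
by rewrite fg.
Qed.

Hypothesis v1 : (\int[lebesgue_measure]_(y in `]0%R, +oo[) (v y)%:E = 1)%E.

Lemma jump_mean_cst k : 0 <= k -> E (fun=> k) = k%:E.
Proof.
move=> k0.
rewrite (_ : E _ = E (fun=> k * 1)); last by apply: eq_jump_mean => y _; rewrite mulr1.
rewrite jump_meanZ// /jump_mean.
by under eq_integral do rewrite mul1r; rewrite v1 mule1.
Qed.

End jump_mean_theory.

(** * Integrals of powers at infinity and at the origin *)

Lemma continuous_powR {R : realType} (p x : R) : 0 < x ->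
  {for x, continuous (fun y : R => y `^ p)}.
Proof.
move=> x0; apply: differentiable_continuous; apply/derivable1_diffP.
by apply: derivable_powR; rewrite in_itv/= andbT.
Qed.

Section power_integrals.
Context {R : realType}.
Local Notation mu := (@lebesgue_measure R).

Let derivable_powRZ (a p x : R) : 0 < x ->
  is_derive x 1 (fun y : R => a * y `^ p) (a * (p * x `^ (p - 1))).
Proof.
move=> x0; have h := is_derive1_powR p x0.
exact: is_deriveZ.
Qed.

Let continuous_powRZ (a p x : R) : 0 < x -> {for x, continuous (fun y : R => a * y `^ p)}.
Proof.
move=> x0; apply: differentiable_continuous; apply/derivable1_diffP.
by have [] := derivable_powRZ a p x0.
Qed.

Lemma powR_cvgy (p : R) : 0 < p -> x `^ p @[x --> +oo] --> +oo.
Proof.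
move=> p0; apply/cvgryPge => A; near=> x.
have hA : (Num.max A 1) `^ p^-1 <= x by near: x; exact: nbhs_pinfty_ge.
rewrite (@le_trans _ _ (Num.max A 1))//; first by rewrite le_max lexx.
have m0 : 0 <= Num.max A 1 by rewrite le_max ler01 orbT.
rewrite -[leLHS]powRr1// -(mulVf (lt0r_neq0 p0)) powRrM.
by apply: le_powR => //; [exact: ltW|exact: powR_ge0].
Unshelve. all: by end_near. Qed.

Lemma powRN_cvg0 (p : R) : 0 < p -> x `^ (- p) @[x --> +oo] --> 0.
Proof.
move=> p0; under eq_fun do rewrite powRN.
apply: (gtr0_cvgV0 _).2; last exact: powR_cvgy.
by near=> x; rewrite powR_gt0//; near: x; exact: nbhs_pinfty_gt.
Unshelve. all: by end_near. Qed.

Lemma integral_powR_infty (p b : R) : 0 < p -> 0 < b ->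
  (\int[mu]_(y in `]b, +oo[) (y `^ (- 1 - p))%:E = (b `^ (- p) / p)%:E)%E.
Proof.
move=> p0 b0.
rewrite integral_itv_obnd_cbnd; last first.
  by apply/measurable_EFinP/measurable_funTS; exact: measurable_powR.
have c x : 0 < x -> {for x, continuous (fun y : R => y `^ (- 1 - p))}.
  exact: continuous_powR.
rewrite (@ge0_continuous_FTC2y _ _ (fun y => - p^-1 * y `^ (- p)) b 0).
- by rewrite -EFinB sub0r mulNr opprK mulrC.
- by move=> x _; exact: powR_ge0.
- apply/continuous_within_itvcyP; split.
    by move=> x; rewrite in_itv/= andbT => bx; apply: c; exact: lt_trans bx.
  by apply: cvg_at_right_filter; exact: c.
- rewrite -(mulr0 (- p^-1)); apply: cvgM; first exact: cvg_cst.
  exact: powRN_cvg0.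
- by move=> x bx; have [] := derivable_powRZ (- p^-1) (- p) (lt_trans b0 bx).
- by apply: cvg_at_right_filter; exact: continuous_powRZ.
- move=> x; rewrite in_itv/= andbT => bx.
  have [_] := derivable_powRZ (- p^-1) (- p) (lt_trans b0 bx).
  rewrite derive1E => ->; rewrite mulrA mulrNN mulVf ?gt_eqF// mul1r.
  by congr (_ `^ _); ring.
Unshelve. all: by end_near. Qed.

(** The integrand may blow up at 0, so the primitive is used on compact intervals that exhaust ]0,
    b], and monotone convergence concludes. Dropping the primitive at the left end leaves an
    inequality. *)
Lemma integral_powR_0 (r b : R) : 0 < r -> 0 < b ->
  (\int[mu]_(y in `]0%R, b]) (y `^ (r - 1))%:E <= (b `^ r / r)%:E)%E.
Proof.
move=> r0 b0.
(* The shift by 2 keeps the interval nondegenerate already for [n = 0]. *)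
pose F (n : nat) := `[b / n.+2%:R, b]%classic.
have hb n : 0 < b / n.+2%:R by rewrite divr_gt0.
have hb2 n : b / n.+2%:R < b by rewrite ltr_pdivrMr// ltr_pMr// ltr1n.
have UF : `]0, b]%classic = \bigcup_n F n.
  apply/seteqP; split => [y|y [n _]]; rewrite /F /= ?in_itv/=.
    move=> /andP[y0 yb]; exists (Num.bound (b / y)) => //.
    rewrite /F /= in_itv/= yb andbT.
    rewrite ler_pdivrMr// mulrC -ler_pdivrMr//.
    have /ltW h : b / y < (Num.bound (b / y))%:R.
      by apply: archi_boundP; rewrite divr_ge0// ltW.
    by rewrite (le_trans h)// ler_nat leqW.
  by move=> /andP[y1 ->]; rewrite andbT (lt_le_trans (hb n)).
have mF : forall D, measurable_fun D (fun y : R => (y `^ (r - 1))%:E).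
  by move=> D; apply/measurable_EFinP/measurable_funTS; exact: measurable_powR.
have h n : (\int[mu]_(y in F n) (y `^ (r - 1))%:E <= (b `^ r / r)%:E)%E.
  have c x : 0 < x -> {for x, continuous (fun y : R => y `^ (r - 1))}.
    exact: continuous_powR.
  rewrite (@continuous_FTC2 _ _ (fun y => r^-1 * y `^ r) (b / n.+2%:R) b (hb2 n)).
  - rewrite -EFinB lee_fin mulrC lerBlDr lerDl.
    by rewrite mulr_ge0 ?powR_ge0// invr_ge0 ltW.
  - apply/continuous_within_itvP => //; split.
    + by move=> x; rewrite in_itv/= => /andP[bx _]; apply: c; exact: lt_trans bx.
    + by apply: cvg_at_right_filter; exact: c.
    + by apply: cvg_at_left_filter; exact: c.
  - split.
    + move=> x; rewrite in_itv/= => /andP[bx _].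
      by have [] := derivable_powRZ (r^-1) r (lt_trans (hb n) bx).
    + by apply: cvg_at_right_filter; exact: continuous_powRZ.
    + by apply: cvg_at_left_filter; exact: continuous_powRZ.
  - move=> x; rewrite in_itv/= => /andP[bx _].
    have [_] := derivable_powRZ (r^-1) r (lt_trans (hb n) bx).
    by rewrite derive1E => ->; rewrite mulrA mulVf ?gt_eqF// mul1r.
rewrite UF.
have nd : nondecreasing_seq F.
  move=> m n mn; apply/subsetPset => y; rewrite /F /= !in_itv/= => /andP[y1 ->].
  rewrite andbT (le_trans _ y1)// ler_pM2l// lef_pV2 ?posrE// ler_nat.
  by rewrite !ltnS.
have F0 i y : F i y -> (0 <= (y `^ (r - 1))%:E)%E by rewrite lee_fin powR_ge0.
have mFi i : measurable (F i : set R) by exact: measurable_itv.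
have := @ge0_nondecreasing_set_cvg_integral _ (measurableTypeR R) R F
  (fun y => (y `^ (r - 1))%:E) lebesgue_measure nd mFi (fun=> mF _) F0.
move=> /cvg_lim <-//.
apply: lime_le; last by near=> n; exact: h.
apply: ereal_nondecreasing_is_cvgn.
exact: (@ge0_nondecreasing_set_nondecreasing_integral _ (measurableTypeR R) R
  F (fun y => (y `^ (r - 1))%:E) lebesgue_measure nd mFi (fun=> mF _) F0).
Unshelve. all: by end_near. Qed.

End power_integrals.

(** * Tails, moments and positivity for one jump density *)

Section jump_density.
Context {R : realType} (alpha c : R) (v : R -> R).
Hypotheses (alpha0 : 0 < alpha) (c0 : 0 < c) (hv : classD alpha c v).
Local Notation E f := (jump_mean v f%R).
Local Notation mu := (@lebesgue_measure R).

Lemma classD_measurable : measurable_fun [set: R] v.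
Proof. by have [[]] := hv. Qed.

Lemma classD_ge0 y : 0 <= v y.
Proof. by have [[]] := hv. Qed.

Lemma integral_classD : (\int[mu]_(y in `]0%R, +oo[) (v y)%:E = 1)%E.
Proof.
have [[_ _ <-] [cf [_ _ _ _ vN]]] := hv.
rewrite integral_mkcond; apply: eq_integral => y _; rewrite patchE.
case: ifPn => // /negP; rewrite inE/= in_itv/= andbT => /negP.
by rewrite -leNgt => /vN ->.
Qed.

Lemma classD_gt0 y : 0 < y -> 0 < v y.
Proof.
have [_ [cf [cf0 _ _ vE _]]] := hv => y0.
by rewrite vE// mulr_gt0 ?cf0 ?powR_gt0// ltW.
Qed.

Lemma classD_ubound : exists2 M : R, 0 < M &
  forall y, 0 < y -> v y <= M * y `^ (- 1 - alpha).
Proof.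
have [_ [cf [cf0 [M hM] _ vE _]]] := hv; exists M.
  apply: (lt_le_trans (cf0 0 (lexx _))); apply: hM; exists 0 => //=.
  by rewrite in_itv/= lexx.
move=> y y0; rewrite vE// ler_wpM2r ?powR_ge0//; apply: hM; exists y => //=.
by rewrite in_itv/= ltW.
Qed.

Lemma classD_asymptotic eta : 0 < eta -> exists2 Y : R, 0 < Y &
  forall y, Y <= y ->
    `|v y - c * y `^ (- 1 - alpha)| <= eta * y `^ (- 1 - alpha).
Proof.
move=> eta0; have [_ [cf [_ _ /cvgrPdist_le/(_ _ eta0) h vE _]]] := hv.
have [A [_ hA]] := h; exists (Num.max (A + 1) 1); first by rewrite lt_max ltr01 orbT.
move=> y; rewrite ge_max => /andP[Ay y1].
have y0 : 0 < y by apply: lt_le_trans y1.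
rewrite vE// -mulrBl normrM [X in _ * X]ger0_norm ?powR_ge0//.
rewrite ler_wpM2r ?powR_ge0// distrC hA//; lra.
Qed.

Let mv := classD_measurable.
Let v0 := classD_ge0.

Lemma jump_mean_indicM (A : set R) f : A `<=` `]0, +oo[ -> measurable A ->
  E (fun y => \1_A y * f y) = (\int[mu]_(y in A) (f y * v y)%:E)%E.
Proof.
move=> A0 mA; rewrite /jump_mean integral_mkcond [RHS]integral_mkcond.
apply: eq_integral => y _; rewrite !patchE indicE.
have [yA|yA] := boolP (y \in A).
  by rewrite mem_set ?mul1r//; apply: A0; rewrite inE in yA.
by case: ifPn => //; rewrite !mul0r.
Qed.

Lemma jump_mean_indic (A : set R) : A `<=` `]0, +oo[ -> measurable A ->
  E \1_A = (\int[mu]_(y in A) (v y)%:E)%E.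
Proof.
move=> A0 mA; rewrite -[LHS](_ : E (fun y => \1_A y * 1) = _); last first.
  by apply: eq_jump_mean => y _; rewrite mulr1.
by rewrite jump_mean_indicM//; under eq_integral do rewrite mul1r.
Qed.

Let subpos (b : R) i : 0 <= b ->
  [set` Interval (BRight b) i] `<=` (`]0, +oo[%classic : set R).
Proof.
move=> b0; by apply: subset_itv; rewrite ?bnd_simp.
Qed.

Let mpow (D : set R) k p : measurable_fun D (fun y : R => (k * y `^ p)%:E).
Proof. by apply/measurable_EFinP; solve_mfun. Qed.

Lemma jump_mean_tail_le g : g < alpha -> exists2 C : R, 0 < C &
  forall b, 0 < b ->
    (E (fun y => \1_(`]b, +oo[%classic : set R) y * y `^ g)
      <= (C * b `^ (g - alpha))%:E)%E.
Proof.
move=> ga; have [M M0 hM] := classD_ubound.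
have ag : 0 < alpha - g by rewrite subr_gt0.
exists (M / (alpha - g)) => [|b b0]; first by rewrite divr_gt0.
rewrite jump_mean_indicM//; last exact/subpos/ltW.
apply: (@le_trans _ _ (\int[mu]_(y in `]b, +oo[)
    (M%:E * (y `^ (- 1 - (alpha - g)))%:E))%E).
  apply: ge0_le_integral => //.
  - by move=> y _; rewrite lee_fin mulr_ge0 ?powR_ge0.
  - apply/measurable_EFinP/measurable_funTS; solve_mfun.
  - by apply/measurable_EFinP; solve_mfun.
  - move=> y /=; rewrite in_itv/= andbT => /(lt_trans b0) y0.
    rewrite -EFinM lee_fin.
    rewrite (_ : - 1 - (alpha - g) = g + (- 1 - alpha)); last by ring.
    rewrite powRD; last by rewrite (gt_eqF y0) implybT.
    by rewrite mulrCA ler_wpM2l ?powR_ge0// hM.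
rewrite ge0_integralZl_EFin//; last 3 first.
- by move=> y _; rewrite lee_fin powR_ge0.
- by apply/measurable_EFinP; solve_mfun.
- exact: ltW.
rewrite integral_powR_infty// -EFinM lee_fin opprB.
by rewrite mulrCA mulrC.
Qed.

Lemma jump_mean_powR_fin s : 0 <= s -> s < alpha ->
  exists2 m : R, 0 <= m & E (fun y => y `^ s) = m%:E.
Proof.
move=> s0 sa; have [C C0 hC] := jump_mean_tail_le sa.
have h0 : (0 <= E (fun y => y `^ s))%E.
  by apply: jump_mean_ge0 => // y _; exact: powR_ge0.
have : (E (fun y => y `^ s) <= (1 + C * 1 `^ (s - alpha))%:E)%E.
  rewrite EFinD; apply: le_trans (leeD2l _ (hC 1 ltr01)).
  rewrite -(jump_mean_cst mv v0 integral_classD ler01) -jump_meanD//.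
  - apply: le_jump_mean => //; first by solve_mfun.
      by move=> y _; exact: powR_ge0.
    move=> y y0; rewrite indicE mem_setE in_itv/= andbT.
    have [y1|y1] := ltP 1 y; first by rewrite mul1r lerDr.
    by rewrite mul0r addr0; have := le_powR s0 (ltW y0) y1; rewrite powR1.
  - solve_mfun.
  - by move=> y _; rewrite mulr_ge0 ?powR_ge0.
case: (E _) h0 => [m m0 _|//|//]; exists m => //.
Qed.

(** The bound [M * y^(- alpha)] on [y * v y] is integrable at 0 because [alpha < 1]. *)
Lemma jump_mean_trunc_le : alpha < 1 -> exists2 C : R, 0 < C &
  forall b, 0 < b ->
    (E (fun y => \1_(`]0%R, b]%classic : set R) y * y)
      <= (C * b `^ (1 - alpha))%:E)%E.
Proof.
move=> a1; have [M M0 hM] := classD_ubound.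
have a1' : 0 < 1 - alpha by rewrite subr_gt0.
exists (M / (1 - alpha)) => [|b b0]; first by rewrite divr_gt0.
rewrite jump_mean_indicM//; last exact/subpos.
apply: (@le_trans _ _ (\int[mu]_(y in `]0%R, b])
    (M%:E * (y `^ ((1 - alpha) - 1))%:E))%E).
  apply: ge0_le_integral => //.
  - by move=> y /=; rewrite in_itv/= => /andP[y0 _]; rewrite lee_fin mulr_ge0// ltW.
  - apply/measurable_EFinP/measurable_funTS; solve_mfun.
  - by apply/measurable_EFinP; solve_mfun.
  - move=> y /=; rewrite in_itv/= => /andP[y0 _].
    rewrite -EFinM lee_fin.
    rewrite (_ : (1 - alpha) - 1 = 1 + (- 1 - alpha)); last by ring.
    rewrite powRD; last by rewrite (gt_eqF y0) implybT.
    by rewrite powRr1 ?(ltW y0)// mulrCA ler_wpM2l ?hM// ltW.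
rewrite ge0_integralZl_EFin//; last 3 first.
- by move=> y _; rewrite lee_fin powR_ge0.
- by apply/measurable_EFinP; solve_mfun.
- exact: ltW.
rewrite mulrAC -mulrA EFinM lee_wpmul2l ?lee_fin ?(ltW M0)//.
by rewrite integral_powR_0.
Qed.

Lemma jump_mean_tail_ge : exists k Y : R, [/\ 0 < k, 0 < Y &
  forall b, Y <= b ->
    ((k * b `^ (- alpha))%:E <= E \1_(`]b, (2 * b)%R]%classic : set R))%E].
Proof.
have c20 : 0 < c / 2 by rewrite divr_gt0.
have [Y Y0 hY] := classD_asymptotic c20.
(* From [Y] on the density is at least [c / 2 * y^(- 1 - alpha)], which is smallest on ]b, 2 b] at
   the right end; the length [b] of the interval supplies the missing power. *)
exists (c / 2 * 2 `^ (- 1 - alpha)), Y; split => // [|b Yb].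
  by rewrite mulr_gt0// powR_gt0.
have b0 : 0 < b by apply: lt_le_trans Yb.
rewrite jump_mean_indic//; last exact/subpos/ltW.
apply: (@le_trans _ _ (\int[mu]_(y in `]b, (2 * b)%R])
   (c / 2 * (2 * b) `^ (- 1 - alpha))%:E)%E).
  rewrite integral_cst//= lebesgue_measure_itv/= lte_fin.
  rewrite ltr_pMl// ltr1n/= -EFinD -EFinM lee_fin.
  rewrite (_ : 2 * b - b = b); last by ring.
  rewrite powRM// ?(ltW b0)// -!mulrA.
  rewrite (_ : b `^ (- alpha) = b `^ (- 1 - alpha) * b)//.
  rewrite mulrC -[X in _ = X * _](powRr1 (ltW b0)) -powRD.
    by congr (_ `^ _); ring.
  by rewrite (gt_eqF b0) implybT.
apply: ge0_le_integral => //.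
- by move=> y _; rewrite lee_fin mulr_ge0 ?powR_ge0// ltW.
- exact/measurable_EFinP/measurable_funTS.
- move=> y /=; rewrite in_itv/= => /andP[by_ yb]; rewrite lee_fin.
  have y0 : 0 < y by apply: lt_trans by_.
  have := hY y (le_trans Yb (ltW by_)).
  rewrite ler_norml => /andP[h _].
  rewrite (@le_trans _ _ (c / 2 * y `^ (- 1 - alpha)))//; last by move: h; lra.
  rewrite ler_pM2l//.
  rewrite -opprD 2!powRN lef_pV2 ?posrE ?powR_gt0 ?mulr_gt0//.
  by apply: le_powR => //; [rewrite addr_ge0// ltW|exact: ltW].
Qed.

(** The factor [cf] is positive at each point, but no positive lower bound on bounded sets is
    assumed. If the integral vanished, [v] would be zero almost everywhere on an interval of
    positive length. *)
Lemma jump_mean_itv_gt0 (b b' : R) : 0 <= b -> b < b' ->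
  (0 < E \1_(`]b, b']%classic : set R))%E.
Proof.
move=> b0 bb'; rewrite jump_mean_indic//; last exact/subpos.
rewrite lt0e integral_ge0 ?andbT//; last by move=> y _; rewrite lee_fin.
apply/negP => /eqP h.
have mvb : measurable_fun (`]b, b']%classic : set R) (fun y => (v y)%:E).
  exact/measurable_EFinP/measurable_funTS.
have /(ae_eq_integral_abs mu (measurable_itv `]b, b']) mvb)[N [mN N0 hN]] :
    (\int[mu]_(y in `]b, b']) `|(v y)%:E| = 0)%E.
  by rewrite -[RHS]h; apply: eq_integral => y _; rewrite gee0_abs// lee_fin.
have : (mu `]b, b'] <= mu N)%E.
  apply: le_measure; rewrite ?inE// => y yb; apply: hN => /(_ yb) [vy].
  move: yb; rewrite /= in_itv/= => /andP[by_ _].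
  by have := classD_gt0 (le_lt_trans b0 by_); rewrite vy ltxx.
by rewrite N0 lebesgue_measure_itv/= lte_fin bb' -EFinD lee_fin leNgt subr_gt0 bb'.
Qed.

End jump_density.

(** * The integral at the critical exponent for the pure power density *)

Section substitutions.
Context {R : realType}.
Local Notation mu := (@lebesgue_measure R).
Variables (G : R -> R) (z a b : R).
Hypotheses (z0 : 0 < z) (a0 : 0 < a) (ab : a < b).
Hypothesis cG : forall x, 0 < x -> {for x, continuous G}.

Let within_pos x y : 0 < x -> x < y -> {within `[x, y], continuous G}.
Proof.
move=> x0 xy; apply/continuous_within_itvP => //; split.
- by move=> t; rewrite in_itv/= => /andP[xt _]; apply: cG; exact: lt_trans xt.
- by apply: cvg_at_right_filter; exact: cG.
- by apply: cvg_at_left_filter; apply: cG; exact: lt_trans xy.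
Qed.

Lemma integral_scale :
  (\int[mu]_(y in `[(z * a)%R, (z * b)%R]) (G y)%:E =
   \int[mu]_(u in `[a, b]) (z * G (z * u))%:E)%E.
Proof.
have dz (x : R) : is_derive x 1 (fun u => z * u) z.
  by apply: is_derive_eq; rewrite scaler1.
have Dz : derive1 ( *%R z) = cst z.
  by apply/funext => x; rewrite derive1E; have [_ ->] := dz x.
have cz (x : R) : {for x, continuous (fun u => z * u)}.
  by apply: differentiable_continuous; apply/derivable1_diffP; have [] := dz x.
rewrite (@integration_by_substitution_increasing _ ( *%R z)) ?ltW//.
- by apply: eq_integral => u _; rewrite Dz !fctE mulrC.
- by move=> x y _ _ xy; rewrite ltr_pM2l.
- by rewrite Dz => x _; exact: cvg_cst.
- by rewrite Dz; exact: is_cvg_cst.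
- by rewrite Dz; exact: is_cvg_cst.
- split.
  + by move=> x _; have [] := dz x.
  + by apply: cvg_at_right_filter; exact: cz.
  + by apply: cvg_at_left_filter; exact: cz.
- by apply: within_pos; rewrite ?mulr_gt0// ltr_pM2l.
Qed.

(** The change of variable [y = z / u] folds the jumps larger than [z] onto the interval that
    [integral_scale] uses for the smaller ones, so that the two contributions can be added. *)
Lemma integral_inversion :
  (\int[mu]_(y in `[(z / b)%R, (z / a)%R]) (G y)%:E =
   \int[mu]_(u in `[a, b]) (z * u `^ (- 2) * G (z * u `^ (- 1)))%:E)%E.
Proof.
have b0 : 0 < b by apply: lt_trans ab.
have ze (x : R) : 0 < x -> z / x = z * x `^ (- 1).
  by move=> x0; rewrite powR_inv1// ltW.
pose F (x : R) := z * x `^ (- 1).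
have dF (x : R) : 0 < x -> is_derive x 1 F (- (z * x `^ (- 2))).
  move=> x0; have h := is_derive1_powR (-1) x0.
  have h2 := is_deriveZ z h.
  apply: is_derive_eq h2 _.
  rewrite mulN1r scalerN /GRing.scale/=.
  by congr (- (_ * _ `^ _)); ring.
have DF (x : R) : 0 < x -> derive1 F x = - (z * x `^ (- 2)).
  by move=> x0; rewrite derive1E; have [_ ->] := dF x x0.
have cF (x : R) : 0 < x -> {for x, continuous F}.
  move=> x0; apply: differentiable_continuous; apply/derivable1_diffP.
  by have [] := dF x x0.
have cDF (x : R) : 0 < x -> {for x, continuous (derive1 F)}.
  move=> x0; rewrite /prop_for /continuous_at DF//.
  apply: (@cvg_trans _ ((fun y => - (z * y `^ (- 2))) y @[y --> x])).
    apply: near_eq_cvg; near=> y; rewrite DF//.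
    by near: y; exact: lt_nbhsr.
  suff : {for x, continuous (fun y : R => - (z * y `^ (- 2)))} by [].
  by apply: continuousN; apply: continuousM; [exact: cst_continuous|exact: continuous_powR].
rewrite (ze _ a0) (ze _ b0).
rewrite (@integration_by_substitution_decreasing _ F) ?ltW//.
- apply: eq_integral => u; rewrite inE/= in_itv/= => /andP[au _].
  have u0 : 0 < u by apply: lt_le_trans au.
  by rewrite !fctE DF// opprK mulrC.
- move=> x y; rewrite !in_itv/= => /andP[ax _] /andP[ay _] xy.
  have x0 : 0 < x by apply: lt_le_trans ax.
  have y0 : 0 < y by apply: lt_le_trans ay.
  by rewrite /F -!ze// ltr_pM2l// ltf_pV2.
- by move=> x; rewrite in_itv/= => /andP[ax _]; apply: cDF; exact: lt_trans ax.
- apply/cvg_ex; exists (derive1 F a); apply: cvg_at_right_filter; exact: cDF.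
- apply/cvg_ex; exists (derive1 F b); apply: cvg_at_left_filter; exact: cDF.
- split.
  + by move=> x; rewrite in_itv/= => /andP[ax _]; have [] := dF x (lt_trans a0 ax).
  + by apply: cvg_at_right_filter; exact: cF.
  + by apply: cvg_at_left_filter; exact: cF.
- apply: within_pos; rewrite /F -!ze//; first by rewrite divr_gt0.
  by rewrite ltr_pM2l// ltf_pV2.
Unshelve. all: by end_near. Qed.

End substitutions.

(** The absolute value makes the power continuous across 0, where [z - y] changes sign and [powR]
    would return a default value on negative bases. *)
Lemma continuous_norm_powR {R : realType} (p : R) : 0 < p ->
  continuous (fun x : R => `|x| `^ p).
Proof.
move=> p0 x; have [->|x0] := eqVneq x 0.
  rewrite /continuous_at normr0 powR0 ?gt_eqF//.
  apply/cvgr0Pnorm_le => e e0; exists (e `^ p^-1) => /=; first exact: powR_gt0.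
  move=> y /=; rewrite sub0r normrN => /ltW ye.
  rewrite ger0_norm ?powR_ge0//.
  rewrite (le_trans (le_powR (ltW p0) (normr_ge0 _) ye))//.
  by rewrite -powRrM mulVf ?gt_eqF// powRr1// ltW.
apply: (@continuous_comp _ _ _ (fun x : R => `|x|) (fun x : R => x `^ p)).
  exact: norm_continuous.
by apply: continuous_powR; rewrite normr_gt0.
Qed.

Section critical_integral.
Context {R : realType} (alpha : R).
Hypotheses (alpha12 : 1 / 2 < alpha) (alpha1 : alpha < 1).
Local Notation beta := (2 * alpha - 1).
Local Notation mu := (@lebesgue_measure R).

Let alpha0 : 0 < alpha. Proof. by have := alpha12; lra. Qed.
Let beta0 : 0 < beta. Proof. by have := alpha12; lra. Qed.

(* [- (1 - u) `^ (2 * alpha) * u `^ (- alpha) / alpha] is a primitive of the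
   integrand, precisely because [beta = 2 * alpha - 1]. *)
Lemma integral_critical_01 d : 0 < d < 1 ->
  (\int[mu]_(u in `[d, 1%R])
      (`|1 - u| `^ beta * (u `^ (- 1 - alpha) + u `^ (- alpha)))%:E =
   ((1 - d) `^ (2 * alpha) * d `^ (- alpha) / alpha)%:E)%E.
Proof.
move=> /andP[d0 d1].
pose F u : R := - alpha^-1 * ((1 - u) `^ (2 * alpha) * u `^ (- alpha)).
pose f u := `|1 - u| `^ beta * (u `^ (- 1 - alpha) + u `^ (- alpha)).
have dF (x : R) : 0 < x -> x < 1 -> is_derive x 1 F (f x).
  move=> x0 x1; have x1' : 0 < 1 - x by rewrite subr_gt0.
  have h1 := is_derive1_powR (- alpha) x0.
  have h2 := is_derive1_powR (2 * alpha) x1'.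
  have h3 : is_derive x 1 (fun u : R => 1 - u) (-1).
    by apply: is_derive_eq; rewrite add0r mul1r.
  have h4 := @is_derive1_comp _ (fun u : R => u `^ (2 * alpha)) (fun u => 1 - u)
    x _ _ h2 h3.
  have h5 := is_deriveM h4 h1.
  have h6 := is_deriveZ (- alpha^-1) h5.
  apply: is_derive_eq h6 _.
  rewrite /f ger0_norm ?(ltW x1')// /GRing.scale/=.
  rewrite (_ : - alpha - 1 = - 1 - alpha); last by ring.
  rewrite (_ : (1 - x) `^ (2 * alpha) = (1 - x) * (1 - x) `^ (2 * alpha - 1)); last first.
    by rewrite mulr_powRB1 ?mulr_gt0// ltW.
  rewrite (_ : x `^ (- alpha) = x * x `^ (- 1 - alpha)); last first.
    rewrite -[X in X * _]powRr1 ?(ltW x0)// -powRDp//.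
    by congr (_ `^ _); ring.
  by field; rewrite gt_eqF.
have cf (x : R) : 0 < x -> {for x, continuous f}.
  move=> x0; apply: continuousM.
    apply: (@continuous_comp _ _ _ (fun u : R => 1 - u) (fun u : R => `|u| `^ beta)).
      by apply: continuousB; [exact: cst_continuous|exact: cvg_id].
    exact: continuous_norm_powR.
  by apply: continuousD; exact: continuous_powR.
rewrite (@continuous_FTC2 _ f F d 1 d1).
- rewrite /F subrr powR0 ?gt_eqF ?mulr_gt0// mul0r mulr0 -EFinB sub0r mulNr opprK.
  by rewrite mulrC.
- apply/continuous_within_itvP => //; split.
  + by move=> x; rewrite in_itv/= => /andP[dx _]; apply: cf; exact: lt_trans dx.
  + by apply: cvg_at_right_filter; exact: cf.
  + by apply: cvg_at_left_filter; exact: cf.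
- split.
  + move=> x; rewrite in_itv/= => /andP[dx x1].
    by have [] := dF x (lt_trans d0 dx) x1.
  + apply: cvg_at_right_filter; apply: differentiable_continuous.
    by apply/derivable1_diffP; have [] := dF d d0 d1.
  (* Beyond [u = 1] the base [1 - u] in [F] is negative and its power is a default value. [F']
     agrees with [F] on the left of 1 and is continuous on both sides. *)
  + pose F' u : R := - alpha^-1 * (`|1 - u| `^ (2 * alpha) * u `^ (- alpha)).
    have -> : F 1 = F' 1 by rewrite /F /F' subrr normr0.
    apply: (@cvg_trans _ (F' u @[u --> 1^'-])).
      apply: near_eq_cvg; near=> u; rewrite /F /F' ger0_norm// subr_ge0.
      by near: u; exact: nbhs_left_le.
    apply: cvg_at_left_filter; suff : {for 1, continuous F'} by [].
    apply: continuousM; first exact: cst_continuous.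
    apply: continuousM; last exact: continuous_powR.
    apply: (@continuous_comp _ _ _ (fun u : R => 1 - u) (fun u : R => `|u| `^ (2 * alpha))).
      by apply: continuousB; [exact: cst_continuous|exact: cvg_id].
    by apply: continuous_norm_powR; rewrite mulr_gt0.
- move=> x; rewrite in_itv/= => /andP[dx x1].
  by rewrite derive1E; have [_ ->] := dF x (lt_trans d0 dx) x1.
Unshelve. all: by end_near. Qed.

(** The window is symmetric around [z] on the logarithmic scale: [y = z * u] below [z] and
    [y = z / u] above it both give [u] in [d, 1]. Up to the common factor [|1 - u|^beta], the lower
    part contributes [u^(- 1 - alpha)] and the upper part [u^(- 2) * u^(- beta) * u^(1 + alpha)],
    which is [u^(- alpha)] for [beta = 2 * alpha - 1]. *)
Lemma integral_critical z d : 0 < z -> 0 < d < 1 ->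
  (\int[mu]_(y in `[(z * d)%R, (z / d)%R])
      (`|z - y| `^ beta * y `^ (- 1 - alpha))%:E =
   (z `^ (beta - alpha) * ((1 - d) `^ (2 * alpha) * d `^ (- alpha) / alpha))%:E)%E.
Proof.
move=> z0 d01; have /andP[d0 d1] := d01.
pose G y : R := `|z - y| `^ beta * y `^ (- 1 - alpha).
have G0 y : 0 <= G y by rewrite mulr_ge0 ?powR_ge0.
have mG D : measurable_fun (D : set R) (fun y => (G y)%:E).
  by apply/measurable_EFinP/measurable_funTS; rewrite /G; solve_mfun.
have cG (x : R) : 0 < x -> {for x, continuous G}.
  move=> x0; apply: continuousM; last exact: continuous_powR.
  apply: (@continuous_comp _ _ _ (fun u : R => z - u) (fun u : R => `|u| `^ beta)).
    by apply: continuousB; [exact: cst_continuous|exact: cvg_id].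
  exact: continuous_norm_powR.
have zd : z * d <= z by rewrite ger_pMr// ltW.
have zd' : z <= z / d by rewrite ler_pdivlMr// ger_pMr// ltW.
rewrite (@itv_bndbnd_setU _ _ _ (BRight z)) ?bnd_simp//.
rewrite ge0_integral_setU//=; last 3 first.
- exact: mG.
- by move=> y _; rewrite lee_fin G0.
- apply/disj_setPS => y [] /=; rewrite !in_itv/= => /andP[_ yz] /andP[zy _].
  by move: zy; rewrite ltNge yz.
rewrite (@integral_itv_obnd_cbnd _ z)//.
have := @integral_scale R G z d 1 z0 d0 d1 cG.
rewrite mulr1 => ->.
have := @integral_inversion R G z d 1 z0 d0 d1 cG.
rewrite divr1 => ->.
rewrite -ge0_integralD//=; last 4 first.
- by move=> y _; rewrite lee_fin mulr_ge0// ltW.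
- by apply/measurable_EFinP/measurable_funTS; rewrite /G; solve_mfun.
- by move=> y _; rewrite lee_fin !mulr_ge0 ?powR_ge0// ltW.
- apply/measurable_EFinP/measurable_funTS; rewrite /G; solve_mfun.
rewrite EFinM -integral_critical_01//.
set K := z `^ (beta - alpha).
have K0 : 0 <= K by exact: powR_ge0.
rewrite -(@ge0_integralZl_EFin _ _ _ mu _ (measurable_itv _) _ _ _ K K0); last 2 first.
- by move=> y _; rewrite lee_fin mulr_ge0 ?addr_ge0 ?powR_ge0.
- by apply/measurable_EFinP/measurable_funTS; solve_mfun.
apply: eq_integral => u; rewrite inE/= in_itv/= => /andP[du u1].
have u0 : 0 < u by apply: lt_le_trans du.
rewrite -EFinD -EFinM; congr (_%:E); rewrite /G.
have -> : `|z - z * u| = z * `|1 - u|.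
  by rewrite -[X in X - _]mulr1 -mulrBr normrM gtr0_norm.
have -> : `|z - z * u `^ (- 1)| = z * `|1 - u| * u^-1.
  rewrite powR_inv1 ?(ltW u0)//.
  have -> : z - z / u = - (z * (1 - u) * u^-1) by field; rewrite gt_eqF.
  by rewrite normrN !normrM (gtr0_norm z0) [`|u^-1|]gtr0_norm// invr_gt0.
rewrite !powRM ?mulr_ge0 ?normr_ge0 ?powR_ge0 ?invr_ge0 ?(ltW u0) ?(ltW z0)//.
rewrite -!powR_inv1 ?(ltW u0)// -!powRrM.
have -> : K = z * z `^ beta * z `^ (- 1 - alpha).
  rewrite /K -[X in _ = X * _ * _]powRr1 ?(ltW z0)// -!powRDp//.
  by congr (_ `^ _); ring.
have -> : u `^ (- alpha) = u `^ (- 2) * u `^ (- 1 * beta) * u `^ (- 1 * (- 1 - alpha)).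
  by rewrite -!powRDp//; congr (_ `^ _); ring.
by ring.
Qed.

End critical_integral.

Lemma ge0_fin_numP {R : realType} (x : \bar R) (r : R) : (0 <= x)%E ->
  (x <= r%:E)%E -> exists2 s : R, 0 <= s <= r & x = s%:E.
Proof.
by case: x => [s||]//; rewrite !lee_fin => s0 sr; exists s; rewrite ?s0.
Qed.

Lemma addEFin_inj {R : realType} (x : \bar R) (r s : R) :
  (x + r%:E = s%:E)%E -> x = (s - r)%:E.
Proof. by case: x => //= x [<-]; rewrite addrK. Qed.

(** * Drift at the critical exponent for a density of the class *)

Section critical_drift.
Context {R : realType} (alpha c : R) (v : R -> R).
Hypotheses (alpha12 : 1 / 2 < alpha) (alpha1 : alpha < 1).
Hypotheses (c0 : 0 < c) (hv : classD alpha c v).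
Local Notation E f := (jump_mean v f%R).
Local Notation beta := (2 * alpha - 1).
Local Notation mu := (@lebesgue_measure R).

Let alpha0 : 0 < alpha. Proof. by have := alpha12; lra. Qed.
Let beta0 : 0 < beta. Proof. by have := alpha12; lra. Qed.
Let mv := classD_measurable hv.
Let v0 := classD_ge0 hv.
Let v1 := integral_classD hv.

(** Carries the exact integrals against [y^(- 1 - alpha)] over to [v], the constant [c] being
    replaced by [c - e] and [c + e]. *)
Let sandwich (A : set R) (f : R -> R) (e Y : R) :
  measurable A -> (forall y, A y -> 0 < Y /\ Y <= y) ->
  measurable_fun [set: R] f -> (forall y, 0 <= f y) -> 0 <= e <= c ->
  (forall y, Y <= y -> `|v y - c * y `^ (- 1 - alpha)| <= e * y `^ (- 1 - alpha)) ->
  ((c - e)%:E * \int[mu]_(y in A) (f y * y `^ (- 1 - alpha))%:E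
    <= E (fun y => \1_A y * f y))%E /\
  (E (fun y => \1_A y * f y)
    <= (c + e)%:E * \int[mu]_(y in A) (f y * y `^ (- 1 - alpha))%:E)%E.
Proof.
move=> mA AY mf f0 /andP[e0 ec] hY.
have A0 : A `<=` `]0, +oo[.
  by move=> y /AY[Y0 /(lt_le_trans Y0)]/=; rewrite in_itv/= andbT.
have mfw : measurable_fun A (fun y => (f y * y `^ (- 1 - alpha))%:E).
  by apply/measurable_EFinP/measurable_funTS; solve_mfun.
have mfv : measurable_fun A (fun y => (f y * v y)%:E).
  by apply/measurable_EFinP/measurable_funTS; solve_mfun.
have fw0 y : A y -> (0 <= (f y * y `^ (- 1 - alpha))%:E)%E.
  by move=> _; rewrite lee_fin mulr_ge0 ?powR_ge0.
rewrite jump_mean_indicM//.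
rewrite -!ge0_integralZl_EFin// ?subr_ge0 ?addr_ge0 ?(ltW c0)//.
split; apply: ge0_le_integral => //.
- by move=> y Ay; rewrite -EFinM lee_fin !mulr_ge0 ?subr_ge0 ?powR_ge0.
- exact: measurable_funeM.
- move=> y /AY[_ /hY]; rewrite ler_norml => /andP[h _].
  rewrite -EFinM lee_fin mulrCA ler_wpM2l//; lra.
- by move=> y Ay; rewrite lee_fin mulr_ge0.
- exact: measurable_funeM.
- move=> y /AY[_ /hY]; rewrite ler_norml => /andP[_ h].
  rewrite -EFinM lee_fin mulrCA ler_wpM2l//; lra.
Qed.

(** The tail beyond [z * d] minus the tail beyond [z / d]. *)
Let integral_weight (z d : R) : 0 < z -> 0 < d < 1 ->
  (\int[mu]_(y in `](z * d)%R, (z / d)%R]) (y `^ (- 1 - alpha))%:E =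
   (z `^ (- alpha) * ((d `^ (- alpha) - d `^ alpha) / alpha))%:E)%E.
Proof.
move=> z0 /andP[d0 d1].
have zd0 : 0 < z * d by rewrite mulr_gt0.
have zd'0 : 0 < z / d by rewrite divr_gt0.
have zdd : z * d <= z / d.
  by rewrite ler_pdivlMr// -mulrA ger_pMr// mulr_ile1// ltW.
have := integral_powR_infty alpha0 zd0.
rewrite (@itv_bndbnd_setU _ _ _ (BRight (z / d))) ?bnd_simp//.
have mw D : measurable_fun (D : set R) (fun y : R => (y `^ (- 1 - alpha))%:E).
  by apply/measurable_EFinP/measurable_funTS; solve_mfun.
rewrite ge0_integral_setU//=; last 3 first.
- exact: mw.
- by move=> y _; rewrite lee_fin powR_ge0.
- apply/disj_setPS => y [] /=; rewrite !in_itv/= => /andP[_ yz] /andP[zy _].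
  by move: zy; rewrite ltNge yz.
rewrite integral_powR_infty//.
move=> /addEFin_inj h; apply: (etrans h).
congr (_%:E).
rewrite !powRM ?invr_ge0 ?(ltW z0) ?(ltW d0)//.
rewrite -(powR_inv1 (ltW d0)) -powRrM mulrNN mul1r.
by field; rewrite gt_eqF.
Qed.

(** Up to powers of [z], [w] is the mass of the window and [w'] its integral of [|z - y|^beta]. Both
    may grow like [d^(- alpha)] as [d] tends to 0, but their difference is only of order
    [d^(1 - alpha)]: this cancellation is the vanishing of the critical drift. The leftover
    [d^alpha] is absorbed because [alpha > 1 / 2]. *)
Let weight_bounds d : 0 < d < 1 ->
  let w := (d `^ (- alpha) - d `^ alpha) / alpha in
  let w' := (1 - d) `^ (2 * alpha) * d `^ (- alpha) / alpha in
  [/\ `|w' - w| <= 4 * d `^ (1 - alpha), 0 <= w, 0 <= w' & w + w' <= 4 * d `^ (- alpha)].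
Proof.
move=> /andP[d0 d1] w w'.
have dal : d `^ alpha <= d `^ (1 - alpha).
  by apply: ger_powR; [rewrite d0 ltW|have := alpha12; lra].
have dNal : d `^ alpha <= d `^ (- alpha).
  by apply: ger_powR; [rewrite d0 ltW|have := alpha0; lra].
have dm : d `^ (1 - alpha) = d * d `^ (- alpha).
  by rewrite powRDp// powRr1// ltW.
have d'0 : 0 <= 1 - d by lra.
have p0 : 0 <= (1 - d) `^ (2 * alpha) by exact: powR_ge0.
have p1 : (1 - d) `^ (2 * alpha) <= 1.
  have := @le_powR R (2 * alpha) (1 - d) 1 _ d'0 _; rewrite powR1; apply => //.
    by rewrite mulr_ge0// ltW.
  lra.
have p2 : 1 - 2 * alpha * d <= (1 - d) `^ (2 * alpha).
  apply: le_trans (powR_ge_tangent d'0 _); first by lra.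
  by have := alpha12; lra.
have D0 : 0 <= d `^ (- alpha) by exact: powR_ge0.
have D1 : 0 <= d `^ alpha by exact: powR_ge0.
have h1 : d `^ (- alpha) * (1 - (1 - d) `^ (2 * alpha)) <= 2 * d `^ (1 - alpha).
  rewrite dm mulrCA mulrA mulrC; apply: ler_wpM2r => //.
  have : alpha * d <= d by rewrite ger_pMl// ltW.
  lra.
have h2 : 0 <= d `^ (- alpha) * (1 - (1 - d) `^ (2 * alpha)).
  by rewrite mulr_ge0// subr_ge0.
have h3 : (1 - d) `^ (2 * alpha) * d `^ (- alpha) <= d `^ (- alpha).
  by rewrite ger_pMl// powR_gt0.
have ia : alpha^-1 <= 2.
  by rewrite -[2]invrK lef_pV2 ?posrE//; have := alpha12; lra.
have ia0 : 0 < alpha^-1 by rewrite invr_gt0.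
have E0 : 0 <= d `^ (1 - alpha) by exact: powR_ge0.
split.
- rewrite /w /w' -mulrBl normrM (gtr0_norm ia0).
  rewrite (_ : 4 * d `^ (1 - alpha) = 2 * d `^ (1 - alpha) * 2); last by ring.
  apply: ler_pM => //; first exact: ltW.
  by rewrite ler_norml; apply/andP; split; lra.
- by rewrite /w divr_ge0 ?(ltW alpha0)// subr_ge0.
- by rewrite /w' !mulr_ge0 ?(ltW ia0).
- rewrite /w /w' -mulrDl (_ : 4 * d `^ (- alpha) = 2 * d `^ (- alpha) * 2); last by ring.
  apply: ler_pM => //; [|exact: ltW|].
    by rewrite addr_ge0 ?subr_ge0// mulr_ge0.
  lra.
Qed.


Let jump_mean_split (a b : R) (f : R -> R) : 0 <= a -> a <= b ->
  measurable_fun [set: R] f -> (forall y, 0 < y -> 0 <= f y) ->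
  E f = (E (fun y => \1_(`]0%R, a]%classic : set R) y * f y) +
         E (fun y => \1_(`]a, b]%classic : set R) y * f y) +
         E (fun y => \1_(`]b, +oo[%classic : set R) y * f y))%E.
Proof.
move=> a0 ab mf f0.
have i0 (A : set R) y : 0 < y -> 0 <= \1_A y * f y.
  by move=> /f0 h; rewrite mulr_ge0// indicE ler0n.
have mi (A : set R) : measurable A -> measurable_fun [set: R] (fun y => \1_A y * f y).
  by move=> mA; solve_mfun.
rewrite -!jump_meanD//.
all: try by [exact: mi | exact: i0].
all: try by apply: measurable_funD; exact: mi.
all: try by move=> y y0; rewrite addr_ge0// i0.
apply: eq_jump_mean => y y0; rewrite !indicE !mem_setE !in_itv/= y0 andbT/=.
have [ya|ay] := leP y a.
  by rewrite (ltNge b) (le_trans ya ab)/= mul1r !mul0r !addr0.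
by have [yb|yb] := leP y b; rewrite /= mul1r !mul0r !add0r ?addr0.
Qed.

(** The jumps are split at [z * d] and [z / d]. A jump below the window changes the power by at most
    [z^(beta - 1) * y]; above it, both [|z - y|^beta] and [z^beta] are at most [y^beta]; each of
    these parts costs a multiple of [d^(1 - alpha) * z^(beta - alpha)]. Inside the window the
    density is nearly a pure power, and the exact integral gives [w' - w]. The constants are chosen
    in the order [d], [e], [A]. *)
Lemma critical_drift eta : 0 < eta -> exists2 A : R, 0 < A &
  forall z, A <= z -> exists2 t : R,
    E (fun y => `|z - y| `^ beta) = t%:E &
    `|t - z `^ beta| <= eta * z `^ (beta - alpha).
Proof.
move=> eta0.
have [C1 C10 hC1] := jump_mean_trunc_le hv alpha1.
have ba : beta < alpha by have := alpha1; lra.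
have [C3 C30 hC3] := jump_mean_tail_le hv ba.
have [m m0 hm] := jump_mean_powR_fin hv (ltW beta0) ba.
pose K := 4 * c + C1 + C3.
have K0 : 0 < K by rewrite !addr_gt0// mulr_gt0.
have a1' : 0 < 1 - alpha by rewrite subr_gt0.
(* Makes [K * d^(1 - alpha)] at most [eta / 2]; in [K], the summand [4 * c] answers for [w' - w],
   and [C1], [C3] for the jumps outside the window. *)
pose d : R := Num.min (1 / 2) ((eta / (2 * K)) `^ (1 - alpha)^-1).
have d0 : 0 < d by rewrite lt_min divr_gt0//= powR_gt0// divr_gt0// mulr_gt0.
have d1 : d < 1 by rewrite gt_min; apply/orP; left; lra.
have d01 : 0 < d < 1 by rewrite d0.
have dK : K * d `^ (1 - alpha) <= eta / 2.
  have : d `^ (1 - alpha) <= eta / (2 * K).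
    have dl : d <= (eta / (2 * K)) `^ (1 - alpha)^-1 by rewrite ge_min lexx orbT.
    apply: le_trans (le_powR (ltW a1') (ltW d0) dl) _.
    by rewrite -powRrM mulVf ?gt_eqF// powRr1// divr_ge0// ltW// mulr_gt0.
  rewrite ler_pdivlMr ?mulr_gt0//; lra.
(* Chosen after [d]: the error [e] of the density is multiplied by [w + w'], which is only bounded
   by [4 * d^(- alpha)]. *)
pose e := Num.min c (eta / 8 * d `^ alpha).
have e0 : 0 < e by rewrite lt_min c0/= mulr_gt0 ?powR_gt0// divr_gt0.
have ec : 0 <= e <= c by rewrite ltW//= ge_min lexx.
have ed : e * (4 * d `^ (- alpha)) <= eta / 2.
  have he : e <= eta / 8 * d `^ alpha by rewrite ge_min lexx orbT.
  apply: le_trans (ler_wpM2r _ he) _; first by rewrite mulr_ge0// powR_ge0.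
  have dd : d `^ alpha * d `^ (- alpha) = 1 by rewrite -powRDp// subrr powRr0.
  rewrite [leLHS](_ : _ = eta / 2 * (d `^ alpha * d `^ (- alpha))); last by field.
  by rewrite dd mulr1.
have [Y Y0 hY] := classD_asymptotic hv e0.
have [hw w0 w'0 hww] := weight_bounds d01.
set w := (d `^ (- alpha) - d `^ alpha) / alpha in hw w0 hww.
set w' := (1 - d) `^ (2 * alpha) * d `^ (- alpha) / alpha in hw w'0 hww.
(* Puts the whole window beyond [Y], where the density is controlled. *)
exists (Y / d); first by rewrite divr_gt0.
move=> z; rewrite ler_pdivrMr// => Yz.
have zd0 : 0 < z * d by apply: lt_le_trans Yz.
have z0 : 0 < z by move: zd0; rewrite pmulr_lgt0.
have zd'0 : 0 < z / d by rewrite divr_gt0.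
have zd : z * d <= z by rewrite ger_pMr// ltW.
have zd' : z <= z / d by rewrite ler_pdivlMr// ger_pMr// ltW.
have zdd := le_trans zd zd'.
pose f y : R := `|z - y| `^ beta.
have f0 y : 0 <= f y by exact: powR_ge0.
have mf : measurable_fun [set: R] f by rewrite /f; solve_mfun.
have b01 : 0 <= beta <= 1 by rewrite ltW//=; have := alpha1; lra.
have fle y : 0 < y -> f y <= z `^ beta + y `^ beta.
  move=> y0; apply: le_trans (powR_subadditive b01 (ltW z0) (ltW y0)).
  apply: le_powR; [exact: ltW|exact: normr_ge0|].
  by rewrite (le_trans (ler_normB _ _))// !gtr0_norm.
have Efin : (E f <= (z `^ beta + m)%:E)%E.
  rewrite EFinD -hm -[X in (X + _)%E](jump_mean_cst mv v0 v1) ?powR_ge0//.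
  rewrite -jump_meanD; solve_side.
  by apply: le_jump_mean; solve_side.
set I1 : set R := `]0%R, (z * d)%R]%classic.
set I2 : set R := `](z * d)%R, (z / d)%R]%classic.
set I3 : set R := `](z / d)%R, +oo[%classic.
have mI1 : measurable I1 by exact: measurable_itv.
have mI2 : measurable I2 by exact: measurable_itv.
have mI3 : measurable I3 by exact: measurable_itv.
have ind0 (A : set R) y : 0 <= (\1_A y : R) by rewrite indicE ler0n.
have pieces (A : set R) (g : R -> R) (r : R) : measurable A -> measurable_fun [set: R] g ->
    (forall y, 0 < y -> 0 <= g y) -> (E g <= r%:E)%E ->
    exists2 s : R, 0 <= s & E (fun y => \1_A y * g y) = s%:E.
  move=> mA mg g0 gr.
  have [||s /andP[s0 _] hs] := @ge0_fin_numP _ (E (fun y => \1_A y * g y)) r.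
  - by apply: jump_mean_ge0 => // y y0; rewrite mulr_ge0// g0.
  - apply: le_trans gr; apply: le_jump_mean => //.
    + solve_mfun.
    + by move=> y y0; rewrite mulr_ge0// g0.
    + by move=> y y0; rewrite ler_piMl ?g0// indicE lern1 leq_b1.
  - by exists s.
have E1 : (E (fun=> 1) <= 1%:E)%E by rewrite (jump_mean_cst mv v0 v1).
have [x1 x10 X1] := pieces I1 f _ mI1 mf (fun y _ => f0 y) Efin.
have [x2 x20 X2] := pieces I2 f _ mI2 mf (fun y _ => f0 y) Efin.
have [x3 x30 X3] := pieces I3 f _ mI3 mf (fun y _ => f0 y) Efin.
have m1 : measurable_fun [set: R] (fun=> 1 : R) by exact: measurable_cst.
have [p1 p10 P1] := pieces I1 (fun=> 1) _ mI1 m1 (fun _ _ => ler01) E1.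
have [p2 p20 P2] := pieces I2 (fun=> 1) _ mI2 m1 (fun _ _ => ler01) E1.
have [p3 p30 P3] := pieces I3 (fun=> 1) _ mI3 m1 (fun _ _ => ler01) E1.
have psum : p1 + p2 + p3 = 1.
  have := jump_mean_split (ltW zd0) zdd m1 (fun _ _ => ler01).
  by rewrite (jump_mean_cst mv v0 v1)// P1 P2 P3 -!EFinD => -[].
have tE := jump_mean_split (ltW zd0) zdd mf (fun y _ => f0 y).
rewrite X1 X2 X3 -!EFinD in tE.
exists (x1 + x2 + x3) => //.
set Z := z `^ beta.
have Z0 : 0 < Z by exact: powR_gt0.
pose e1 := C1 * d `^ (1 - alpha) * z `^ (beta - alpha).
pose e3 := C3 * d `^ (1 - alpha) * z `^ (beta - alpha).
have ha : x1 <= Z * p1.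
  rewrite -lee_fin EFinM -P1 -X1 -jump_meanZ; solve_side.
  apply: le_jump_mean; solve_side.
  move=> y y0; rewrite mulr1 mulrC indicE mem_setE in_itv/= y0/=.
    have [yz|] := leP y (z * d); last by rewrite !mulr0.
    rewrite !mulr1 le_powR//; first exact: ltW.
    have h : y <= z by exact: le_trans yz zd.
    by rewrite ger0_norm; move: h y0; clear -alpha12 alpha1 c0 hv alpha0 beta0
      mv v0 v1 sandwich integral_weight weight_bounds
      jump_mean_split; lra.
have hb : Z * p1 <= x1 + e1.
  have hq : ((z `^ (beta - 1))%:E * E (fun y => \1_I1 y * y) <= e1%:E)%E.
    apply: le_trans (lee_wpmul2l _ (hC1 _ zd0)) _; first by rewrite lee_fin powR_ge0.
    rewrite -EFinM lee_fin /e1 powRM ?(ltW z0) ?(ltW d0)//.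
    rewrite [leLHS](_ : _ =
      C1 * d `^ (1 - alpha) * (z `^ (beta - 1) * z `^ (1 - alpha))); last by ring.
    have -> : beta - alpha = (beta - 1) + (1 - alpha) by ring.
    by rewrite (powRDp (beta - 1) _ z0).
  rewrite -lee_fin EFinM EFinD -P1 -X1.
  apply: le_trans (leeD2l _ hq).
  rewrite -!jump_meanZ ?powR_ge0; solve_side.
  rewrite -jump_meanD; solve_side.
  apply: le_jump_mean; solve_side.
  move=> y y0; rewrite indicE mem_setE in_itv/= y0/=.
    have [yz|] := leP y (z * d); last by rewrite !(mulr0, mul0r) addr0.
    rewrite !(mulr1, mul1r).
    have h : y <= z by exact: le_trans yz zd.
    (* [u <= u `^ beta] for [u = 1 - y / z] in [0, 1] *)
    have h1 : 0 <= 1 - y / z by rewrite subr_ge0 ler_pdivrMr// mul1r.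
    have h2 : 1 - y / z <= (1 - y / z) `^ beta.
      move: h1; rewrite le_eqVlt => /predU1P[<-|h1]; first exact: powR_ge0.
      apply: ger1_powR; last by case/andP: b01.
      by rewrite h1/= gerDl oppr_le0 divr_ge0// ltW.
    have fE : f y = Z * (1 - y / z) `^ beta.
      rewrite /f /Z -powRM ?(ltW z0)//; congr (_ `^ _).
      by rewrite ger0_norm ?subr_ge0// mulrBr mulr1 mulrCA divff ?gt_eqF// mulr1.
    have ZE : z `^ (beta - 1) = Z / z.
      by rewrite powRDp// powR_inv1// ltW.
    rewrite fE ZE -mulrA [z^-1 * y]mulrC -mulrDr ler_peMr ?(ltW Z0)//.
    by move: h2; clear -alpha12 alpha1 c0 hv alpha0 beta0
      mv v0 v1 sandwich integral_weight weight_bounds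
      jump_mean_split; lra.
have E3 : (E (fun y => \1_I3 y * y `^ beta) <= e3%:E)%E.
  apply: le_trans (hC3 _ zd'0) _; rewrite lee_fin /e3.
  rewrite powRM ?invr_ge0 ?(ltW z0) ?(ltW d0)// -(powR_inv1 (ltW d0)) -powRrM.
  rewrite (_ : -1 * (beta - alpha) = 1 - alpha); last by ring.
  by rewrite [leLHS](_ : _ = C3 * d `^ (1 - alpha) * z `^ (beta - alpha))//; ring.
have hc1 : x3 <= e3.
  rewrite -lee_fin -X3; apply: le_trans E3; apply: le_jump_mean; solve_side.
  move=> y y0; rewrite indicE mem_setE in_itv/= andbT.
    have [yz|] := ltP (z / d) y; last by rewrite !mul0r.
    rewrite !mul1r le_powR//; first exact: ltW.
    have h : z <= y by exact: le_trans zd' (ltW yz).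
    by rewrite ler0_norm; move: h z0; clear -alpha12 alpha1 c0 hv alpha0 beta0
      mv v0 v1 sandwich integral_weight weight_bounds
      jump_mean_split; lra.
have hc2 : Z * p3 <= e3.
  rewrite -lee_fin EFinM -P3; apply: le_trans E3.
  rewrite -jump_meanZ; solve_side.
  apply: le_jump_mean; solve_side.
  move=> y y0; rewrite indicE mem_setE in_itv/= andbT mulr1.
    have [yz|] := ltP (z / d) y; last by rewrite mul0r mulr0.
    rewrite mul1r mulr1 le_powR//; [exact: ltW|exact: ltW|].
    exact: le_trans zd' (ltW yz).
have AY y : I2 y -> 0 < Y /\ Y <= y.
  by rewrite /I2/= in_itv/= => /andP[h _]; split => //; apply: le_trans Yz (ltW h).
have [d1l d1u] := sandwich mI2 AY mf f0 ec hY.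
have [d2l d2u] := sandwich mI2 AY m1 (fun=> ler01) ec hY.
have wE := integral_weight z0 d01.
have w'E : (\int[mu]_(y in I2) (f y * y `^ (- 1 - alpha))%:E =
    (z `^ (beta - alpha) * w')%:E)%E.
  rewrite -(integral_critical alpha12 z0 d01).
  rewrite integral_itv_obnd_cbnd//.
  by apply/measurable_EFinP/measurable_funTS; rewrite /f; solve_mfun.
have wE' : (\int[mu]_(y in I2) (1 * y `^ (- 1 - alpha))%:E =
    (z `^ (- alpha) * w)%:E)%E.
  by under eq_integral do rewrite mul1r; exact: wE.
rewrite w'E X2 -EFinM lee_fin in d1l; rewrite w'E X2 -EFinM lee_fin in d1u.
rewrite wE' P2 -EFinM lee_fin in d2l; rewrite wE' P2 -EFinM lee_fin in d2u.
set S := z `^ (beta - alpha).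
have S0 : 0 < S by exact: powR_gt0.
have ZS : Z * z `^ (- alpha) = S by rewrite /S powRDp.
have d2l' : (c - e) * (S * w) <= Z * p2.
  rewrite -ZS; move: d2l; rewrite -(ler_pM2l Z0); clear -alpha12 alpha1 c0 hv alpha0 beta0
      mv v0 v1 sandwich integral_weight weight_bounds
      jump_mean_split; lra.
have d2u' : Z * p2 <= (c + e) * (S * w).
  rewrite -ZS; move: d2u; rewrite -(ler_pM2l Z0); clear -alpha12 alpha1 c0 hv alpha0 beta0
      mv v0 v1 sandwich integral_weight weight_bounds
      jump_mean_split; lra.
have Zsum : Z * p1 + Z * p2 + Z * p3 = Z by rewrite -!mulrDr psum mulr1.
have p3' : 0 <= Z * p3 by rewrite mulr_ge0// ltW.
have final : S * (c * `|w' - w| + e * (w + w') + (C1 + C3) * d `^ (1 - alpha)) <= eta * S.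
  rewrite mulrC ler_pM2r//.
  have : c * `|w' - w| <= c * (4 * d `^ (1 - alpha)) by rewrite ler_pM2l.
  have : e * (w + w') <= e * (4 * d `^ (- alpha)) by rewrite ler_pM2l.
  move: dK ed; rewrite /K; clear -alpha12 alpha1 c0 hv alpha0 beta0
      mv v0 v1 sandwich integral_weight weight_bounds
      jump_mean_split; lra.
apply: le_trans final.
have hn1 : S * c * (w' - w) <= S * c * `|w' - w|.
  by rewrite ler_wpM2l ?ler_norm// mulr_ge0 ?ltW.
have hn2 : - (S * c * (w' - w)) <= S * c * `|w' - w|.
  by rewrite -mulrN ler_wpM2l// ?mulr_ge0 ?(ltW S0) ?(ltW c0)// -normrN ler_norm.
rewrite /e1 /e3 in ha hb hc1 hc2.
rewrite -!/S in d1l d1u hb hc1 hc2.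
have e1p : 0 <= C1 * d `^ (1 - alpha) * S by rewrite !mulr_ge0 ?powR_ge0 ?ltW.
clear -alpha12 alpha1 c0 hv alpha0 beta0
      mv v0 v1 sandwich integral_weight weight_bounds
      jump_mean_split ha hb hc1 hc2 d1l d1u d2l' d2u' Zsum p3' hn1 hn2 e1p x30.
rewrite ler_norml; apply/andP; split; lra.
Qed.

End critical_drift.

(** * Drift below and above the critical exponent *)

Section drift.
Context {R : realType} (alpha c : R) (v : R -> R).
Hypotheses (alpha0 : 0 < alpha) (c0 : 0 < c) (hv : classD alpha c v).
Local Notation E f := (jump_mean v f%R).

Let mv := classD_measurable hv.
Let v0 := classD_ge0 hv.
Let v1 := integral_classD hv.

Let le_mean f g := @le_jump_mean R v mv v0 f g.
Let meanD f g := @jump_meanD R v mv v0 f g.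
Let meanZ k f := @jump_meanZ R v mv v0 k f.
Let mean_cst k := @jump_mean_cst R v mv v0 v1 k.

Lemma jump_mean_norm_powR_le s z : 0 <= s <= 1 -> 0 < z ->
  (E (fun y => `|z - y| `^ s) <= (z `^ s)%:E + E (fun y => y `^ s))%E.
Proof.
move=> s01 z0; have /andP[s0 s1] := s01.
rewrite -mean_cst ?powR_ge0// -meanD; solve_side.
apply: le_mean; solve_side.
move=> y y0; apply: le_trans (powR_subadditive s01 (ltW z0) (ltW y0)).
apply: le_powR => //.
by rewrite (le_trans (ler_normB _ _))// !gtr0_norm.
Qed.

Let tail_powR_scale (rho z : R) : 0 < rho -> 0 < z ->
  (rho * z) `^ (- alpha) = rho `^ (- alpha) * z `^ (- alpha).
Proof. by move=> r0 z0; rewrite powRM// ltW. Qed.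

Let rescale (b g z y : R) : 0 < b -> 0 < z ->
  (`|z - y| `^ b / z `^ b) `^ (g / b) * z `^ g = `|z - y| `^ g.
Proof.
move=> b0 z0; rewrite powRM ?powR_ge0 ?invr_ge0 ?powR_ge0//.
rewrite -(powR_inv1 (powR_ge0 z b)) -!powRrM.
have bg : b * (g / b) = g by rewrite mulrCA divff ?mulr1// gt_eqF.
rewrite bg -mulrA -powRDp//.
by rewrite (_ : b * (-1 * (g / b)) + g = 0) ?powRr0 ?mulr1// mulrCA bg; ring.
Qed.

(** Such a jump crosses the origin and lands at distance at least [R1^(1 / b) * z]. *)
Let tail_large (b R1 z y : R) : 0 < b -> 0 < z -> 0 <= R1 ->
  (1 + R1 `^ b^-1) * z < y -> R1 <= `|z - y| `^ b / z `^ b.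
Proof.
move=> b0 z0 R10 hy; rewrite ler_pdivlMr ?powR_gt0//.
have h : R1 `^ b^-1 * z <= `|z - y|.
  by rewrite distrC (le_trans _ (ler_norm _))//; move: hy; rewrite mulrDl mul1r; lra.
have := le_powR (ltW b0) _ h.
rewrite powRM ?powR_ge0 ?(ltW z0)// -powRrM mulVf ?gt_eqF// powRr1//.
by apply; rewrite mulr_ge0 ?powR_ge0// ltW.
Qed.

Section critical_range.
Hypotheses (alpha12 : 1 / 2 < alpha) (alpha1 : alpha < 1).
Local Notation beta := (2 * alpha - 1).
Let beta0 : 0 < beta. Proof. by have := alpha12; lra. Qed.

(* Concavity of [s `^ (g / beta)] at [s = 1] compares the drift of [|z| `^ g]
   with the negligible drift of [|z| `^ beta]; the gain comes from the jumps
   larger than a multiple of [z]. *)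
Lemma subcritical_drift_lt1 g : 0 < g < beta -> exists eps A : R,
  [/\ 0 < eps, 0 < A & forall z, A <= z ->
    (E (fun y => `|z - y| `^ g) <= (z `^ g - eps * z `^ (g - alpha))%:E)%E].
Proof.
move=> /andP[g0 gb].
pose th := g / beta.
have th0 : 0 < th by rewrite divr_gt0.
have th1 : th < 1 by rewrite ltr_pdivrMr// mul1r.
have th1' : 0 < 1 - th by rewrite subr_gt0.
(* From [R1] on, [s^th <= th * s], so the tangent bound [th * s + (1 - th)] is improved by the full
   constant [1 - th]. *)
pose R1 := th `^ (- (1 - th)^-1).
have R10 : 0 < R1 by exact: powR_gt0.
pose rho := 1 + R1 `^ beta^-1.
have rho0 : 0 < rho by rewrite addr_gt0// powR_gt0.
have [k [Y [k0 Y0 hY]]] := jump_mean_tail_ge alpha0 c0 hv.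
pose G := (1 - th) * (k * rho `^ (- alpha)).
have G0 : 0 < G by rewrite !mulr_gt0// powR_gt0.
(* With this [eta] the critical drift, multiplied by [th], consumes half of the gain [G]. *)
have eta0 : 0 < G / (2 * th) by rewrite divr_gt0// mulr_gt0.
have [A1 A10 hA1] := critical_drift alpha12 alpha1 c0 hv eta0.
exists (G / 2), (Num.max A1 (Y / rho)); split.
- by rewrite divr_gt0.
- by rewrite lt_max A10.
move=> z; rewrite ge_max => /andP[Az]; rewrite ler_pdivrMr// mulrC => Yz.
have z0 : 0 < z by apply: lt_le_trans Az.
have [t tE ht] := hA1 z Az.
pose I : set R := `](rho * z)%R, (2 * (rho * z))%R]%classic.
have mI : measurable I by exact: measurable_itv.
have Zb : z `^ (g - beta) * z `^ beta = z `^ g.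
  by rewrite -powRDp// subrK.
have Za : z `^ (g - beta) * z `^ (beta - alpha) = z `^ (g - alpha).
  by rewrite -powRDp//; congr (_ `^ _); ring.
have pw y : 0 < y -> `|z - y| `^ g + (1 - th) * z `^ g * \1_I y <=
    (1 - th) * z `^ g + th * z `^ (g - beta) * `|z - y| `^ beta.
  move=> y0; rewrite -(rescale g y beta0 z0) -/th.
  set s := _ / _.
  have s0 : 0 <= s by rewrite divr_ge0 ?powR_ge0.
  have -> : th * z `^ (g - beta) * `|z - y| `^ beta = th * s * z `^ g.
    by rewrite -Zb /s; field; rewrite gt_eqF ?powR_gt0.
  rewrite -mulrA [z `^ g * _]mulrC mulrA -!mulrDl ler_pM2r ?powR_gt0//.
  rewrite indicE mem_setE in_itv/=.
  case: (boolP (rho * z < y <= _)) => [/andP[hy _]|_] /=; last first.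
    by rewrite mulr0 addr0 addrC powR_le_tangent// th0 ltW.
  rewrite mulr1 addrC lerD2l.
  have hs := tail_large beta0 z0 (ltW R10) hy.
  have s0' : 0 < s by apply: lt_le_trans R10 hs.
  rewrite -[in leLHS](subrK 1 th) powRDp// powRr1// ler_pM2r//.
  rewrite -(opprB 1 th) powRN -[leRHS]invrK lef_pV2 ?posrE ?invr_gt0 ?powR_gt0//.
  apply: le_trans (le_powR (ltW th1') (ltW R10) hs).
  by rewrite /R1 -powRrM mulNr mulVf ?gt_eqF// powR_inv1// ltW.
have hp : ((k * (rho * z) `^ (- alpha))%:E <= E \1_I)%E by exact: hY.
have : (E (fun y => `|z - y| `^ g) + ((1 - th) * z `^ g * (k * (rho * z) `^ (- alpha)))%:E
   <= ((1 - th) * z `^ g + th * z `^ (g - beta) * t)%:E)%E.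
  have c1 : 0 <= (1 - th) * z `^ g by rewrite mulr_ge0 ?powR_ge0// ltW.
  have c2 : 0 <= th * z `^ (g - beta) by rewrite mulr_ge0 ?powR_ge0// ltW.
  rewrite [((_ * (k * _))%:E)%E]EFinM.
  apply: le_trans (leeD2l _ (lee_wpmul2l _ hp)) _; first by rewrite lee_fin.
  rewrite [in leRHS]EFinD [(_ * t)%:E]EFinM -tE.
  rewrite -!meanZ//; solve_side.
  rewrite -(mean_cst c1) -!meanD; solve_side.
  by apply: le_mean => //; solve_side.
case: (E _) => [e||]; rewrite ?leNye//; rewrite -EFinD !lee_fin => he.
have ht2 : t <= z `^ beta + G / (2 * th) * z `^ (beta - alpha).
  by move: ht; rewrite ler_norml => /andP[_]; lra.
have ht3 : th * z `^ (g - beta) * t <= th * z `^ g + G / 2 * z `^ (g - alpha).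
  rewrite -Zb -Za.
  rewrite [leRHS](_ : _ = th * z `^ (g - beta) * (z `^ beta + G / (2 * th) * z `^ (beta - alpha))).
    by rewrite ler_pM2l// mulr_gt0// powR_gt0.
  by field; rewrite gt_eqF.
move: he; rewrite tail_powR_scale//.
have -> : (1 - th) * z `^ g * (k * (rho `^ (- alpha) * z `^ (- alpha))) = G * z `^ (g - alpha).
  by rewrite powRDp// /G; ring.
lra.
Qed.

(** Here [th = g / beta] exceeds 1 and [s^th] lies above its tangent. Jumps larger than [rho * z]
    give the gain [G], and the critical drift is taken with [eta = G / th], so that it is exactly
    compensated. *)
Lemma supercritical_drift g : beta < g -> g < alpha -> exists2 A : R,
  0 < A & forall z, A <= z -> ((z `^ g)%:E <= E (fun y => `|z - y| `^ g))%E.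
Proof.
move=> gb ga.
pose th := g / beta.
have th1 : 1 < th by rewrite ltr_pdivlMr// mul1r.
have th0 : 0 < th by rewrite (lt_trans ltr01).
have th1' : 0 < th - 1 by rewrite subr_gt0.
pose R1 := th `^ (th - 1)^-1.
have R10 : 0 < R1 by exact: powR_gt0.
pose rho := 1 + R1 `^ beta^-1.
have rho0 : 0 < rho by rewrite addr_gt0// powR_gt0.
have [k [Y [k0 Y0 hY]]] := jump_mean_tail_ge alpha0 c0 hv.
pose G := (th - 1) * (k * rho `^ (- alpha)).
have G0 : 0 < G by rewrite !mulr_gt0// powR_gt0.
have eta0 : 0 < G / th by rewrite divr_gt0.
have [A1 A10 hA1] := critical_drift alpha12 alpha1 c0 hv eta0.
exists (Num.max A1 (Y / rho)); first by rewrite lt_max A10.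
move=> z; rewrite ge_max => /andP[Az]; rewrite ler_pdivrMr// mulrC => Yz.
have z0 : 0 < z by apply: lt_le_trans Az.
have [t tE ht] := hA1 z Az.
pose I : set R := `](rho * z)%R, (2 * (rho * z))%R]%classic.
have mI : measurable I by exact: measurable_itv.
have Zb : z `^ (g - beta) * z `^ beta = z `^ g.
  by rewrite -powRDp// subrK.
have Za : z `^ (g - beta) * z `^ (beta - alpha) = z `^ (g - alpha).
  by rewrite -powRDp//; congr (_ `^ _); ring.
have pw y : 0 < y -> (th - 1) * z `^ g * \1_I y + th * z `^ (g - beta) * `|z - y| `^ beta
    <= `|z - y| `^ g + (th - 1) * z `^ g.
  move=> y0; rewrite -(rescale g y beta0 z0) -/th.
  set s := _ / _.
  have s0 : 0 <= s by rewrite divr_ge0 ?powR_ge0.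
  have -> : th * z `^ (g - beta) * `|z - y| `^ beta = th * s * z `^ g.
    by rewrite -Zb /s; field; rewrite gt_eqF ?powR_gt0.
  rewrite -mulrA [z `^ g * _]mulrC mulrA -!mulrDl ler_pM2r ?powR_gt0//.
  rewrite indicE mem_setE in_itv/=.
  case: (boolP (rho * z < y <= _)) => [/andP[hy _]|_] /=; last first.
    by have := powR_ge_tangent s0 (ltW th1); lra.
  rewrite mulr1 addrC lerD2r.
  have hs := tail_large beta0 z0 (ltW R10) hy.
  have s0' : 0 < s by apply: lt_le_trans R10 hs.
  rewrite -[in leRHS](subrK 1 th) powRDp// powRr1// ler_pM2r//.
  apply: le_trans (le_powR (ltW th1') (ltW R10) hs).
  by rewrite /R1 -powRrM mulVf ?gt_eqF// powRr1// ltW.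
have hp : ((k * (rho * z) `^ (- alpha))%:E <= E \1_I)%E by exact: hY.
have : (((th - 1) * z `^ g * (k * (rho * z) `^ (- alpha)) + th * z `^ (g - beta) * t)%:E
   <= E (fun y => `|z - y| `^ g) + ((th - 1) * z `^ g)%:E)%E.
  have c1 : 0 <= (th - 1) * z `^ g by rewrite mulr_ge0 ?powR_ge0// ltW.
  have c2 : 0 <= th * z `^ (g - beta) by rewrite mulr_ge0 ?powR_ge0// ltW.
  rewrite EFinD [((_ * (k * _))%:E)%E]EFinM.
  apply: le_trans (leeD2r _ (lee_wpmul2l _ hp)) _; first by rewrite lee_fin.
  rewrite [(_ * t)%:E]EFinM -tE.
  rewrite -!meanZ//; solve_side.
  rewrite -(mean_cst c1) -!meanD; solve_side.
  by apply: le_mean => //; solve_side.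
case: (E _) => [e||]; rewrite ?leey//; rewrite -EFinD !lee_fin => he.
have ht2 : z `^ beta - G / th * z `^ (beta - alpha) <= t.
  by move: ht; rewrite ler_norml => /andP[+ _]; lra.
have ht3 : th * z `^ g - G * z `^ (g - alpha) <= th * z `^ (g - beta) * t.
  rewrite -Zb -Za.
  rewrite [leLHS](_ : _ = th * z `^ (g - beta) * (z `^ beta - G / th * z `^ (beta - alpha))).
    by rewrite ler_pM2l// mulr_gt0// powR_gt0.
  by field; rewrite gt_eqF.
move: he; rewrite tail_powR_scale//.
have -> : (th - 1) * z `^ g * (k * (rho `^ (- alpha) * z `^ (- alpha))) = G * z `^ (g - alpha).
  by rewrite powRDp// /G; ring.
lra.
Qed.

End critical_range.

End drift.

(** * The case [alpha = 1], and killing near the origin *)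

Section killed_drift.
Context {R : realType} (alpha c : R) (v : R -> R).
Hypotheses (alpha0 : 0 < alpha) (c0 : 0 < c) (hv : classD alpha c v).
Local Notation E f := (jump_mean v f%R).

Let mv := classD_measurable hv.
Let v0 := classD_ge0 hv.
Let v1 := integral_classD hv.

Let le_mean f g := @le_jump_mean R v mv v0 f g.
Let meanD f g := @jump_meanD R v mv v0 f g.
Let meanZ k f := @jump_meanZ R v mv v0 k f.
Let mean_cst k := @jump_mean_cst R v mv v0 v1 k.

(* For [alpha = 1] the truncated mean diverges. *)
Let truncated_mean_unbounded : alpha = 1 -> forall B : R,
  exists2 A : R, 0 < A & forall z, A <= z ->
    (B%:E <= E (fun y => \1_(`]0%R, z]%classic : set R) y * y))%E.
Proof.
move=> a1 B; have [k [Y [k0 Y0 hY]]] := jump_mean_tail_ge alpha0 c0 hv.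
pose e (z : R) := E (fun y => \1_(`]0%R, z]%classic : set R) y * y).
(* On ]b, 2 b] the mass is at least [k / b] and the jumps exceed [b], so doubling the cut-off adds
   at least [k]. *)
have double b : Y <= b -> (e b + k%:E <= e (2 * b)%R)%E.
  move=> Yb; have b0 : 0 < b by apply: lt_le_trans Yb.
  have hk : (k%:E <= b%:E * E \1_(`]b, (2 * b)%R]%classic : set R))%E.
    apply: le_trans (lee_wpmul2l _ (hY b Yb)); last by rewrite lee_fin ltW.
    by rewrite a1 -EFinM lee_fin powR_inv1 ?(ltW b0)// mulrCA divff ?mulr1// gt_eqF.
  apply: le_trans (leeD2l _ hk) _.
  rewrite -meanZ; solve_side.
  rewrite /e -meanD; solve_side.
  apply: le_mean; solve_side.
  move=> y y0; rewrite !indicE !mem_setE !in_itv/= y0/=.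
  have [yb|yb] := leP y b; first by rewrite (le_trans yb) ?mulr0 ?addr0//; lra.
  by rewrite mul0r add0r; case: (y <= _); rewrite ?mul1r ?mulr1 ?mulr0 ?mul0r// ltW.
have iter n : ((n%:R * k)%:E <= e (2 ^+ n * Y)%R)%E.
  elim: n => [|n IH].
    by rewrite mul0r; apply: jump_mean_ge0 => // y y0; solve_ge0.
  rewrite exprS -mulrA; apply: le_trans (double _ _).
    by rewrite -natr1 mulrDl mul1r EFinD leeD2r.
  by rewrite ler_peMl ?(ltW Y0)// exprn_ege1// ler1n.
exists (2 ^+ (Num.bound (B / k)) * Y); first by rewrite mulr_gt0// exprn_gt0.
move=> z hz.
apply: le_trans (le_trans (iter (Num.bound (B / k))) _).
  rewrite lee_fin -ler_pdivrMr// (le_trans (ler_norm _))//.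
  rewrite ltW//; have := archi_boundP (normr_ge0 (B / k)).
  by rewrite /Num.bound normr_id.
apply: le_mean; solve_side.
move=> y y0; apply: ler_wpM2r; first exact: ltW.
rewrite !indicE !mem_setE !in_itv/= y0/= ler_nat.
by case: (leP y (2 ^+ _ * Y)) => // h; rewrite (le_trans h hz).
Qed.

(** A jump [y <= z] lowers [z^g] by at least [g * z^(g - 1) * y], by the tangent at 1; a larger one
    contributes at most the tail [C * z^(g - 1)]. Once the truncated mean exceeds [(C + 1) / g], the
    gain beats the tail with margin [z^(g - 1)], hence [eps = 1]. *)
Let subcritical_drift_eq1 g : alpha = 1 -> 0 < g < 1 -> exists eps A : R,
  [/\ 0 < eps, 0 < A & forall z, A <= z ->
    (E (fun y => `|z - y| `^ g) <= (z `^ g - eps * z `^ (g - alpha))%:E)%E].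
Proof.
move=> a1 /andP[g0 g1].
have ga : g < alpha by rewrite a1.
have [C C0 hC] := jump_mean_tail_le hv ga.
have [A A0 hA] := truncated_mean_unbounded a1 ((C + 1) / g).
exists 1, A; split => // z Az.
have z0 : 0 < z by apply: lt_le_trans Az.
have c1 : 0 <= g * z `^ (g - 1) by rewrite mulr_ge0 ?powR_ge0 ?ltW.
have c2 : 0 <= z `^ g by exact: powR_ge0.
have pw y : 0 < y ->
   `|z - y| `^ g + (g * z `^ (g - 1)) * (\1_(`]0%R, z]%classic : set R) y * y) <=
   z `^ g + \1_(`]z, +oo[%classic : set R) y * y `^ g.
  move=> y0; rewrite !indicE !mem_setE !in_itv/= y0 andbT/=.
  have [yz|zy] := leP y z; last first.
    rewrite !mul0r mulr0 addr0 mul1r ler_wpDl// le_powR ?(ltW g0)//.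
    by rewrite ler0_norm; lra.
  rewrite mul0r addr0 mul1r ger0_norm ?subr_ge0//.
  have h1 : 0 <= 1 - y / z by rewrite subr_ge0 ler_pdivrMr// mul1r.
  have := @powR_le_tangent R g _ h1; rewrite g0 ltW// => /(_ isT).
  have -> : z - y = z * (1 - y / z) by field; rewrite gt_eqF.
  rewrite powRM ?(ltW z0)// -(ler_pM2l (powR_gt0 g z0)) => h.
  rewrite powRDp// powR_inv1 ?(ltW z0)//.
  apply: le_trans (lerD h (lexx _)) _.
  by rewrite le_eqVlt; apply/orP; left; apply/eqP; field; rewrite gt_eqF.
have : (E (fun y => `|z - y| `^ g) + ((C + 1) * z `^ (g - 1))%:E <=
    (z `^ g + C * z `^ (g - 1))%:E)%E.
  have h1 : (((C + 1) * z `^ (g - 1))%:E <= (g * z `^ (g - 1))%:E *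
     E (fun y => \1_(`]0%R, z]%classic : set R) y * y))%E.
    apply: le_trans (lee_wpmul2l _ (hA z Az)); last by rewrite lee_fin.
    by rewrite -EFinM lee_fin le_eqVlt; apply/orP; left; apply/eqP; field; rewrite gt_eqF.
  have h2 := hC z z0; rewrite a1 in h2.
  apply: le_trans (leeD2l _ h1) _; rewrite EFinD; apply: le_trans (leeD2l _ h2).
  rewrite -meanZ; solve_side.
  rewrite -(mean_cst c2) -!meanD; solve_side.
  by apply: le_mean; solve_side.
rewrite a1.
case: (E _) => [e||]; rewrite ?leNye//; rewrite -EFinD !lee_fin; lra.
Qed.

Lemma subcritical_drift g : 1 / 2 < alpha -> alpha <= 1 -> 0 < g < 2 * alpha - 1 ->
  exists eps A : R, [/\ 0 < eps, 0 < A & forall z, A <= z ->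
    (E (fun y => `|z - y| `^ g) <= (z `^ g - eps * z `^ (g - alpha))%:E)%E].
Proof.
move=> a12; rewrite le_eqVlt => /predU1P[a1|a1] hg.
  by apply: subcritical_drift_eq1 => //; move: hg; rewrite a1; lra.
exact: (subcritical_drift_lt1 alpha0 c0 hv a12 a1 hg).
Qed.

(* Finitely many cells of mesh [a] cover ]0, A], and a jump from [z] whose size
   lies in the cell of [z] ends in [- a, a]. *)
Lemma killing_probability a A : 0 < a -> exists2 p : R, 0 < p < 1 &
  forall z, 0 < z -> z <= A ->
    (E (fun y => beyond a `|z - y|) <= (1 - p)%:E)%E.
Proof.
move=> a0.
pose I (k : nat) : set R := `](k%:R * a)%R, (k.+1%:R * a)%R]%classic.
have I0 k : (0 < E \1_(I k))%E.
  apply: (jump_mean_itv_gt0 hv); first by rewrite mulr_ge0// ltW.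
  by rewrite ltr_pM2r// ltr_nat.
have mI k : measurable (I k) by exact: measurable_itv.
have minI N : exists2 p : R, 0 < p < 1 & forall k, (k < N)%N -> (p%:E <= E \1_(I k))%E.
  elim: N => [|N [p /andP[p0 p1] IH]]; first by exists (1 / 2) => //; lra.
  have [q q0 hq] : exists2 q : R, 0 < q & (q%:E <= E \1_(I N))%E.
    move: (I0 N); case: (E _) => [q||]//; first by rewrite lte_fin => q0; exists q.
    by move=> _; exists 1; rewrite ?leey.
  exists (Num.min p q); first by rewrite lt_min p0 q0 gt_min p1.
  move=> k; rewrite ltnS leq_eqVlt => /predU1P[->|/IH].
    by apply: le_trans hq; rewrite lee_fin ge_min lexx orbT.
  by apply: le_trans; rewrite lee_fin ge_min lexx.
have [p p01 hp] := minI (Num.bound (A / a)).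
exists p => // z z0 zA.
have [k kN kz] : exists2 k, (k < Num.bound (A / a))%N & I k z.
  have zN : z <= (Num.bound (A / a))%:R * a.
    rewrite -ler_pdivrMr// ltW//.
    apply: le_lt_trans (_ : A / a < _); first by rewrite ler_pM2r ?invr_gt0.
    by apply: archi_boundP; rewrite divr_ge0 ?(ltW a0)// (le_trans (ltW z0)).
  elim: (Num.bound _) zN => [|N IH] zN; first by move: zN; rewrite mul0r leNgt z0.
  have [zn|zn] := leP z (N%:R * a).
    by have [k kN hk] := IH zn; exists k => //; rewrite ltnS ltnW.
  by exists N => //; rewrite /I/= in_itv/= zn zN.
have hIk := hp k kN.
have : (E (fun y => beyond a `|z - y|) + E \1_(I k) <= 1)%E.
  rewrite -meanD; solve_side.
  rewrite -[leRHS](mean_cst ler01); apply: le_mean; solve_side.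
  move=> y y0; rewrite indicE; case: (boolP (y \in I k)) => [|_]; last first.
    by rewrite addr0 beyond_le1.
  rewrite mem_setE /I in_itv/= => /andP[y1 y2].
  rewrite /beyond ltNge.
  suff -> : `|z - y| <= a by rewrite add0r.
  move: kz; rewrite /I/= in_itv/= => /andP[z1 z2].
  rewrite -natr1 mulrDl mul1r in y2 z2.
  by rewrite ler_norml; apply/andP; split; lra.
move=> h; have : (E (fun y => beyond a `|z - y|) + p%:E <= 1)%E.
  exact: le_trans (leeD2l _ hIk) h.
case: (E _) => [e||]; rewrite ?leNye//; rewrite -EFinD !lee_fin; lra.
Qed.

End killed_drift.

(** The power [t^g] up to the level [y], and a plateau at [M * y^g] beyond it. The upward jump at
    [y] makes up for what truncation takes from the mean. *)
Definition capped {R : realType} (g M y t : R) : R :=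
  beyond y t * (M * y `^ g) + (1 - beyond y t) * t `^ g.

(** * One-step inequalities with truncation and killing *)

Section one_step_estimates.
Context {R : realType} (alpha c : R) (v : R -> R).
Hypotheses (alpha0 : 0 < alpha) (c0 : 0 < c) (hv : classD alpha c v).
Local Notation E f := (jump_mean v f%R).

Let mv := classD_measurable hv.
Let v0 := classD_ge0 hv.
Let v1 := integral_classD hv.

Let le_mean f g := @le_jump_mean R v mv v0 f g.
Let meanD f g := @jump_meanD R v mv v0 f g.
Let meanZ k f := @jump_meanZ R v mv v0 k f.
Let mean_cst k := @jump_mean_cst R v mv v0 v1 k.

Let le_powRN (p x y : R) : p <= 0 -> 0 < x -> x <= y -> y `^ p <= x `^ p.
Proof.
move=> p0 x0 xy; have y0 := lt_le_trans x0 xy.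
rewrite -[p]opprK (powRN y) (powRN x) lef_pV2 ?posrE ?powR_gt0//.
by apply: le_powR => //; [rewrite oppr_ge0|exact: ltW].
Qed.

(** From [z <= y], a jump larger than [2 * y] lands beyond [y] on the other side of the origin. *)
Lemma far_jump_probability : exists k Y : R, [/\ 0 < k, 0 < Y &
  forall z y, 0 < z -> z <= y -> Y <= y ->
    ((k * y `^ (- alpha))%:E <= E (fun x => beyond y `|z - x|))%E].
Proof.
have [k [Y [k0 Y0 hY]]] := jump_mean_tail_ge alpha0 c0 hv.
exists (k * 2 `^ (- alpha)), Y; split => //; first by rewrite mulr_gt0// powR_gt0.
move=> z y z0 zy Yy; have y0 : 0 < y by apply: lt_le_trans zy.
have Yy2 : Y <= 2 * y by lra.
have := hY _ Yy2; rewrite powRM ?(ltW y0)// mulrA => /le_trans; apply.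
apply: le_mean; solve_side.
move=> x x0; rewrite indicE mem_setE in_itv/=.
case: (boolP (2 * y < x <= _)) => [/andP[yx _]|_]; last exact: beyond_ge0.
rewrite /beyond distrC (_ : y < `|x - z|)//.
by apply: lt_le_trans (ler_norm _); lra.
Qed.

(** The truncated distance decreases by at most the size [x] of the jump, and the power [s] is
    subadditive. *)
Lemma truncated_drift_ge s z y : 0 <= s <= 1 -> 0 < z -> 0 <= y ->
  (((Num.min z y) `^ s)%:E <=
     E (fun x => (Num.min `|z - x| y) `^ s) + E (fun x => x `^ s))%E.
Proof.
move=> s01 z0 y0; have /andP[s0 _] := s01.
rewrite -mean_cst ?powR_ge0// -meanD; solve_side.
apply: le_mean; solve_side.
move=> x x0.
have m0 : 0 <= Num.min `|z - x| y by rewrite le_min normr_ge0.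
apply: le_trans (powR_subadditive s01 m0 (ltW x0)).
apply: le_powR => //; first by rewrite le_min ltW.
rewrite /Num.min; case: ifP => h1; case: ifP => h2; have := ler_norm (z - x); lra.
Qed.

(** Below [A] the constant [C] does the work: it is lost with probability at least [p], and
    [C * p >= m + 1] covers the possible increase [m] of the power and a decrease by 1, which
    exceeds the required one since [y >= 1] and [eps <= 1]. Above [A] the subcritical drift applies.
    All [C >= C0] are allowed, so that both densities can share one constant. *)
Lemma subcritical_killed_drift a g : 0 < a -> 1 / 2 < alpha -> alpha <= 1 ->
  0 < g < 2 * alpha - 1 -> exists C0 eps : R, [/\ 0 <= C0, 0 < eps &
    forall C, C0 <= C -> forall y z, 1 <= y -> a < z -> z <= y ->
    (E (fun x => (beyond a `|z - x|) * (C + (Num.min `|z - x| y) `^ g)) <=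
      (C + z `^ g - eps * y `^ (g - alpha))%:E)%E].
Proof.
move=> a0 a12 a1 hg; have /andP[g0 g1] := hg.
have [eps [A [eps0 A0 hA]]] := subcritical_drift alpha0 c0 hv a12 a1 hg.
have ga : g < alpha by lra.
have g01 : 0 <= g <= 1 by rewrite ltW//=; lra.
have [p /andP[p0 p1] hp] := killing_probability hv A a0.
have [m m0 hm] := jump_mean_powR_fin hv (ltW g0) ga.
exists ((m + 1) / p), (Num.min eps 1); split => //.
- by rewrite divr_ge0 ?addr_ge0// ltW.
- by rewrite lt_min eps0 ltr01.
move=> C hC y z y1 az zy.
have C0 : 0 <= C by apply: le_trans hC; rewrite divr_ge0 ?addr_ge0// ltW.
have z0 : 0 < z by apply: lt_trans az.
have y0 : 0 < y by lra.
have yp : 0 <= y `^ (g - alpha) by exact: powR_ge0.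
have pw x : 0 < x -> beyond a `|z - x| * (C + Num.min `|z - x| y `^ g) <=
    C * beyond a `|z - x| + `|z - x| `^ g.
  move=> x0; rewrite mulrDr [beyond _ _ * C]mulrC lerD2l.
  apply: (@le_trans _ _ (Num.min `|z - x| y `^ g)).
    by rewrite ler_piMl ?powR_ge0// beyond_le1.
  apply: le_powR; [exact: ltW|by rewrite le_min normr_ge0 ltW|].
  by rewrite ge_min lexx.
have bound (q : R) : (E (fun x => beyond a `|z - x|) <= q%:E)%E ->
   (E (fun x => beyond a `|z - x| * (C + Num.min `|z - x| y `^ g)) <=
    (C * q)%:E + E (fun x => `|z - x| `^ g))%E.
  move=> hq; rewrite EFinM.
  apply: le_trans (leeD2r _ (lee_wpmul2l _ hq)); last by rewrite lee_fin.
  rewrite -meanZ; solve_side.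
  rewrite -meanD; solve_side.
  by apply: le_mean; solve_side.
have [zA|Az] := leP z A.
  apply: le_trans (bound _ (hp z z0 zA)) _.
  apply: le_trans (leeD2l _ (jump_mean_norm_powR_le hv g01 z0)) _.
  rewrite hm -!EFinD lee_fin.
  have h1 : m + 1 <= C * p by move: hC; rewrite ler_pdivrMr.
  have h2 : Num.min eps 1 * y `^ (g - alpha) <= 1.
    rewrite -[leRHS]mulr1; apply: ler_pM => //.
    - by rewrite le_min ltW//= ler01.
    - by rewrite ge_min lexx orbT.
    - have : g - alpha <= 0 by lra.
      by move=> /le_powRN/(_ ltr01 y1); rewrite powR1.
  move: h1 h2; rewrite mulrBr mulr1; lra.
have E1 : (E (fun x => beyond a `|z - x|) <= 1%:E)%E.
  rewrite -(mean_cst ler01); apply: le_mean; solve_side.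
  by move=> x _; exact: beyond_le1.
apply: le_trans (bound _ E1) _.
apply: le_trans (leeD2l _ (hA z (ltW Az))) _.
rewrite -!EFinD lee_fin mulr1 -addrA !lerD2l lerN2.
apply: ler_pM => //; first by rewrite le_min ltW//= ler01.
  by rewrite ge_min lexx.
by apply: le_powRN => //; lra.
Qed.

(** Truncation takes at most the tail [C * y^(g - alpha)] from the mean, and the plateau returns
    [M' * y^g] times a crossing probability of at least [k * y^(- alpha)]; so [M' >= C / k]
    suffices. *)
Lemma capped_drift_ge g : 1 / 2 < alpha -> alpha < 1 ->
  2 * alpha - 1 < g -> g < alpha -> exists A M : R, [/\ 0 < A, 1 <= M &
    forall M' y z, M <= M' -> A <= z -> z <= y ->
      ((z `^ g)%:E <= E (fun x => capped g M' y `|z - x|))%E].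
Proof.
move=> a12 a1 gb ga.
have [A A0 hA] := supercritical_drift alpha0 c0 hv a12 a1 gb ga.
have [C C0 hC] := jump_mean_tail_le hv ga.
have [k [Y [k0 Y0 hY]]] := far_jump_probability.
have g0 : 0 < g by lra.
exists (Num.max A Y), (Num.max 1 (C / k)); split.
- by rewrite lt_max A0.
- by rewrite le_max lexx.
move=> M y z; rewrite !ge_max => /andP[M1 hM] /andP[Az Yz] zy.
have z0 : 0 < z by apply: lt_le_trans Az.
have y0 : 0 < y by apply: lt_le_trans zy.
have M0 : 0 <= M by lra.
have cap0 x : 0 <= capped g M y `|z - x|.
  by rewrite /capped addr_ge0 ?mulr_ge0 ?beyond_ge0 ?powR_ge0 ?subr_ge0 ?beyond_le1.
have mcap : measurable_fun [set: R] (fun x => capped g M y `|z - x|).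
  rewrite /capped; solve_mfun.
pose tail x : R := \1_(`]y, +oo[%classic : set R) x * x `^ g.
have mtail : measurable_fun [set: R] tail by rewrite /tail; solve_mfun.
have tail0 x : 0 < x -> 0 <= tail x by move=> x0; rewrite /tail; solve_ge0.
have Mk : C * y `^ (g - alpha) <= M * y `^ g * (k * y `^ (- alpha)).
  rewrite powRDp// [leRHS](_ : _ = (M * k) * (y `^ g * y `^ (- alpha))); last by ring.
  by rewrite ler_wpM2r ?mulr_ge0 ?powR_ge0// -ler_pdivrMr.
have c1 : 0 <= M * y `^ g by rewrite mulr_ge0 ?powR_ge0.
have : ((z `^ g)%:E + (M * y `^ g * (k * y `^ (- alpha)))%:E <=
   E (fun x => capped g M y `|z - x|) + (C * y `^ (g - alpha))%:E)%E.
  apply: le_trans (leeD2l _ (hC y y0)).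
  apply: le_trans (leeD2r _ (hA z Az)) _.
  have Yy := le_trans Yz zy.
  rewrite [(_ * (k * _))%:E]EFinM.
  apply: le_trans (leeD2l _ (lee_wpmul2l _ (hY z y z0 zy Yy))) _.
    by rewrite lee_fin.
  rewrite -meanZ; solve_side.
  rewrite -/tail -!meanD; solve_side.
  apply: le_mean; solve_side.
  move=> x x0; rewrite /capped /tail /beyond indicE mem_setE in_itv/= andbT.
  have [yx|xy] := ltP y `|z - x|; last first.
    by rewrite !mulr0 mul0r add0r addr0 subr0 mul1r lerDl mulr_ge0 ?powR_ge0.
  have yx' : y < x.
    have [zx|xz] := leP z x.
      by move: yx; rewrite distrC ger0_norm ?subr_ge0//; lra.
    by move: yx; rewrite gtr0_norm ?subr_gt0//; lra.
  rewrite yx' !mulr1 !mul1r subrr mul0r addr0 addrC lerD2l.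
  apply: le_powR; [exact: ltW|exact: normr_ge0|].
  by rewrite distrC ger0_norm; lra.
case: (E _) => [e||]; rewrite ?leey// -!EFinD !lee_fin; lra.
Qed.

(* The jumps have a finite mean, so that [|z|] drifts towards [0] at a constant
   speed away from the origin, and a finite moment of order [g > 1]. *)
Lemma positive_speed_killed_drift a g : 0 < a -> 1 < g -> g < alpha ->
  exists delta T0 : R, [/\ 0 < delta, 0 < T0 &
    forall delta' T z, 0 <= delta' <= delta -> T0 <= T -> a < z ->
    (E (fun x => beyond a `|z - x| * (`|z - x| + T + delta') `^ g) <=
      ((z + T) `^ g)%:E)%E].
Proof.
move=> a0 g1 ga.
have g0 : 0 < g by lra.
have a1 : 1 < alpha by lra.
have [m _ hm'] := jump_mean_powR_fin hv ler01 a1.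
have hm : E (fun x => x) = m%:E.
  by rewrite -hm'; apply: eq_jump_mean => x x0; rewrite powRr1// ltW.
have [mg mg0 hmg] := jump_mean_powR_fin hv (ltW g0) ga.
have m0 : 0 < m.
  have h : (E \1_(`]1, 2]%classic : set R) <= m%:E)%E.
    rewrite -hm; apply: le_mean; solve_side.
    move=> x x0; rewrite indicE mem_setE in_itv/=.
    by case: (boolP (1 < x <= 2)) => [/andP[/ltW]|_]//; rewrite ltW.
  rewrite -lte_fin; apply: lt_le_trans h.
  by apply: (jump_mean_itv_gt0 hv); rewrite ?ler01// ltr1n.
have [C1 C10 hC1] := jump_mean_tail_le hv a1.
(* From [A] on, [C1 * z^(1 - alpha) <= m / 4]. Since [|z - x|] is at most [z - x] plus [2 * x] on
   the event [x > z], the mean distance drops by at least [m / 2 = 2 * delta]. *)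
pose A := (4 * C1 / m) `^ (alpha - 1)^-1.
have A0 : 0 < A by rewrite powR_gt0// divr_gt0// mulr_gt0.
pose delta := m / 4.
have delta0 : 0 < delta by rewrite divr_gt0.
have drift z : A <= z -> (E (fun x => `|z - x|) <= (z - 2 * delta)%:E)%E.
  move=> Az; have z0 : 0 < z by apply: lt_le_trans Az.
  have ht : C1 * z `^ (1 - alpha) <= m / 4.
    have h : 4 * C1 / m <= z `^ (alpha - 1).
      have a1' : 0 <= alpha - 1 by lra.
      apply: le_trans (le_powR a1' (ltW A0) Az).
      by rewrite powR_invK ?subr_gt0// divr_ge0 ?mulr_ge0// ltW.
    rewrite -(opprB alpha 1) powRN ler_pdivrMr ?powR_gt0//.
    by move: h; rewrite ler_pdivrMr//; lra.
  have : (E (fun x => `|z - x|) + m%:E <=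
      (z + 2 * (C1 * z `^ (1 - alpha)))%:E)%E.
    have two0 : (0 <= 2 :> R) by [].
    have zl := ltW z0.
    rewrite EFinD EFinM -hm.
    apply: le_trans (leeD2l _ (lee_wpmul2l _ (hC1 z z0))); last by rewrite lee_fin.
    rewrite -(mean_cst zl) -meanZ; solve_side.
    rewrite -!meanD; solve_side.
    apply: le_mean; solve_side.
    move=> x x0; rewrite indicE mem_setE in_itv/= andbT powRr1 ?(ltW x0)//.
    have [zx|xz] := ltP z x.
      by rewrite distrC ger0_norm ?mul1r ?subr_ge0; lra.
    by rewrite ger0_norm ?mul0r ?subr_ge0//; lra.
  case: (E _) => [e||]; rewrite ?leNye// -!EFinD !lee_fin /delta; lra.
have [p /andP[p0 p1] hp] := killing_probability hv A a0.
(* Solves [eta * (m + delta) = g * delta / 2]: the error of the expansion consumes half of the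
   linear gain. *)
pose eta := g * delta / (2 * (m + delta)).
have md0 : 0 < m + delta by rewrite addr_gt0.
have eta0 : 0 < eta by rewrite divr_gt0 ?mulr_gt0.
have [C C0 hC] := powR_expansion g1 eta0.
have expand t X : 0 < t -> - t <= X -> (t + X) `^ g <=
    t `^ g + t `^ (g - 1) * (g * X + eta * `|X|) + C * `|X| `^ g.
  move=> t0 tX.
  have h1 : -1 <= X / t by rewrite ler_pdivlMr// mulN1r.
  have := hC _ h1; rewrite -(ler_pM2l (powR_gt0 g t0)).
  have -> : t `^ g * (1 + X / t) `^ g = (t + X) `^ g.
    rewrite -powRM ?(ltW t0)//; last by lra.
    by rewrite mulrDr mulr1 mulrCA divff ?mulr1 ?gt_eqF.
  move=> /le_trans; apply.
  rewrite normrM [`|t^-1|]gtr0_norm ?invr_gt0// powRM ?invr_ge0 ?(ltW t0)//.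
  have -> : t^-1 `^ g = t `^ (-1 * g) by rewrite -(powR_inv1 (ltW t0)) -powRrM.
  have tg : t `^ g * t `^ (-1 * g) = 1 by rewrite -powRDp// mulN1r subrr powRr0.
  have tg1 : t `^ g / t = t `^ (g - 1) by rewrite powRDp// powR_inv1// ltW.
  rewrite [leLHS](_ : _ = t `^ g + t `^ g / t * (g * X + eta * `|X|) +
    C * `|X| `^ g * (t `^ g * t `^ (-1 * g))); last by ring.
  by rewrite tg tg1 mulr1.
pose B := A + delta.
have B0 : 0 < B by rewrite addr_gt0.
pose M := 2 `^ g * (mg + B `^ g).
have M0 : 0 <= M by rewrite mulr_ge0 ?addr_ge0 ?powR_ge0.
have momB : (E (fun x => (x + B) `^ g) <= M%:E)%E.
  have p2 : 0 <= 2 `^ g :> R by exact: powR_ge0.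
  have pB : 0 <= B `^ g by exact: powR_ge0.
  rewrite /M EFinM EFinD -hmg -(mean_cst pB) -meanD; solve_side.
  rewrite -meanZ; solve_side.
  apply: le_mean; solve_side.
  move=> x x0.
  apply: (@le_trans _ _ ((2 * Num.max x B) `^ g)).
    apply: le_powR; [exact: ltW|by rewrite addr_ge0 ?ltW|].
    by rewrite mulr_natl mulr2n lerD// le_max lexx ?orbT.
  rewrite powRM//; last by rewrite le_max (ltW x0).
  rewrite ler_wpM2l// /Num.max; case: ifP => _; first by rewrite lerDr powR_ge0.
  by rewrite lerDl.
pose K := (g + eta) * (m + B).
have K0 : 0 < K by rewrite mulr_gt0 ?addr_gt0.
(* The second entry lets the other half of the linear gain, of order [T^(g - 1)], dominate the
   remainder [C * M] far from the origin. The third lets the loss [p * T^g] at killing dominate the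
   possible growth for [z <= A]. *)
pose T0 := Num.max (Num.max 1 ((2 * C * M / (g * delta)) `^ (g - 1)^-1)) ((K + C * M) / p).
have T00 : 0 < T0 by rewrite !lt_max ltr01.
exists delta, T0; split => // d T z /andP[d0 dd] TT az.
have z0 : 0 < z by apply: lt_trans az.
have T1 : 1 <= T by apply: le_trans TT; rewrite !le_max lexx.
have T2 : (2 * C * M / (g * delta)) `^ (g - 1)^-1 <= T.
  by apply: le_trans TT; rewrite !le_max lexx orbT.
have T3 : (K + C * M) / p <= T by apply: le_trans TT; rewrite !le_max lexx orbT.
have T_gt0 : 0 < T by lra.
have dB : d <= B by rewrite /B; lra.
have [zA|Az] := leP z A.
  have T10 : 0 <= T `^ (g - 1) by exact: powR_ge0.
  have T1g : 1 <= T `^ (g - 1).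
    have g1' : 0 <= g - 1 by lra.
    by have := le_powR g1' ler01 T1; rewrite powR1.
  have Tg : T `^ g = T * T `^ (g - 1) by rewrite mulr_powRB1 ?(ltW T_gt0).
  have Tg0 : 0 <= T `^ g by exact: powR_ge0.
  have pw x : 0 < x -> beyond a `|z - x| * (`|z - x| + T + d) `^ g <=
      T `^ g * beyond a `|z - x| + (T `^ (g - 1) * (g + eta) * (x + B) + C * (x + B) `^ g).
    move=> x0.
    have xB : 0 <= x + B by rewrite addr_ge0// ltW.
    have h : (`|z - x| + T + d) `^ g <=
        T `^ g + (T `^ (g - 1) * (g + eta) * (x + B) + C * (x + B) `^ g).
      apply: (@le_trans _ _ ((T + (x + B)) `^ g)).
        apply: le_powR; [exact: ltW|by rewrite !addr_ge0// ltW|].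
        have : `|z - x| <= z + x by rewrite (le_trans (ler_normB _ _))// !gtr0_norm.
        rewrite /B; lra.
      have := expand T (x + B) T_gt0 _; rewrite ger0_norm// => /(_ _)/le_trans; apply.
        by lra.
      by rewrite le_eqVlt; apply/orP; left; apply/eqP; ring.
    apply: le_trans (ler_wpM2l (beyond_ge0 _ _) h) _.
    rewrite mulrDr [beyond _ _ * T `^ g]mulrC lerD2l ler_piMl ?beyond_le1//.
    by solve_ge0.
  apply: (@le_trans _ _ ((T `^ g * (1 - p))%:E + ((T `^ (g - 1) * K)%:E + (C * M)%:E))%E).
    have q0 : 0 <= T `^ (g - 1) * (g + eta) by solve_ge0.
    have Bl := ltW B0; have Cl := ltW C0.
    rewrite EFinM [(C * M)%:E]EFinM.
    apply: le_trans (leeD (lee_wpmul2l _ (hp z z0 zA)) (leeD2l _ (lee_wpmul2l _ momB)));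
    rewrite ?lee_fin//.
    rewrite /K mulrA [(_ * (m + B))%:E]EFinM EFinD -hm -(mean_cst Bl) -meanD; solve_side.
    rewrite -!meanZ; solve_side.
    rewrite -!meanD; solve_side.
    by apply: le_mean; solve_side.
  rewrite -!EFinD lee_fin.
  have : T `^ g <= (z + T) `^ g by apply: le_powR; [exact: ltW|exact: ltW|lra].
  apply: le_trans.
  have hCM : C * M <= T `^ (g - 1) * (C * M) by rewrite ler_peMl// mulr_ge0// ltW.
  have : T `^ (g - 1) * (K + C * M) <= T `^ (g - 1) * (p * T).
    by rewrite ler_wpM2l// [p * T]mulrC -ler_pdivrMr.
  rewrite Tg; lra.
set t := z + T.
have t0 : 0 < t by rewrite addr_gt0.
have Tt : T <= t by rewrite lerDr ltW.
set tg := t `^ (g - 1).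
have tg0 : 0 < tg by exact: powR_gt0.
have pw x : 0 < x -> beyond a `|z - x| * (`|z - x| + T + d) `^ g + tg * g * z <=
    t `^ g + (tg * g * (`|z - x| + delta) + (tg * eta * (x + delta) + C * (x + B) `^ g)).
  move=> x0.
  have h : (`|z - x| + T + d) `^ g <= (t + (`|z - x| - z + delta)) `^ g.
    apply: le_powR; [exact: ltW|by rewrite !addr_ge0// ltW|].
    by rewrite /t; lra.
  have hX : `| `|z - x| - z + delta| <= x + delta.
    rewrite (le_trans (ler_normD _ _))// (gtr0_norm delta0) lerD2r.
    have := ler_dist_dist (z - x) z.
    rewrite (gtr0_norm z0) => /le_trans; apply.
    by rewrite addrAC subrr sub0r normrN gtr0_norm.
  have nX : - t <= `|z - x| - z + delta.
    have := normr_ge0 (z - x); move: T_gt0 delta0; rewrite /t.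
    clear -alpha0 c0 hv mv v0 v1 le_mean meanD meanZ mean_cst le_powRN; lra.
  have e1 := expand _ _ t0 nX.
  have e2 : eta * `| `|z - x| - z + delta| <= eta * (x + delta) by rewrite ler_pM2l.
  have e3 : C * `| `|z - x| - z + delta| `^ g <= C * (x + B) `^ g.
    rewrite ler_pM2l//; apply: le_powR => //; first exact: ltW.
    by rewrite (le_trans hX)// lerD2l /B lerDr ltW.
  have e4 : beyond a `|z - x| * (`|z - x| + T + d) `^ g <= (`|z - x| + T + d) `^ g.
    by rewrite ler_piMl ?powR_ge0// beyond_le1.
  have e5 : tg * (eta * `| `|z - x| - z + delta|) <= tg * (eta * (x + delta)) by rewrite ler_pM2l.
  move: (le_trans e4 (le_trans h e1)) e3 e5; rewrite -/tg.
  clear -alpha0 c0 hv mv v0 v1 le_mean meanD meanZ mean_cst le_powRN; lra.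
have : (E (fun x => beyond a `|z - x| * (`|z - x| + T + d) `^ g) + (tg * g * z)%:E <=
   (t `^ g)%:E + ((tg * g * (z - 2 * delta + delta))%:E +
      ((tg * eta * (m + delta))%:E + (C * M)%:E)))%E.
  have q1 : 0 <= tg * g by solve_ge0.
  have q2 : 0 <= tg * eta by solve_ge0.
  have q3 : 0 <= tg * g * z by solve_ge0.
  have q4 : 0 <= t `^ g by exact: powR_ge0.
  have Cl := ltW C0; have dl := ltW delta0.
  have h1 : (E (fun x => `|z - x| + delta) <= (z - 2 * delta + delta)%:E)%E.
    rewrite meanD; solve_side.
    by rewrite mean_cst// EFinD leeD2r// drift// ltW.
  have h2 : E (fun x => x + delta) = (m + delta)%:E.
    by rewrite meanD; solve_side; rewrite mean_cst// hm.
  rewrite [(tg * g * (z - _ + _))%:E]EFinM [(tg * eta * _)%:E]EFinM [(C * M)%:E]EFinM -h2.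
  apply: le_trans (leeD2l _ (leeD (lee_wpmul2l _ h1) (leeD2l _ (lee_wpmul2l _ momB))));
  rewrite ?lee_fin//.
  rewrite -(mean_cst q4) -(mean_cst q3) -!meanZ; solve_side.
  rewrite -!meanD; solve_side.
  apply: le_mean; solve_side.
have g1' : 0 <= g - 1 by lra.
have hT : 2 * C * M / (g * delta) <= tg.
  have h0 : 0 <= 2 * C * M / (g * delta).
    by apply: divr_ge0; solve_ge0.
  have := le_powR g1' (powR_ge0 _ _) (le_trans T2 Tt).
  by rewrite powR_invK// subr_gt0.
have hT' : 2 * C * M <= tg * (g * delta) by move: hT; rewrite ler_pdivrMr// mulr_gt0.
have he : eta * (m + delta) = g * delta / 2.
  by rewrite /eta; field; rewrite gt_eqF.
have he' : tg * eta * (m + delta) = tg * (g * delta) / 2.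
  by rewrite -mulrA he mulrA.
case: (E _) => [e||]; rewrite ?leNye// -!EFinD !lee_fin he'; move: hT'.
clear -alpha0 c0 hv mv v0 v1 le_mean meanD meanZ mean_cst le_powRN; lra.
Qed.

End one_step_estimates.

(** * Extension of identities from indicators to nonnegative functions *)

Section integral_like.
Local Open Scope ereal_scope.
Context {R : realType}.

(** What an integral of nonnegative functions satisfies. It covers integrals against a density,
    integrals along a random variable and iterated integrals against a kernel, so one uniqueness
    argument serves both the kernel and the Markov property. *)
Definition integral_like d (T : measurableType d)
    (L : (T -> \bar R) -> \bar R) : Prop :=
  [/\ L (fun=> 0) = 0,
      forall f g, (forall x, 0 <= f x) -> measurable_fun [set: T] f ->
        (forall x, 0 <= g x) -> measurable_fun [set: T] g ->
        L (fun x => f x + g x) = L f + L g,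
      forall (r : R) f, (0 <= r)%R -> (forall x, 0 <= f x) ->
        measurable_fun [set: T] f -> L (fun x => r%:E * f x) = r%:E * L f &
      forall (F : (T -> \bar R)^nat), (forall n x, 0 <= F n x) ->
        (forall n, measurable_fun [set: T] (F n)) ->
        (forall x, nondecreasing_seq (F ^~ x)) ->
        L (fun x => limn (F ^~ x)) = limn (fun n => L (F n))].

Import HBNNSimple.

Lemma integral_like_ext d (T : measurableType d) (L1 L2 : (T -> \bar R) -> \bar R) :
  integral_like L1 -> integral_like L2 ->
  (forall B, measurable B ->
    L1 (fun x => (\1_B x)%:E) = L2 (fun x => (\1_B x)%:E)) ->
  forall f, (forall x, 0 <= f x) -> measurable_fun [set: T] f -> L1 f = L2 f.
Proof.
move=> [L10 L1D L1Z L1lim] [L20 L2D L2Z L2lim] L12 f f0 mf.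
have simple (g : {nnsfun T >-> R}) :
    L1 (fun x => (g x)%:E) = L2 (fun x => (g x)%:E).
  pose S : seq R := finmap.enum_fset (fset_set (range g)).
  have -> : (fun x => (g x)%:E) = (fun x => \sum_(r <- S)
      (r * \1_(g @^-1` [set r]) x)%:E).
    by apply/funext => x; rewrite fimfunE fsbig_finite//= sumEFin.
  have : forall r, r \in S -> (0 <= r)%R.
    move=> r; rewrite in_fset_set// inE => -[x _ <-]; exact: fun_ge0.
  have mr (r : R) : measurable (g @^-1` [set r]) by [].
  elim: S => [|r s IH] s0.
    by under eq_fun do rewrite big_nil; rewrite L10 L20.
  have r0 : (0 <= r)%R by apply: s0; rewrite mem_head.
  have s0' : forall r, r \in s -> (0 <= r)%R.
    by move=> t ts; apply: s0; rewrite in_cons ts orbT.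
  have i0 (t : R) : (0 <= t)%R -> forall x, 0 <= (t * \1_(g @^-1` [set t]) x)%:E.
    by move=> t0 x; rewrite lee_fin mulr_ge0.
  have mi (t : R) : measurable_fun [set: T] (fun x => (t * \1_(g @^-1` [set t]) x)%:E).
    by apply/measurable_EFinP/measurable_funM.
  have sum0 x : 0 <= \sum_(t <- s) (t * \1_(g @^-1` [set t]) x)%:E.
    by rewrite big_seq; apply: sume_ge0 => t /s0'/i0.
  have msum : measurable_fun [set: T]
      (fun x => \sum_(t <- s) (t * \1_(g @^-1` [set t]) x)%:E).
    exact: emeasurable_sum.
  under eq_fun do rewrite big_cons.
  rewrite L1D ?L2D//; try exact: i0.
  rewrite IH//; congr (_ + _).
  have mind : measurable_fun [set: T] (fun x => (\1_(g @^-1` [set r]) x : R)%:E).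
    exact/measurable_EFinP/measurable_indic.
  have -> : (fun x => (r * \1_(g @^-1` [set r]) x)%:E) =
      (fun x => r%:E * (\1_(g @^-1` [set r]) x)%:E).
    by apply/funext => x; rewrite EFinM.
  by rewrite L1Z ?L2Z// ?L12// => x; rewrite lee_fin.
pose F n x := (nnsfun_approx measurableT mf n x)%:E.
have -> : f = fun x => limn (F ^~ x).
  by apply/funext => x; apply/esym/cvg_lim => //; exact: cvg_nnsfun_approx.
have F0 n x : 0 <= F n x by rewrite lee_fin.
have mF n : measurable_fun [set: T] (F n) by exact/measurable_EFinP.
have ndF x : nondecreasing_seq (F ^~ x).
  by move=> m n mn; rewrite lee_fin; exact/lefP/nd_nnsfun_approx.
rewrite L1lim// L2lim//; congr (lim _).
by under eq_fun do rewrite simple.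
Qed.

Lemma integral_like_weight d (T : measurableType d) d' (Y : measurableType d')
    (mu : {measure set T -> \bar R}) (D : set T) (h : T -> Y) (w : T -> R) :
  measurable D -> measurable_fun [set: T] h -> measurable_fun [set: T] w ->
  (forall x, (0 <= w x)%R) ->
  integral_like (fun f : Y -> \bar R => \int[mu]_(x in D) (f (h x) * (w x)%:E)).
Proof.
move=> mD mh mw w0.
have mfh (f : Y -> \bar R) : measurable_fun [set: Y] f ->
    measurable_fun D (fun x => f (h x) * (w x)%:E).
  move=> mf; apply/measurable_funTS; apply: emeasurable_funM.
    exact: measurableT_comp.
  exact/measurable_EFinP.
have w0' x : 0 <= (w x)%:E by rewrite lee_fin.
split.
- by under eq_integral do rewrite mul0e; rewrite integral0.
- move=> f g f0 mf g0 mg; rewrite -ge0_integralD//.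
  + by apply: eq_integral => x _; rewrite ge0_muleDl.
  + by move=> x _; rewrite mule_ge0.
  + exact: mfh.
  + by move=> x _; rewrite mule_ge0.
  + exact: mfh.
- move=> r f r0 f0 mf; rewrite -ge0_integralZl_EFin//.
  + by apply: eq_integral => x _; rewrite muleA.
  + by move=> x _; rewrite mule_ge0.
  + exact: mfh.
- move=> F F0 mF ndF.
  rewrite -monotone_convergence//.
  + apply: eq_integral => x _; apply/esym/cvg_lim => //.
    apply: cvgeZr => //.
    exact: ereal_nondecreasing_is_cvgn.
  + by move=> n; exact: mfh.
  + by move=> n x _; rewrite mule_ge0.
  + by move=> x _ m n mn; rewrite lee_wpmul2r// ndF.
Qed.

Lemma integral_like_kernel d (T : measurableType d) d' (Y : measurableType d')
    (mu : {measure set T -> \bar R}) (D : set T)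
    (k : T -> {measure set Y -> \bar R}) :
  measurable D -> (forall B, measurable B -> measurable_fun [set: T] (k ^~ B)) ->
  integral_like (fun f : Y -> \bar R => \int[mu]_(x in D) \int[k x]_y f y).
Proof.
move=> mD mk.
have mkf (f : Y -> \bar R) : (forall y, 0 <= f y) -> measurable_fun [set: Y] f ->
    measurable_fun D (fun x => \int[k x]_y f y).
  by move=> f0 mf; apply/measurable_funTS; exact: measurable_fun_integral_kernel.
split.
- by rewrite integral0_eq// => x _; rewrite integral0.
- move=> f g f0 mf g0 mg; rewrite -ge0_integralD//.
  + by apply: eq_integral => x _; rewrite ge0_integralD.
  + by move=> x _; exact: integral_ge0.
  + exact: mkf.
  + by move=> x _; exact: integral_ge0.
  + exact: mkf.
- move=> r f r0 f0 mf; rewrite -ge0_integralZl_EFin//.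
  + by apply: eq_integral => x _; rewrite ge0_integralZl_EFin.
  + by move=> x _; exact: integral_ge0.
  + exact: mkf.
- move=> F F0 mF ndF.
  have ndI x : nondecreasing_seq (fun n => \int[k x]_y F n y).
    by move=> m n mn; apply: ge0_le_integral => // y _; exact: ndF.
  rewrite -monotone_convergence//.
  + by apply: eq_integral => x _; rewrite monotone_convergence// => y _; exact: ndF.
  + by move=> n; exact: mkf.
  + by move=> n x _; exact: integral_ge0.
Qed.

End integral_like.

(** * Lebesgue measure under translation and reflection *)

Section lebesgue_invariance.
Context {R : realType}.
Local Notation mu := (@lebesgue_measure R).

Let integral_pushforward_invariant (h : R -> R) (f : R -> \bar R) :
  measurable_fun [set: R] h ->
  (forall a b, mu (h @^-1` `]a, b]) = mu `]a, b])%classic ->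
  measurable_fun [set: R] f -> (forall x, (0 <= f x)%E) ->
  (\int[mu]_x f (h x) = \int[mu]_x f x)%E.
Proof.
move=> mh hE mf f0.
have -> : (\int[mu]_x f (h x) =
    \int[pushforward mu (h : measurableTypeR R -> measurableTypeR R)]_x f x)%E.
  by rewrite ge0_integral_pushforward.
apply: eq_measure_integral => A mA _.
apply/esym/lebesgue_measure_unique => //= _ [[a b]] _ <-.
exact/esym/hE.
Qed.

Lemma lebesgue_integral_subl (z : R) (f : R -> \bar R) :
  measurable_fun [set: R] f -> (forall x, (0 <= f x)%E) ->
  (\int[mu]_x f (z - x)%R = \int[mu]_x f x)%E.
Proof.
move=> mf f0; apply: (@integral_pushforward_invariant (fun x => z - x)) => //.
  exact: measurable_funB.
move=> a b.
rewrite (_ : _ @^-1` _ = `[z - b, z - a[%classic); last first.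
  apply/seteqP; split => x /=; rewrite !in_itv/= => /andP[h1 h2]; apply/andP; lra.
rewrite !lebesgue_measure_itv/= !lte_fin ltrD2l ltrN2; case: ifP => // _.
by rewrite -!EFinD; congr (_%:E); ring.
Qed.

Lemma lebesgue_integral_subr (z : R) (f : R -> \bar R) :
  measurable_fun [set: R] f -> (forall x, (0 <= f x)%E) ->
  (\int[mu]_x f (x - z)%R = \int[mu]_x f x)%E.
Proof.
move=> mf f0; apply: (@integral_pushforward_invariant (fun x => x - z)) => //.
  exact: measurable_funB.
move=> a b.
rewrite (_ : _ @^-1` _ = `]a + z, b + z]%classic); last first.
  apply/seteqP; split => x /=; rewrite !in_itv/= => /andP[h1 h2]; apply/andP; lra.
rewrite !lebesgue_measure_itv/= !lte_fin ltrD2r; case: ifP => // _.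
by rewrite -!EFinD; congr (_%:E); ring.
Qed.

End lebesgue_invariance.

(** * The kernel acting on functions of the distance to the origin *)

Section oscillating_kernel.
Context {R : realType} (alpha c_plus c_minus : R) (v_plus v_minus : R -> R).
Hypotheses (hvp : classD alpha c_plus v_plus) (hvm : classD alpha c_minus v_minus).
Context (K : R.-pker R ~> R).
Hypothesis hK : one_sided_oscillating_kernel v_plus v_minus K.
Local Notation mu := (@lebesgue_measure R).

Definition jump_density (z : R) : R -> R := if 0 < z then v_plus else v_minus.

Let kernel_density (z : R) (w : R -> R) (f : R -> R) :
  measurable_fun [set: R] w -> (forall y, 0 <= w y) ->
  (forall B, measurable B -> K z B = (\int[mu]_(t in B) (w t)%:E)%E) ->
  measurable_fun [set: R] f -> (forall t, 0 <= f t) ->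
  (\int[K z]_t (f t)%:E = \int[mu]_t (f t * w t)%:E)%E.
Proof.
move=> mw w0 hw mf f0.
have m1 : measurable_fun [set: R] (fun=> 1 : R) by exact: measurable_cst.
have mid : measurable_fun [set: R] (@id R) by exact: measurable_id.
have L1 := @integral_like_weight R _ R _ R (K z) _ _ _ measurableT mid m1 (fun=> ler01).
have L2 := @integral_like_weight R _ (measurableTypeR R) _ R mu _ _ _ measurableT mid mw w0.
have mEf : measurable_fun [set: R] (fun t => (f t)%:E) by exact/measurable_EFinP.
have h := integral_like_ext L1 L2 _ _ mEf.
have -> : (\int[K z]_t (f t)%:E = \int[K z]_t ((f t)%:E * 1%:E))%E.
  by apply: eq_integral => t _; rewrite mule1.
rewrite -[RHS](_ : \int[mu]_t ((f t)%:E * (w t)%:E) = _)%E; last first.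
  by apply: eq_integral => t _; rewrite EFinM.
apply: h => [B mB|t]; last by rewrite lee_fin.
under eq_integral do rewrite mule1.
rewrite integral_indic// setIT hw// [LHS]integral_mkcond.
apply: eq_integral => t _; rewrite patchE indicE.
by case: ifPn; rewrite ?mul1e ?mul0e.
Qed.

(** The walk always jumps towards the origin: from [z > 0] to [z - y], from [z < 0] to [z + y]. In
    both cases the new distance is [| |z| - y |], so for even functions the side survives only in
    the choice of the density. *)
Lemma kernel_even_integral (z : R) (f : R -> R) : z != 0 ->
  measurable_fun [set: R] f -> (forall t, 0 <= f t) ->
  (\int[K z]_t (f `|t|)%:E = 
   jump_mean (jump_density z) (fun y => f `| `|z| - y |)%R)%E.
Proof.
move=> z0 mf f0; have [hKp hKm _] := hK.
have mfn : measurable_fun [set: R] (fun t : R => f `|t|).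
  by apply: measurableT_comp => //; exact: measurable_normc.
have to_half_line v c : classD alpha c v -> forall g : R -> R,
    (\int[mu]_y (g y * v y)%:E = jump_mean v g)%E.
  move=> [_ [cf [_ _ _ _ vN]]] g; rewrite /jump_mean [RHS]integral_mkcond.
  apply: eq_integral => y _; rewrite patchE; case: ifPn => // /negP.
  rewrite inE/= in_itv/= andbT => /negP; rewrite -leNgt => /vN ->.
  by rewrite mulr0.
rewrite /jump_density; have [zp|zm|] := ltgtP z 0; last by move/eqP; rewrite (negbTE z0).
- have mv := classD_measurable hvm.
  rewrite (@kernel_density z (fun t => v_minus (t - z)) (fun t => f `|t|))//.
  + rewrite -(to_half_line _ _ hvm).
    rewrite -(@lebesgue_integral_subr _ z (fun y => (f `| `|z| - y| * v_minus y)%:E)).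
    * apply: eq_integral => t _; congr (f _ * _)%:E.
      by rewrite (ltr0_norm zp) opprB addKr normrN.
    * apply/measurable_EFinP; apply: measurable_funM => //.
      apply: measurableT_comp => //; apply: measurable_normc.
      exact: measurable_funB.
    * by move=> t; rewrite lee_fin mulr_ge0// (classD_ge0 hvm).
  + apply: measurableT_comp => //; exact: measurable_funB.
  + by move=> y; exact: (classD_ge0 hvm).
  + by move=> B mB; rewrite hKm.
- have mv := classD_measurable hvp.
  rewrite (@kernel_density z (fun t => v_plus (z - t)) (fun t => f `|t|))//.
  + rewrite -(to_half_line _ _ hvp).
    rewrite -(@lebesgue_integral_subl _ z (fun y => (f `| `|z| - y| * v_plus y)%:E)).
    * apply: eq_integral => t _; congr (f _ * _)%:E.
      by rewrite (gtr0_norm zm) opprB addrCA subrr addr0.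
    * apply/measurable_EFinP; apply: measurable_funM => //.
      apply: measurableT_comp => //; apply: measurable_normc.
      exact: measurable_funB.
    * by move=> t; rewrite lee_fin mulr_ge0// (classD_ge0 hvp).
  + apply: measurableT_comp => //; exact: measurable_funB.
  + by move=> y; exact: (classD_ge0 hvp).
  + move=> B mB; rewrite hKp//; apply: eq_integral => t _.
    by rewrite /w_plus opprB.
Qed.

End oscillating_kernel.

(** * Survival probabilities as iterated integrals of the kernel *)

Section survival.
Context {R : realType} (K : R.-pker R ~> R) (a : R).
Local Open Scope ereal_scope.

(* [survival n z] is the probability that the chain started at [z] stays outside
   [[- a, a]] up to time [n]. *)
Fixpoint survival (n : nat) (z : R) : \bar R :=
  if n is m.+1 then (beyond a `|z|)%:E * \int[K z]_t survival m t
  else (beyond a `|z|)%:E.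

Let mbeyond : measurable_fun [set: R] (fun z : R => (beyond a `|z|)%:E).
Proof. by apply/measurable_EFinP/measurable_beyond/measurable_normc. Qed.

Lemma survival_ge0 n z : 0 <= survival n z.
Proof.
elim: n z => [|n IH] z /=; first by rewrite lee_fin beyond_ge0.
by rewrite mule_ge0 ?lee_fin ?beyond_ge0//; exact: integral_ge0.
Qed.

Lemma measurable_survival n : measurable_fun [set: R] (survival n).
Proof.
elim: n => [|n IH] //=; apply: emeasurable_funM => //.
apply: measurable_fun_integral_kernel => //; first exact: measurable_kernel.
exact: survival_ge0.
Qed.

Lemma survival_le_beyond n z : survival n z <= (beyond a `|z|)%:E.
Proof.
elim: n z => [|n IH] z //=.
rewrite -[leRHS]mule1 lee_wpmul2l ?lee_fin ?beyond_ge0//.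
have <- : \int[K z]_t 1 = 1 by rewrite integral_cst// prob_kernel mule1.
apply: ge0_le_integral => //.
- by move=> t _; exact: survival_ge0.
- exact: measurable_survival.
- by move=> t _; rewrite (le_trans (IH t))// lee_fin beyond_le1.
Qed.

Lemma survival_le1 n z : survival n z <= 1.
Proof. by rewrite (le_trans (survival_le_beyond n z))// lee_fin beyond_le1. Qed.

End survival.

(** * Upper and lower bounds for the survival probabilities *)

Section survival_bounds.
Context {R : realType} (alpha c_plus c_minus : R) (v_plus v_minus : R -> R).
Hypotheses (alpha0 : 0 < alpha) (cp0 : 0 < c_plus) (cm0 : 0 < c_minus).
Hypotheses (hvp : classD alpha c_plus v_plus) (hvm : classD alpha c_minus v_minus).
Context (K : R.-pker R ~> R).
Hypothesis hK : one_sided_oscillating_kernel v_plus v_minus K.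
Context (a : R).
Hypothesis a0 : 0 < a.
Local Notation jd := (jump_density v_plus v_minus).

Let S n z := survival K a n z.
Let S0 n z : (0 <= S n z)%E := survival_ge0 K a n z.
Let mS n : measurable_fun [set: R] (S n) := measurable_survival K a n.

Let SS n z : a < `|z| -> S n.+1 z = (\int[K z]_t S n t)%E.
Proof. by move=> az; rewrite /S /= /beyond az mul1e. Qed.

Let jd_ind (P : (R -> R) -> Prop) : P v_plus -> P v_minus -> forall z, P (jd z).
Proof. by move=> Pp Pm z; rewrite /jump_density; case: ifP. Qed.

Let jd_measurable z : measurable_fun [set: R] (jd z).
Proof. by apply: jd_ind; [exact: classD_measurable hvp|exact: classD_measurable hvm]. Qed.

Let jd_ge0 z y : 0 <= jd z y.
Proof.
move: y; apply: (jd_ind (P := fun v => forall y, 0 <= v y)).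
  exact: (classD_ge0 hvp).
exact: (classD_ge0 hvm).
Qed.

Let az0 (z : R) : a < `|z| -> z != 0.
Proof. by move=> az; rewrite -normr_gt0 (lt_trans a0). Qed.

Lemma survival_step_le n (r : R) (f : R -> R) z :
  measurable_fun [set: R] f -> (forall t, 0 <= f t) -> 0 <= r -> a < `|z| ->
  (forall t, (r%:E * S n t <= (beyond a `|t| * f `|t|)%:E)%E) ->
  (r%:E * S n.+1 z <= jump_mean (jd z)
     (fun y => beyond a `| `|z| - y| * f `| `|z| - y|)%R)%E.
Proof.
move=> mf f0 r0 az h; rewrite SS//.
have mF : measurable_fun [set: R] (fun t => beyond a t * f t).
  by apply: measurable_funM => //; apply: measurable_beyond; exact: measurable_id.
have mFn : measurable_fun [set: R] (fun t : R => (beyond a `|t| * f `|t|)%:E).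
  apply/measurable_EFinP; apply: (measurableT_comp mF).
  by apply: measurable_normc; exact: measurable_id.
have F0 t : 0 <= beyond a t * f t by rewrite mulr_ge0 ?beyond_ge0.
rewrite -(kernel_even_integral hvp hvm hK (az0 az) mF F0).
rewrite -ge0_integralZl_EFin//.
apply: ge0_le_integral => //.
- by move=> t _; rewrite mule_ge0// S0.
- by apply: measurable_funeM; exact: mS.
Qed.

(** The additive error [k] passes through the step unchanged because [K z] has mass 1. *)
Lemma survival_step_ge n (r k : R) (f : R -> R) z :
  measurable_fun [set: R] f -> (forall t, 0 <= f t) -> 0 <= r -> 0 <= k ->
  a < `|z| ->
  (forall t, ((f `|t|)%:E <= r%:E * S n t + k%:E)%E) ->
  (jump_mean (jd z) (fun y => f `| `|z| - y|)%R <= r%:E * S n.+1 z + k%:E)%E.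
Proof.
move=> mf f0 r0 k0 az h; rewrite SS//.
rewrite -(kernel_even_integral hvp hvm hK (az0 az) mf f0).
have kE : (\int[K z]_t k%:E = k%:E)%E by rewrite integral_cst// prob_kernel mule1.
have mrS : measurable_fun [set: R] (fun t => r%:E * S n t)%E.
  by apply: measurable_funeM; exact: mS.
rewrite -[X in (_ <= _ + X)%E]kE -ge0_integralZl_EFin//.
rewrite -ge0_integralD//; last first.
  by move=> t _; rewrite mule_ge0// S0.
apply: ge0_le_integral => //.
- by move=> t _; rewrite lee_fin.
- apply/measurable_EFinP; apply: (measurableT_comp mf).
  by apply: measurable_normc; exact: measurable_id.
- by apply: emeasurable_funD.
Qed.

Let S_le1 n z : (S n z <= 1)%E := survival_le1 K a n z.

Let S_inside n z : `|z| <= a -> S n z = 0%E.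
Proof.
move=> za; apply/eqP; rewrite eq_le S0 andbT.
apply: le_trans (survival_le_beyond K a n z) _.
by rewrite /beyond ltNge za.
Qed.

(* A function [V] with drift at most [- rho] on [a < |z| <= y] bounds the
   survival probabilities through [n * S n <= S 0 + ... + S n]. *)
Let survival_potential_bound C g y rho : 0 <= C -> 0 < g -> 0 < y -> 0 < rho ->
  (forall z, a < `|z| -> `|z| <= y ->
     (jump_mean (jd z) (fun x => beyond a `| `|z| - x| *
        (C + (Num.min `| `|z| - x| y) `^ g))%R <= (C + `|z| `^ g - rho)%:E)%E) ->
  forall n z, ((n%:R)%:E * S n z <=
    (beyond a `|z| * ((rho^-1 + n%:R / y `^ g) *
       (C + (Num.min `|z| y) `^ g)))%:E)%E.
Proof.
move=> C0 g0 y0 rho0 drift; elim=> [|n IH] z.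
  by rewrite mul0e lee_fin !mulr_ge0 ?beyond_ge0 ?addr_ge0 ?powR_ge0 ?invr_ge0 ?(ltW rho0)//.
have [za|az] := leP `|z| a.
  by rewrite S_inside// mule0 lee_fin /beyond ltNge za mul0r.
have yg : 0 < y `^ g by exact: powR_gt0.
have k0 : 0 <= rho^-1 + n%:R / y `^ g.
  by rewrite addr_ge0 ?invr_ge0 ?divr_ge0 ?(ltW rho0) ?(ltW yg).
have -> : beyond a `|z| = 1 by rewrite /beyond az.
rewrite mul1r.
(* Above the level [y] the claim holds without drift: the summand [n.+1 / y^g] times [y^g] is
   already [n.+1]. *)
have [zy|yz] := leP `|z| y; last first.
  apply: le_trans (lee_wpmul2l _ (S_le1 _ _)) _; first by rewrite lee_fin.
  rewrite mule1 lee_fin.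
  apply: (@le_trans _ _ (n.+1%:R / y `^ g * y `^ g)).
    by rewrite divfK// gt_eqF.
  apply: ler_pM.
  - by rewrite divr_ge0// ltW.
  - exact: ltW.
  - by rewrite lerDr invr_ge0 ltW.
  - by rewrite lerDr.
rewrite -natr1 EFinD ge0_muleDl ?lee_fin// mul1e.
set k := rho^-1 + n%:R / y `^ g in IH k0.
have mV : measurable_fun [set: R] (fun t : R => C + (Num.min t y) `^ g).
  by solve_mfun.
have h := @survival_step_le n n%:R (fun t => k * (C + (Num.min t y) `^ g)) z _ _ _ az IH.
have {}h : ((n%:R)%:E * S n.+1 z <= (k * (C + `|z| `^ g - rho))%:E)%E.
  apply: le_trans (h _ _ _) _ => //.
  - by apply: measurable_funM => //; exact: measurable_cst.
  - by move=> t; rewrite mulr_ge0// addr_ge0// powR_ge0.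
  rewrite EFinM; apply: le_trans (lee_wpmul2l _ (drift z az zy)); last by rewrite lee_fin.
  rewrite -jump_meanZ//.
  - by rewrite le_eqVlt; apply/orP; left; apply/eqP/eq_jump_mean => x _; rewrite mulrCA.
  - by solve_mfun.
  - by move=> x _; rewrite mulr_ge0 ?beyond_ge0// addr_ge0// powR_ge0.
apply: le_trans (leeD h (S_le1 _ _)) _.
rewrite -EFinD lee_fin.
(* The decrease [k * rho] of the bound pays for the additional summand [S n.+1 z], which is at most
   1. *)
have hk : 1 <= k * rho.
  by rewrite /k mulrDl mulVf ?gt_eqF// lerDl mulr_ge0 ?divr_ge0 ?(ltW yg) ?(ltW rho0).
have -> : rho^-1 + (n%:R + 1) / y `^ g = k + (y `^ g)^-1.
  by rewrite /k mulrDl mul1r addrA.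
have : 0 <= (y `^ g)^-1 * (C + `|z| `^ g).
  by rewrite mulr_ge0 ?invr_ge0 ?addr_ge0 ?powR_ge0// ltW.
set W := C + `|z| `^ g => hW.
rewrite [leRHS]mulrDl mulrBr.
by rewrite -addrA lerD2l (le_trans _ hW)// addrC subr_le0.
Qed.

Lemma survival_upper_le1 g : 1 / 2 < alpha -> alpha <= 1 ->
  0 < g < 2 * alpha - 1 -> forall z, exists2 C : R, 0 <= C &
    forall n, (0 < n)%N -> (S n z <= (C * n%:R `^ (- (g / alpha)))%:E)%E.
Proof.
move=> a12 a1 hg z; have /andP[g0 g1] := hg.
have [C1 [e1 [C10 e10 h1]]] := subcritical_killed_drift alpha0 cp0 hvp a0 a12 a1 hg.
have [C2 [e2 [C20 e20 h2]]] := subcritical_killed_drift alpha0 cm0 hvm a0 a12 a1 hg.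
pose C := Num.max C1 C2; pose e := Num.min e1 e2.
have C0 : 0 <= C by rewrite le_max C10.
have e0 : 0 < e by rewrite lt_min e10 e20.
have C1C : C1 <= C by rewrite le_max lexx.
have C2C : C2 <= C by rewrite le_max lexx orbT.
have ee1 : e <= e1 by rewrite ge_min lexx.
have ee2 : e <= e2 by rewrite ge_min lexx orbT.
exists ((e^-1 + 1) * (C + `|z| `^ g)) => [|n n0].
  by rewrite mulr_ge0 ?addr_ge0 ?invr_ge0 ?powR_ge0// ltW.
have nR : 0 < n%:R :> R by rewrite ltr0n.
(* Since [y^alpha = n], the inverse drift [rho^-1] and the term [n / y^g] are both of order
   [n^(1 - g / alpha)]. *)
pose y : R := n%:R `^ alpha^-1.
have y0 : 0 < y by exact: powR_gt0.
have y1 : 1 <= y.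
  have ai : 0 <= alpha^-1 by rewrite invr_ge0 ltW.
  have n1 : 1 <= n%:R :> R by rewrite ler1n.
  by have := le_powR ai ler01 n1; rewrite powR1.
have ya : y `^ alpha = n%:R by rewrite powR_invK// ltW.
have yg : y `^ g = n%:R `^ (g / alpha) by rewrite /y -powRrM mulrC.
have rho0 : 0 < e * y `^ (g - alpha) by rewrite mulr_gt0// powR_gt0.
have drift w : a < `|w| -> `|w| <= y ->
     (jump_mean (jd w) (fun x => beyond a `| `|w| - x| *
        (C + (Num.min `| `|w| - x| y) `^ g))%R <=
        (C + `|w| `^ g - e * y `^ (g - alpha))%:E)%E.
  have jdE : jd w = v_plus \/ jd w = v_minus.
    by apply: (jd_ind (P := fun v => v = v_plus \/ v = v_minus)); [left|right].
  move: (jd w) jdE => v vE aw wy; case: vE => ->.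
    apply: le_trans (h1 C C1C y `|w| y1 aw wy) _.
    by rewrite lee_fin lerD2l lerN2 ler_wpM2r// powR_ge0.
  apply: le_trans (h2 C C2C y `|w| y1 aw wy) _.
  by rewrite lee_fin lerD2l lerN2 ler_wpM2r// powR_ge0.
have := survival_potential_bound C0 g0 y0 rho0 drift n z.
have [s s0 ->] : exists2 s : R, 0 <= s & S n z = s%:E.
  have [s /andP[s0 _] ->] := ge0_fin_numP (S0 n z) (S_le1 n z).
  by exists s.
rewrite -EFinM !lee_fin => h.
have kk0 : 0 <= (e * y `^ (g - alpha))^-1 + n%:R / y `^ g.
  by rewrite addr_ge0 ?divr_ge0 ?powR_ge0// invr_ge0 ltW.
have {}h : n%:R * s <= ((e * y `^ (g - alpha))^-1 + n%:R / y `^ g) * (C + `|z| `^ g).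
  apply: le_trans h _.
  apply: (@le_trans _ _ (1 * (((e * y `^ (g - alpha))^-1 + n%:R / y `^ g) *
      (C + Num.min `|z| y `^ g)))).
    rewrite ler_wpM2r ?beyond_le1//.
    by rewrite mulr_ge0// addr_ge0// powR_ge0.
  rewrite mul1r ler_wpM2l//.
  by rewrite lerD2l le_powR// ?(ltW g0) ?le_min ?normr_ge0 ?(ltW y0)// ge_min lexx.
rewrite -(ler_pM2l nR); apply: le_trans h _.
have -> : y `^ (g - alpha) = y `^ g / n%:R by rewrite powRDp// powRN ya.
rewrite powRN -yg le_eqVlt; apply/orP; left; apply/eqP.
by field; rewrite !gt_eqF// powR_gt0.
Qed.

Lemma survival_upper_gt1 g : 1 < g -> g < alpha ->
  forall z, exists2 C : R, 0 <= C &
    forall n, (0 < n)%N -> (S n z <= (C * n%:R `^ (- g))%:E)%E.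
Proof.
move=> g1 ga z.
have g0 : 0 < g by lra.
have [d1 [T1 [d10 T10 h1]]] := positive_speed_killed_drift hvp a0 g1 ga.
have [d2 [T2 [d20 T20 h2]]] := positive_speed_killed_drift hvm a0 g1 ga.
pose d := Num.min d1 d2; pose T := Num.max T1 T2.
have d0 : 0 < d by rewrite lt_min d10 d20.
have T0 : 0 < T by rewrite lt_max T10.
have dd1 : 0 <= d <= d1 by rewrite ltW//= ge_min lexx.
have dd2 : 0 <= d <= d2 by rewrite ltW//= ge_min lexx orbT.
exists ((`|z| + T) `^ g / d `^ g) => [|n n0]; first by rewrite divr_ge0 ?powR_ge0.
have nR : 0 < n%:R :> R by rewrite ltr0n.
have dn : 0 < (d * n%:R) `^ g by rewrite powR_gt0// mulr_gt0.
(* Here [n] is fixed and [k] counts the steps still to be survived. At [k = 0] the potential is at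
   least [(d * n)^g] outside [- a, a]; at [k = n] it no longer depends on [n], and dividing by
   [(d * n)^g] gives the bound. *)
suff bound k w : (k <= n)%N -> (((d * n%:R) `^ g)%:E * S k w <=
    (beyond a `|w| * (`|w| + (T + d * (n - k)%:R)) `^ g)%:E)%E.
  have := bound n z (leqnn n); rewrite subnn mulr0 addr0.
  have [s /andP[s0 _] ->] := ge0_fin_numP (S0 n z) (S_le1 n z).
  rewrite -EFinM !lee_fin => h.
  rewrite -(ler_pM2l dn) powRN.
  rewrite (powRM _ (ltW d0) (ltW nR)) in h *.
  apply: le_trans h _.
  have -> : d `^ g * n%:R `^ g * ((`|z| + T) `^ g / d `^ g / n%:R `^ g) = (`|z| + T) `^ g.
    by field; rewrite !gt_eqF// powR_gt0.
  by rewrite ler_piMl ?powR_ge0// beyond_le1.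
elim: k w => [|k IH] w kn.
  rewrite subn0 /S/= -EFinM lee_fin mulrC ler_wpM2l ?beyond_ge0//.
  apply: le_powR; [exact: ltW|by rewrite mulr_ge0// ltW|].
  by rewrite addrA lerDr addr_ge0// ltW.
have [wa|aw] := leP `|w| a.
  by rewrite S_inside// mule0 lee_fin /beyond ltNge wa mul0r.
have -> : beyond a `|w| = 1 by rewrite /beyond aw.
rewrite mul1r.
have IH' t := IH t (ltnW kn).
set tau := T + d * (n - k)%:R in IH'.
have tauE : tau = (T + d * (n - k.+1)%:R) + d.
  by rewrite /tau -[(n - k)%N]prednK ?subn_gt0// -subnS -natr1; ring.
have mf : measurable_fun [set: R] (fun t => (t + tau) `^ g) by solve_mfun.
have f0 t : 0 <= (t + tau) `^ g by exact: powR_ge0.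
apply: le_trans (survival_step_le mf f0 (powR_ge0 _ _) aw IH') _.
rewrite tauE.
have T'0 : T <= T + d * (n - k.+1)%:R by rewrite lerDl mulr_ge0// ltW.
have T1T : T1 <= T + d * (n - k.+1)%:R by apply: le_trans T'0; rewrite le_max lexx.
have T2T : T2 <= T + d * (n - k.+1)%:R by apply: le_trans T'0; rewrite le_max lexx orbT.
have e1 := h1 d _ `|w| dd1 T1T aw; have e2 := h2 d _ `|w| dd2 T2T aw.
apply: (@le_trans _ _ (jump_mean (jd w) (fun x => beyond a `| `|w| - x| *
    (`| `|w| - x| + (T + d * (n - k.+1)%:R) + d) `^ g)%R)).
  rewrite le_eqVlt; apply/orP; left; apply/eqP; apply: eq_jump_mean => x _.
  by rewrite addrA.
by rewrite /jump_density; case: ifP.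
Qed.

Let jump_moment s : 0 <= s -> s < alpha -> exists2 m : R, 0 <= m &
  forall z, (jump_mean (jd z) (fun x => x `^ s)%R <= m%:E)%E.
Proof.
move=> s0 sa.
have [m1 m10 h1] := jump_mean_powR_fin hvp s0 sa.
have [m2 m20 h2] := jump_mean_powR_fin hvm s0 sa.
exists (Num.max m1 m2); first by rewrite le_max m10.
move=> z; rewrite /jump_density; case: ifP => _.
  by rewrite h1 lee_fin le_max lexx.
by rewrite h2 lee_fin le_max lexx orbT.
Qed.

Let far_jump : exists k Y : R, [/\ 0 < k, 0 < Y &
  forall x z y, 0 < z -> z <= y -> Y <= y ->
    ((k * y `^ (- alpha))%:E <=
       jump_mean (jd x) (fun t => beyond y `|z - t|)%R)%E].
Proof.
have [k1 [Y1 [k10 Y10 h1]]] := far_jump_probability alpha0 cp0 hvp.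
have [k2 [Y2 [k20 Y20 h2]]] := far_jump_probability alpha0 cm0 hvm.
exists (Num.min k1 k2), (Num.max Y1 Y2); split.
- by rewrite lt_min k10.
- by rewrite lt_max Y10.
move=> x z y z0 zy; rewrite ge_max => /andP[Y1y Y2y].
rewrite /jump_density; case: ifP => _.
  apply: le_trans (h1 z y z0 zy Y1y); rewrite lee_fin ler_wpM2r ?powR_ge0//.
  by rewrite ge_min lexx.
apply: le_trans (h2 z y z0 zy Y2y); rewrite lee_fin ler_wpM2r ?powR_ge0//.
by rewrite ge_min lexx orbT.
Qed.

Let S_outside z : a < `|z| -> S 0 z = 1%E.
Proof. by move=> az; rewrite /S /= /beyond az. Qed.

(* By subadditivity [E min(|Z|, y) `^ s] decreases by at most [m] per step. *)
Let survival_linear s y m : 0 < s <= 1 -> 0 < y -> 0 <= m ->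
  (forall z, (jump_mean (jd z) (fun x => x `^ s)%R <= m%:E)%E) ->
  forall k z, (((Num.min `|z| y) `^ s)%:E <=
    (y `^ s)%:E * S k z + (a `^ s + k%:R * m)%:E)%E.
Proof.
move=> /andP[s0 s1] y0 m0 hm.
have min0 z : 0 <= Num.min `|z| y by rewrite le_min normr_ge0 ltW.
have base k z : `|z| <= a -> (((Num.min `|z| y) `^ s)%:E <=
    (y `^ s)%:E * S k z + (a `^ s + k%:R * m)%:E)%E.
  move=> za; rewrite S_inside// mule0 add0e lee_fin.
  rewrite (@le_trans _ _ (a `^ s))//; last by rewrite lerDl mulr_ge0.
  by apply: le_powR => //; [exact: ltW|rewrite ge_min za].
elim=> [|k IH] z; have [za|az] := leP `|z| a; try exact: base.
  rewrite S_outside// mule1 mul0r addr0 -EFinD lee_fin.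
  rewrite (@le_trans _ _ (y `^ s))//; last by rewrite lerDl powR_ge0.
  by apply: le_powR => //; [exact: ltW|rewrite ge_min lexx orbT].
have z0 : 0 < `|z| by apply: lt_trans az.
have s01 : 0 <= s <= 1 by rewrite ltW.
have drift : (((Num.min `|z| y) `^ s)%:E <=
    jump_mean (jd z) (fun x => (Num.min `| `|z| - x| y) `^ s)%R + m%:E)%E.
  apply: le_trans (leeD2l _ (hm z)).
  rewrite /jump_density; case: ifP => _.
    exact: (truncated_drift_ge hvp s01 z0 (ltW y0)).
  exact: (truncated_drift_ge hvm s01 z0 (ltW y0)).
apply: le_trans drift _.
have mf : measurable_fun [set: R] (fun t : R => (Num.min t y) `^ s) by solve_mfun.
have k0 : 0 <= a `^ s + k%:R * m by rewrite addr_ge0 ?powR_ge0// mulr_ge0.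
have := survival_step_ge mf (fun _ => powR_ge0 _ _) (powR_ge0 y s) k0 az IH.
move=> /(leeD2r m%:E)/le_trans; apply.
by rewrite -addeA -EFinD -addrA -natr1 mulrDl mul1r.
Qed.

(** For [|z| >= y] the linear bound reads [y^s <= y^s * S k z] plus an error, and the error is at
    most half of [y^s]. *)
Let survival_half s y m k z : 0 < s <= 1 -> 0 < y -> 0 <= m ->
  (forall z, (jump_mean (jd z) (fun x => x `^ s)%R <= m%:E)%E) ->
  2 * (a `^ s + k%:R * m) <= y `^ s -> y <= `|z| -> ((1 / 2)%:E <= S k z)%E.
Proof.
move=> s01 y0 m0 hm hk yz.
have := survival_linear s01 y0 m0 hm k z.
rewrite (min_idPr yz).
have [p _ ->] := ge0_fin_numP (S0 k z) (S_le1 k z).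
rewrite -EFinM -EFinD !lee_fin => h.
have ys : 0 < y `^ s by exact: powR_gt0.
rewrite -(ler_pM2l ys); lra.
Qed.

(* The truncation level [y = (D * n) `^ s^-1] from which the chain survives [n]
   steps with probability at least [1 / 2]. *)
Let survival_level s m B : 0 < s -> 0 <= m -> exists D N : R, [/\ 0 < D, 1 <= N &
  forall n, N <= n.+1%:R -> [/\ 0 < (D * n.+1%:R) `^ s^-1,
    B <= (D * n.+1%:R) `^ s^-1 &
    2 * (a `^ s + n%:R * m) <= ((D * n.+1%:R) `^ s^-1) `^ s]].
Proof.
move=> s0 m0; have as0 : 0 < a `^ s by exact: powR_gt0.
pose D := 2 * (a `^ s + m).
have D0 : 0 < D by rewrite mulr_gt0// ltr_wpDr.
exists D, (Num.max 1 ((Num.max B 0) `^ s / D)); split => //; first by rewrite le_max lexx.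
move=> n; rewrite ge_max => /andP[n1 nB].
have Dn : 0 < D * n.+1%:R by rewrite mulr_gt0// ltr0n.
split.
- exact: powR_gt0.
- have B0 : 0 <= Num.max B 0 by rewrite le_max lexx orbT.
  rewrite (@le_trans _ _ (Num.max B 0))//; first by rewrite le_max lexx.
  have si : 0 <= s^-1 by rewrite invr_ge0 ltW.
  move: nB; rewrite ler_pdivrMr// mulrC => /(le_powR si (powR_ge0 _ _)).
  by rewrite -powRrM mulfV ?gt_eqF// powRr1.
- rewrite powR_invK// ?(ltW Dn)// /D -mulrA ler_pM2l// mulrDl.
  apply: lerD; first by rewrite ler_peMr// ltW.
  by rewrite mulrC ler_wpM2l// ler_nat.
Qed.

Let pred_ge (N : R) n : 1 <= N -> N <= n%:R -> exists2 k, n = k.+1 & N <= k.+1%:R.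
Proof.
case: n => [|n] N1 Nn; last by exists n.
by have := le_trans N1 Nn; rewrite ler10.
Qed.

Let mbeyond y : measurable_fun [set: R] (beyond y : R -> R).
Proof. exact: (measurable_beyond y (@measurable_id _ R setT)). Qed.

Let mbeyondZ r y : measurable_fun [set: R] (fun t : R => r * beyond y t).
Proof. by apply: measurable_funM => //; exact: measurable_cst. Qed.

Lemma survival_lower_one_jump s z : 0 < s < 1 -> s < alpha -> a < `|z| ->
  exists c N : R, [/\ 0 < c, 0 < N & forall n, N <= n%:R ->
    ((c * n%:R `^ (- (alpha / s)))%:E <= S n z)%E].
Proof.
move=> /andP[s0 s1] sa az.
have s01 : 0 < s <= 1 by rewrite s0 ltW.
have [m m0 hm] := jump_moment (ltW s0) sa.
have [k [Y [k0 Y0 hY]]] := far_jump.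
have [D [N [D0 N1 hN]]] := survival_level (Num.max `|z| Y) s0 m0.
exists (1 / 2 * (k * D `^ (- (alpha / s)))), N; split.
- by rewrite !mulr_gt0// powR_gt0.
- exact: lt_le_trans N1.
(* One of the [n.+1] steps is spent on the jump beyond [y], the other [n] on surviving there. *)
move=> n /(pred_ge N1)[{}n -> Nn].
have [] := hN n Nn; set y := (D * n.+1%:R) `^ s^-1 => y0.
rewrite ge_max => /andP[zy Yy] hn.
have ya : y `^ (- alpha) = D `^ (- (alpha / s)) * n.+1%:R `^ (- (alpha / s)).
  by rewrite /y -powRrM mulrN [s^-1 * _]mulrC powRM// ltW.
have z0 : 0 < `|z| by apply: lt_trans az.
have mf : measurable_fun [set: R] (fun t : R => 1 / 2 * beyond y t).
  exact: mbeyondZ.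
have f0 t : 0 <= 1 / 2 * beyond y t by rewrite mulr_ge0 ?beyond_ge0.
have hS t : ((1 / 2 * beyond y `|t|)%:E <= 1%:E * S n t + 0%:E)%E.
  rewrite mul1e adde0 /beyond; have [yt|_] := ltP y `|t|; last by rewrite mulr0 S0.
  rewrite mulr1; apply: (survival_half s01 y0 m0 hm hn); exact: ltW.
have := survival_step_ge mf f0 ler01 (lexx 0) az hS.
rewrite mul1e adde0; apply: le_trans.
have half0 : 0 <= 1 / 2 :> R by [].
rewrite (@jump_meanZ _ _ (jd_measurable z) (jd_ge0 z))//.
- rewrite -[1 / 2 * _ * _]mulrA -[k * _ * _]mulrA -ya.
  rewrite EFinM lee_wpmul2l ?lee_fin//.
  by exact: (hY z `|z| y z0 zy Yy).
- by solve_mfun.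
Qed.

(** By induction on [j], [capped g M y |t|] is at most [2 * M * y^g * S j t + A^g]: below [A] the
    additive term suffices, beyond [y] survival has probability at least 1/2, and in between the
    capped power is a submartingale. Where it is at least [2 * A^g], the survival probability is
    therefore at least [A^g / (2 * M * y^g)], of order [n^(- g / s)]. One initial jump leads
    there. *)
Lemma survival_lower_excursion g s z : 1 / 2 < alpha -> alpha < 1 ->
  2 * alpha - 1 < g -> g < alpha -> 0 < s -> s < alpha -> a < `|z| ->
  exists c N : R, [/\ 0 < c, 0 < N & forall n, N <= n%:R ->
    ((c * n%:R `^ (- (g / s)))%:E <= S n z)%E].
Proof.
move=> a12 a1 gb ga s0 sa az.
have g0 : 0 < g by lra.
have s01 : 0 < s <= 1 by rewrite s0 ltW// (lt_trans sa).
have [m m0 hm] := jump_moment (ltW s0) sa.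
have [k [Y [k0 Y0 hY]]] := far_jump.
have [A1 [M1 [A10 M11 h1]]] := capped_drift_ge alpha0 cp0 hvp a12 a1 gb ga.
have [A2 [M2 [A20 M21 h2]]] := capped_drift_ge alpha0 cm0 hvm a12 a1 gb ga.
pose A := Num.max (Num.max A1 A2) a.
pose M := Num.max M1 M2.
have A0 : 0 < A by rewrite !lt_max A10.
have A1A : A1 <= A by rewrite !le_max lexx.
have A2A : A2 <= A by rewrite !le_max lexx orbT.
have aA : a <= A by rewrite !le_max lexx orbT.
have M1M : M1 <= M by rewrite le_max lexx.
have M2M : M2 <= M by rewrite le_max lexx orbT.
have M0 : 1 <= M by apply: le_trans M1M.
have Mg0 : 0 < M by lra.
(* Chosen with [A'^g = 2 * A^g], so that half of the starting value remains after the additive term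
   is subtracted. *)
pose A' := 2 `^ g^-1 * A.
have AA' : A <= A'.
  rewrite ler_peMl ?(ltW A0)//.
  have gi : 0 <= g^-1 by rewrite invr_ge0 ltW.
  have two : 1 <= 2 :> R by rewrite ler1n.
  by have := le_powR gi ler01 two; rewrite powR1.
have A'g : A' `^ g = 2 * A `^ g.
  by rewrite powRM ?powR_ge0 ?(ltW A0)// powR_invK.
(* The start [z] may lie too low. A jump beyond [A3] reaches [A'], and its probability is bounded
   below since [A3] exceeds both [|z|] and [Y]. *)
pose A3 := Num.max (Num.max A' `|z|) Y.
have A'A3 : A' <= A3 by rewrite !le_max lexx.
have zA3 : `|z| <= A3 by rewrite !le_max lexx orbT.
have YA3 : Y <= A3 by rewrite !le_max lexx orbT.
have A30 : 0 < A3 by apply: lt_le_trans YA3.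
have [D [N [D0 N1 hN]]] := survival_level A' s0 m0.
exists (A `^ g / (2 * M * D `^ (g / s)) * (k * A3 `^ (- alpha))), N; split.
- by rewrite !mulr_gt0 ?invr_gt0 ?mulr_gt0 ?powR_gt0.
- exact: lt_le_trans N1.
move=> n /(pred_ge N1)[{}n -> Nn].
have [] := hN n Nn; set y := (D * n.+1%:R) `^ s^-1 => y0 A'y hn.
have Ay : A <= y by apply: le_trans A'y.
have yg0 : 0 < y `^ g by exact: powR_gt0.
have Ag0 : 0 < A `^ g by exact: powR_gt0.
have yg : y `^ g = D `^ (g / s) * n.+1%:R `^ (g / s).
  by rewrite /y -powRrM [s^-1 * _]mulrC powRM// ltW.
have r0 : 0 <= 2 * M * y `^ g by rewrite !mulr_ge0// ltW.
have mcap : measurable_fun [set: R] (capped g M y).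
  rewrite (_ : capped g M y = fun t : R =>
    beyond y t * (M * y `^ g) + (1 - beyond y t) * t `^ g); last exact: funext.
  apply: measurable_funD.
    by apply: measurable_funM => //; exact: measurable_cst.
  apply: measurable_funM; last by solve_mfun.
  by apply: measurable_funB => //; exact: measurable_cst.
have cap0 t : 0 <= capped g M y t.
  rewrite /capped addr_ge0// mulr_ge0 ?beyond_ge0 ?powR_ge0 ?subr_ge0 ?beyond_le1//.
  by rewrite mulr_ge0// ltW.
have far j t : (j <= n)%N -> y < `|t| ->
    ((capped g M y `|t|)%:E <= (2 * M * y `^ g)%:E * S j t + (A `^ g)%:E)%E.
  move=> jn yt; rewrite /capped /beyond yt subrr mul0r addr0 mul1r.
  have hj : 2 * (a `^ s + j%:R * m) <= y `^ s.
    by apply: le_trans hn; rewrite ler_pM2l// lerD2l ler_wpM2r// ler_nat.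
  have := survival_half s01 y0 m0 hm hj (ltW yt).
  have [p _ ->] := ge0_fin_numP (S0 j t) (S_le1 j t).
  rewrite -EFinM -EFinD !lee_fin => hp.
  have : 2 * M * y `^ g * (1 / 2) <= 2 * M * y `^ g * p by rewrite ler_wpM2l.
  lra.
have near_ j t : `|t| <= A ->
    ((capped g M y `|t|)%:E <= (2 * M * y `^ g)%:E * S j t + (A `^ g)%:E)%E.
  move=> tA; rewrite /capped /beyond (ltNge y) (le_trans tA Ay)/= mul0r add0r subr0 mul1r.
  rewrite (@le_trans _ _ (A `^ g)%:E)//.
    by rewrite lee_fin; apply: le_powR => //; exact: ltW.
  by rewrite leeDr// mule_ge0// S0.
have claim j : (j <= n)%N -> forall t,
    ((capped g M y `|t|)%:E <= (2 * M * y `^ g)%:E * S j t + (A `^ g)%:E)%E.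
  elim: j => [|j IH] jn t.
    have [tA|At] := leP `|t| A; first exact: near_.
    have [ty|yt] := leP `|t| y; last exact: far.
    rewrite S_outside ?(le_lt_trans aA)// mule1 -EFinD lee_fin.
    rewrite /capped /beyond ltNge ty/= mul0r add0r subr0 mul1r.
    have : `|t| `^ g <= y `^ g by apply: le_powR => //; exact: ltW.
    have : y `^ g <= M * y `^ g by rewrite ler_peMl// ltW.
    lra.
  have [tA|At] := leP `|t| A; first exact: near_.
  have [ty|yt] := leP `|t| y; last exact: far.
  have at_ : a < `|t| by apply: le_lt_trans At.
  have := survival_step_ge mcap cap0 r0 (ltW Ag0) at_ (IH (ltnW jn)).
  apply: le_trans.
  rewrite {1}/capped {1 2}/beyond ltNge ty/= mul0r add0r subr0 mul1r.
  rewrite /jump_density; case: ifP => _.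
    by apply: h1 => //; apply: le_trans A1A (ltW At).
  by apply: h2 => //; apply: le_trans A2A (ltW At).
have mf : measurable_fun [set: R] (fun t : R => A `^ g / (2 * M * y `^ g) * beyond A3 t).
  exact: mbeyondZ.
have q0 : 0 <= A `^ g / (2 * M * y `^ g) by rewrite divr_ge0// ltW.
have f0 t : 0 <= A `^ g / (2 * M * y `^ g) * beyond A3 t by rewrite mulr_ge0 ?beyond_ge0.
have hS t : ((A `^ g / (2 * M * y `^ g) * beyond A3 `|t|)%:E <= 1%:E * S n t + 0%:E)%E.
  rewrite mul1e adde0 {1}/beyond; have [A3t|_] := ltP A3 `|t|; last by rewrite mulr0 S0.
  rewrite mulr1.
  have A't : A' <= `|t| by rewrite (le_trans A'A3)// ltW.
  have A'0 : 0 <= A' by rewrite (le_trans _ AA')// ltW.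
  have cap2 : 2 * A `^ g <= capped g M y `|t|.
    rewrite -A'g /capped /beyond; have [yt|ty] := ltP y `|t|.
      rewrite mul1r subrr mul0r addr0 (@le_trans _ _ (y `^ g))//.
        by apply: le_powR => //; exact: ltW.
      by rewrite ler_peMl// ltW.
    by rewrite mul0r add0r subr0 mul1r; apply: le_powR => //; exact: ltW.
  have := claim n (leqnn n) t.
  have [p _ ->] := ge0_fin_numP (S0 n t) (S_le1 n t).
  rewrite -EFinM -EFinD !lee_fin => hp.
  rewrite ler_pdivrMr ?mulr_gt0//; lra.
have zn : a < `|z| := az.
have := survival_step_ge mf f0 ler01 (lexx 0) zn hS.
rewrite mul1e adde0; apply: le_trans.
rewrite (@jump_meanZ _ _ (jd_measurable z) (jd_ge0 z))//.
- have -> : A `^ g / (2 * M * D `^ (g / s)) * (k * A3 `^ (- alpha)) * n.+1%:R `^ (- (g / s)) =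
      A `^ g / (2 * M * y `^ g) * (k * A3 `^ (- alpha)).
    by rewrite yg [_ `^ (- (g / s))]powRN !invfM; ring.
  rewrite EFinM lee_wpmul2l ?lee_fin//.
  by apply: hY => //; apply: lt_trans az.
- by solve_mfun.
Qed.

End survival_bounds.

(** * Moments of a random time from its tails *)

Section moments_from_tails.
Context {R : realType} {d : measure_display} {T : measurableType d}.
Context (P : probability T R) (tau : T -> \bar R).
Hypothesis mtau : measurable_fun [set: T] tau.
Hypothesis tau01 : forall w, (tau w = 0 \/ 1 <= tau w)%E.

Let B (n : nat) : set T := [set w | ((n%:R)%:E < tau w)%E].

Let mB n : measurable (B n).
Proof.
by rewrite -[B n]setTI; exact: (emeasurable_fun_o_infty measurableT mtau).
Qed.

Let tau0 w : (0 <= tau w)%E.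
Proof. by case: (tau01 w) => [->//|]; exact: le_trans. Qed.

Let mpow (q : R) : measurable_fun [set: T] (fun w => (tau w `^ q)%E).
Proof. exact: (measurableT_comp (measurable_poweR q)). Qed.

Let int1 : (\int[P]_w 1 = 1 :> \bar R)%E.
Proof. by rewrite integral_cst// mul1e; exact: probability_setT. Qed.

(** If [tau > 2^J], the last summand alone dominates [r^q]; otherwise [r <= 2^J] and the induction
    continues. A real [r <= tau w] stands for [tau w], which may be infinite. *)
Let pow_tau_dyadic (q : R) (J : nat) (r : R) w : 0 < q -> 0 <= r -> r <= 2 ^+ J ->
  (r%:E <= tau w)%E ->
  r `^ q <= 1 + \sum_(0 <= j < J) (2 ^+ j.+1) `^ q * \1_(B (2 ^ j)%N) w.
Proof.
move=> q0 r0; elim: J => [|J IH] rJ rt.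
  have one : 1 `^ q = 1 :> R by rewrite powR1.
  by rewrite big_geq// addr0 -one; apply: le_powR => //; exact: ltW.
rewrite big_nat_recr//=.
have s0 : 0 <= \sum_(0 <= j < J) (2 ^+ j.+1) `^ q * \1_(B (2 ^ j)%N) w :> R.
  by apply: sumr_ge0 => j _; rewrite mulr_ge0 ?powR_ge0.
have [Bw|Bw] := pselect (B (2 ^ J)%N w).
  rewrite indicE mem_set// mulr1 (@le_trans _ _ ((2 ^+ J.+1) `^ q))//.
    by apply: le_powR => //; exact: ltW.
  by rewrite addrA lerDr addr_ge0.
rewrite indicE memNset// mulr0 addr0; apply: IH => //.
move/negP: Bw; rewrite -leNgt natrX => /(le_trans rt).
by rewrite lee_fin.
Qed.

Let pow_tau_le (q : R) w : 0 < q -> (tau w `^ q <=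
  1 + \sum_(0 <= j <oo) ((2 ^+ j.+1) `^ q * \1_(B (2 ^ j)%N) w)%:E)%E.
Proof.
move=> q0; set L := (\sum_(0 <= j <oo) _)%E.
have F0 j : (0 <= j)%N -> true -> (0 <= ((2 ^+ j.+1) `^ q * \1_(B (2 ^ j)%N) w)%:E)%E.
  by rewrite lee_fin mulr_ge0 ?powR_ge0.
have bound r : 0 <= r -> (r%:E <= tau w)%E -> ((r `^ q)%:E <= 1 + L)%E.
  move=> r0 rt; pose J := Num.bound r.
  have rJ : r <= 2 ^+ J.
    rewrite (@le_trans _ _ J%:R)//.
      by have := archi_boundP r0; exact: ltW.
    by rewrite -natrX ler_nat ltnW// ltn_expl.
  apply: (@le_trans _ _ (1 + \sum_(0 <= j < J) ((2 ^+ j.+1) `^ q * \1_(B (2 ^ j)%N) w)%:E)%E).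
    by rewrite sumEFin -EFinD lee_fin pow_tau_dyadic.
  by rewrite leeD2l//; exact: nneseries_lim_ge.
have L0 : (0 <= L)%E by exact: nneseries_ge0.
have := tau0 w; move: bound; case: (tau w) => [r| |] bound //.
  by rewrite lee_fin => r0; rewrite poweR_EFin bound.
move=> _; rewrite poweRyr ?gt_eqF//.
move: L0 bound; case: L => [l| |]//; rewrite ?addey// lee_fin => l0 bound.
have l2 : 0 <= 2 + l by rewrite addr_ge0.
(* An infinite [tau w] exceeds every [r]; this one has [r^q = 2 + l], so the series cannot have a
   finite sum [l]. *)
have := bound ((2 + l) `^ q^-1) (powR_ge0 _ _) (leey _).
rewrite powR_invK//.
by rewrite -EFinD lee_fin lerD2r lern1.
Qed.

(** The dyadic series is dominated by a geometric one of ratio [2^(q - p) < 1]. *)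
Let moment_fin_gt0 (C p q : R) : 0 <= C -> 0 < q -> q < p ->
  (forall n, (0 < n)%N -> (P (B n) <= (C * n%:R `^ (- p))%:E)%E) ->
  (moment P tau q < +oo)%E.
Proof.
move=> C0 q0 qp tail; rewrite /moment.
pose F j w : \bar R := ((2 ^+ j.+1) `^ q * \1_(B (2 ^ j)%N) w)%:E.
have F0 j w : (0 <= F j w)%E by rewrite lee_fin mulr_ge0 ?powR_ge0.
have mF j : measurable_fun [set: T] (F j).
  by apply/measurable_EFinP; apply: measurable_funM => //.
have mL : measurable_fun [set: T] (fun w => \sum_(0 <= j <oo) F j w)%E.
  exact: ge0_emeasurable_sum.
have L0 w : (0 <= \sum_(0 <= j <oo) F j w)%E by exact: nneseries_ge0.
apply: (@le_lt_trans _ _ (\int[P]_w (1 + \sum_(0 <= j <oo) F j w))%E).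
  apply: ge0_le_integral => //.
  - by move=> w _; exact: poweR_ge0.
  - by apply: emeasurable_funD.
  - by move=> w _; exact: pow_tau_le.
rewrite ge0_integralD// int1 integral_nneseries// lte_add_pinfty ?ltry//.
pose x : R := 2 `^ (q - p).
have x0 : 0 < x by rewrite powR_gt0.
have x1 : x < 1.
  have pq : 0 < p - q by rewrite subr_gt0.
  rewrite /x -opprB powRN invf_lt1 ?powR_gt0//.
  have one : 1 `^ (p - q) = 1 :> R by rewrite powR1.
  by rewrite -[ltLHS]one gt0_ltr_powR ?nnegrE// ltr1n.
have term j : (\int[P]_w F j w <= ((C * 2 `^ q) * x ^+ j)%:E)%E.
  have -> : (\int[P]_w F j w = ((2 ^+ j.+1) `^ q)%:E * P (B (2 ^ j)%N))%E.
    rewrite /F; under eq_integral do rewrite EFinM.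
    rewrite ge0_integralZl_EFin ?powR_ge0//.
    - by rewrite integral_indic// setIT.
    - by apply/measurable_EFinP.
  apply: le_trans (lee_wpmul2l _ (tail _ _)) _.
  - by rewrite lee_fin powR_ge0.
  - by rewrite expn_gt0.
  rewrite -EFinM lee_fin le_eqVlt; apply/orP; left; apply/eqP.
  have t0 : 0 < 2 ^+ j :> R by exact: exprn_gt0.
  have -> : x ^+ j = (2 ^+ j) `^ (q - p).
    by rewrite /x -(powR_mulrn _ (powR_ge0 _ _)) -(powR_mulrn _ (ler0n R 2)) powRAC.
  rewrite exprS powRM ?(ltW t0)// natrX powRDp//; ring.
apply: (@le_lt_trans _ _ ((C * 2 `^ q / (1 - x))%:E)); last exact: ltry.
apply: lime_le.
  by apply: is_cvg_nneseries => j _ _; exact: integral_ge0.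
apply: nearW => n.
apply: (@le_trans _ _ (\sum_(0 <= j < n) ((C * 2 `^ q) * x ^+ j)%:E)%E).
  by apply: lee_sum => j _.
rewrite sumEFin lee_fin; apply: geometric_le_lim => //.
  by rewrite mulr_ge0 ?powR_ge0.
by rewrite ger0_norm// ltW.
Qed.

(** For [q <= 0] the content is that [tau] is almost surely finite, as [+oo^q] is [+oo] for negative
    [q]. Then [tau^q] is compared with [1 + tau^(p / 2)]: powers of 0 are at most 1 by convention,
    and so is [r^q] for finite [r >= 1]. *)
Lemma moment_fin C p q : 0 <= C -> 0 < p -> q < p ->
  (forall n, (0 < n)%N -> (P [set w | ((n%:R)%:E < tau w)%E] <=
                           (C * n%:R `^ (- p))%:E)%E) ->
  (moment P tau q < +oo)%E.
Proof.
move=> C0 p0 qp tail; have [q0|q0] := ltP 0 q; first exact: moment_fin_gt0 tail.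
have p2 : 0 < p / 2 by lra.
have p2p : p / 2 < p by lra.
have := moment_fin_gt0 C0 p2 p2p tail; rewrite /moment => fin.
apply: (@le_lt_trans _ _ (\int[P]_w (1 + tau w `^ (p / 2)))%E).
  apply: ge0_le_integral => //.
  - by move=> w _; exact: poweR_ge0.
  - by apply: emeasurable_funD.
  - move=> w _; have p2w : (0 <= tau w `^ (p / 2))%E by exact: poweR_ge0.
    have [->|] := tau01 w.
      apply: (@le_trans _ _ 1%E); last by rewrite leeDl// poweR_ge0.
      by rewrite poweR_EFin lee_fin /powR eqxx; case: (q == 0); rewrite ?ler01.
    case: (tau w) p2w => [r| |]//.
      rewrite !poweR_EFin !lee_fin => r2 r1.
      apply: (@le_trans _ _ 1); last by rewrite lerDl.
      rewrite -(powRr0 r) ler_powR//.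
    by move=> _ _; rewrite (@poweRyr _ (p / 2)) ?gt_eqF// addey// leey.
rewrite ge0_integralD//; last by move=> w _; exact: poweR_ge0.
by rewrite int1 lte_add_pinfty// ltry.
Qed.

(** Markov's inequality bounds the moment below by [c * n^(q - p)], which is unbounded in [n]. *)
Lemma moment_infty (c N p q : R) : 0 < c -> 0 < p -> p < q ->
  (forall n, N <= n%:R -> ((c * n%:R `^ (- p))%:E <=
     P [set w | ((n%:R)%:E < tau w)%E])%E) ->
  moment P tau q = +oo%E.
Proof.
move=> c0 p0 pq tail; have q0 : 0 < q by exact: lt_trans pq.
have bound n : N <= n%:R -> (0 < n)%N -> ((c * n%:R `^ (q - p))%:E <= moment P tau q)%E.
  move=> Nn n0; have n0R : 0 < n%:R :> R by rewrite ltr0n.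
  apply: (@le_trans _ _ ((n%:R `^ q)%:E * P (B n))%E).
    rewrite powRDp// mulrCA EFinM lee_wpmul2l ?lee_fin ?powR_ge0//.
    exact: tail.
  rewrite /moment -[B n]setIT -integral_indic// -ge0_integralZl_EFin ?powR_ge0//; last first.
    by apply/measurable_EFinP.
  apply: ge0_le_integral => //.
  - by apply: measurable_funeM; apply/measurable_EFinP.
  - move=> w _; have [Bw|Bw] := pselect (B n w); last first.
      by rewrite indicE memNset// mule0 poweR_ge0.
    rewrite indicE mem_set// mule1 -poweR_EFin.
    apply: gt0_ler_poweR; rewrite ?ltW//.
    + by rewrite in_itv/= leey lee_fin ler0n.
    + by rewrite in_itv/= leey tau0.
have : (0 <= moment P tau q)%E by apply: integral_ge0 => w _; exact: poweR_ge0.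
move: bound; case: (moment P tau q) => [m| |]// bound; rewrite lee_fin => m0.
have e0 : 0 < q - p by rewrite subr_gt0.
pose r := Num.max N (((m + 1) / c) `^ (q - p)^-1).
have r0 : 0 <= r by rewrite le_max powR_ge0 orbT.
have /ltW rn := archi_boundP r0; set n := Num.bound r in rn.
have Nn : N <= n%:R by apply: le_trans rn; rewrite le_max lexx.
have mn : (m + 1) / c <= n%:R `^ (q - p).
  have mc0 : 0 <= (m + 1) / c by rewrite divr_ge0 ?addr_ge0// ltW.
  rewrite -[leLHS](powR_invK e0 mc0); apply: le_powR; rewrite ?powR_ge0 ?(ltW e0)//.
  by apply: le_trans rn; rewrite le_max lexx orbT.
have n0 : (0 < n)%N.
  rewrite lt0n; apply: contraTneq mn => ->.
  rewrite -ltNge powR0 ?gt_eqF//.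
  by rewrite divr_gt0// ltr_wpDl.
have := bound n Nn n0; rewrite lee_fin.
move: mn; rewrite ler_pdivrMr// mulrC => /le_trans h /h.
by rewrite gerDl ler10.
Qed.

End moments_from_tails.

(** * Identification of the hitting time tails with the survival probabilities *)

Section chain.
Context {R : realType} {d : measure_display} {T : measurableType d}.
Context (P : probability T R) (K : R.-pker R ~> R) (x : R).
Context (Z : nat -> {RV P >-> R}).
Hypothesis hZ : markov_chain_from K x Z.
Context (a : R).

Let mZ n : measurable_fun [set: T] (Z n : T -> R) := measurable_funP (Z n).

Lemma natural_filtration_measurable n A : natural_filtration Z n A -> measurable A.
Proof.
apply: smallest_sub; first exact: sigma_algebra_measurable.
by move=> _ [k _ [B mB <-]]; exact: mZ.
Qed.

Lemma markov_integral n A (f : R -> \bar R) : natural_filtration Z n A ->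
  (forall t, (0 <= f t)%E) -> measurable_fun [set: R] f ->
  (\int[P]_(w in A) f (Z n.+1 w) = \int[P]_(w in A) \int[K (Z n w)]_t f t)%E.
Proof.
move=> FA f0 mf; have mA := natural_filtration_measurable FA.
have mk B : measurable B -> measurable_fun [set: T] (fun w => K (Z n w) B).
  by move=> mB; exact: (measurableT_comp (measurable_kernel K B mB)).
have m1 : measurable_fun [set: T] (fun=> 1 : R) by exact: measurable_cst.
have L1 := @integral_like_weight R _ _ _ _ P _ _ _ mA (mZ n.+1) m1 (fun=> ler01).
have L2 := @integral_like_kernel R _ _ _ _ P _ (fun w => K (Z n w)) mA mk.
rewrite -(integral_like_ext L1 L2 _ f0 mf) => [|B mB].
  by apply: eq_integral => w _; rewrite mule1.
transitivity (P (A `&` (Z n.+1 @^-1` B))).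
  rewrite setIC -integral_indic//; last first.
    by rewrite -[X in measurable X]setTI; exact: mZ.
  by apply: eq_integral => w _; rewrite mule1.
rewrite (hZ.2 _ _ _ FA mB); apply: eq_integral => w _.
by rewrite integral_indic// setIT.
Qed.

Let stay n : set T := [set w | forall k, (k <= n)%N -> a < `|Z k w|].

Let stay_filtration n : natural_filtration Z n (stay n).
Proof.
have -> : stay n = \bigcap_(k in [set k | (k <= n)%N]) (Z k @^-1` [set t : R | a < `|t|]).
  by apply/seteqP; split => w.
pose G := \bigcup_(k in [set k | (k <= n)%N])
        preimage_set_system [set: T] (Z k) measurable.
have mo : measurable [set t : R | a < `|t|].
  have mn : measurable_fun [set: R] (fun t : R => `|t|).
    by apply: measurable_normc; exact: measurable_id.
  rewrite (_ : [set t : R | _] = [set: R] `&` (fun t : R => `|t|) @^-1` `]a, +oo[).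
    exact: mn.
  by apply/seteqP; split=> t /=; rewrite in_itv/= andbT => // -[].
apply: (@bigcap_measurable _ (g_sigma_algebraType G)); first by exists 0%N.
move=> k kn; apply: sub_sigma_algebra; exists k => //.
by exists [set t : R | a < `|t|] => //; rewrite setTI.
Qed.

Let mstay n : measurable (stay n).
Proof. by apply: natural_filtration_measurable; exact: stay_filtration. Qed.

(** Induction on [k] at variable [m]: the Markov property at time [m] moves one step from [survival]
    into the event [stay]. Enlarging [stay m.+1] to [stay m] is harmless since [survival] vanishes
    on [- a, a]. *)
Lemma survival_stay k m :
  (\int[P]_(w in stay m) survival K a k (Z m w) = P (stay (m + k)))%E.
Proof.
elim: k m => [|k IH] m.
  rewrite addn0 -[RHS]mul1e -integral_cst//.
  apply: eq_integral => w; rewrite inE => /(_ m (leqnn m)) /= aw.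
  by rewrite /beyond aw.
rewrite addnS -addSn -IH.
transitivity (\int[P]_(w in stay m) \int[K (Z m w)]_t survival K a k t)%E.
  apply: eq_integral => w; rewrite inE => /(_ m (leqnn m)) /= aw.
  by rewrite /beyond aw mul1e.
rewrite -(markov_integral (@stay_filtration m) (survival_ge0 K a k) (measurable_survival K a k)).
rewrite [LHS]integral_mkcond [RHS]integral_mkcond; apply: eq_integral => w _.
rewrite !patchE; case: ifPn => [|].
  rewrite inE => sm; case: ifPn => //; rewrite notin_setE => nsm.
  have [aw|aw] := ltP a `|Z m.+1 w|.
    case: nsm => j; rewrite leq_eqVlt => /orP[/eqP->//|]; exact: sm.
  apply/eqP; rewrite eq_le survival_ge0 andbT.
  by rewrite (le_trans (survival_le_beyond K a k _))// /beyond ltNge aw.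
rewrite notin_setE => nsm; case: ifPn => //; rewrite inE => sm.
by case: nsm => j jm; apply: sm; exact: leqW.
Qed.

(** The chain starts at [x] only almost surely, so the integral over [stay 0] is split into the
    event [Z 0 = x] and a null remainder. *)
Lemma survivalE n : a < `|x| -> P (stay n) = survival K a n x.
Proof.
move=> ax; rewrite -[n]add0n -survival_stay.
have mx : measurable [set w | Z 0%N w = x].
  by rewrite -[X in measurable X]setTI; exact: (@mZ 0%N measurableT [set x]).
have sub : [set w | Z 0%N w = x] `<=` stay 0.
  by move=> w wx k; rewrite leqn0 => /eqP->; rewrite wx.
have null : P (~` [set w | Z 0%N w = x]) = 0%E.
  by rewrite probability_setC// hZ.1 subee.
rewrite -(setDUK sub) ge0_integral_setU//; first last.
- by apply/disj_setPS => w [wx [_ /(_ wx)]].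
- by move=> w _; exact: survival_ge0.
- apply: measurable_funTS; apply: measurableT_comp; first exact: measurable_survival.
  exact: mZ.
- exact: measurableD.
have mD : measurable (stay 0 `\` [set w | Z 0%N w = x]) by exact: measurableD.
have Dnull : P (stay 0 `\` [set w | Z 0%N w = x]) = 0%E.
  apply/eqP; rewrite eq_le measure_ge0 andbT -null; apply: le_measure; rewrite ?inE//.
  exact: measurableC.
rewrite [X in (_ + X)%E](_ : _ = 0%E) ?adde0; last first.
  apply/eqP; rewrite eq_le integral_ge0 ?andbT; last by move=> w _; exact: survival_ge0.
  apply: (@le_trans _ _ (\int[P]_(w in stay 0 `\` [set w | Z 0%N w = x]) 1)%E).
    apply: ge0_le_integral => //.
    - by move=> w _; exact: survival_ge0.
    - apply: measurable_funTS; apply: measurableT_comp; first exact: measurable_survival.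
      exact: mZ.
    - by move=> w _; exact: survival_le1.
  by rewrite integral_cst// mul1e [leLHS]Dnull.
rewrite (eq_integral (fun=> survival K a n x)); last by move=> w; rewrite inE /= => ->.
by rewrite integral_cst// [X in (_ * X)%E](hZ.1) mule1.
Qed.

Let tau := hitting_time Z a.

Lemma hitting_time_gtP n w : ((n%:R)%:E < tau w)%E <-> stay n w.
Proof.
split=> [h k kn|h].
  rewrite ltNge; apply/negP => aw; move: h; apply/negP; rewrite -leNgt.
  apply: (@le_trans _ _ (k%:R)%:E); last by rewrite lee_fin ler_nat.
  by apply: ereal_inf_lbound; exists k.
apply: (@lt_le_trans _ _ (n.+1%:R)%:E); first by rewrite lte_fin ltr_nat.
apply: le_ereal_inf_tmp => _ [k /= ka <-]; rewrite lee_fin ler_nat ltnNge.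
by apply/negP => /h; rewrite ltNge ka.
Qed.

Lemma hitting_time01 w : (tau w = 0 \/ 1 <= tau w)%E.
Proof.
have [h|h] := pselect (stay 0 w).
  right; apply: le_ereal_inf_tmp => _ [k /= ka <-]; rewrite lee_fin ler1n lt0n.
  by apply/negP => /eqP k0; move: (h 0%N (leqnn _)); rewrite -k0 ltNge ka.
left; apply/eqP; rewrite eq_le; apply/andP; split.
  by rewrite leNgt; apply/negP => /(@hitting_time_gtP 0%N w).1.
by apply: le_ereal_inf_tmp => _ [k _ <-]; rewrite lee_fin.
Qed.

(** A countable infimum of functions equal to [k] where [|Z k| <= a] and to [+oo] elsewhere. *)
Lemma measurable_hitting_time : measurable_fun [set: T] tau.
Proof.
pose F k w : \bar R := if `|Z k w| <= a then (k%:R)%:E else +oo%E.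
have mF k : measurable_fun [set: T] (F k).
  apply: measurable_fun_ifT => //; apply: measurable_fun_ler => //.
  by apply: measurable_normc; exact: mZ.
rewrite (_ : tau = fun w => einfs (F ^~ w) 0%N); first exact: measurable_fun_einfs.
apply/funext => w; apply/eqP; rewrite eq_le; apply/andP; split.
  apply: le_ereal_inf_tmp => _ [k _ <-]; rewrite /F; case: ifPn => [ka|_]; last exact: leey.
  by apply: ereal_inf_lbound; exists k.
apply: le_ereal_inf_tmp => _ [k /= ka <-].
by apply: ereal_inf_lbound; exists k => //; rewrite /F ka.
Qed.

Lemma hitting_time_tail n : a < `|x| ->
  P [set w | ((n%:R)%:E < tau w)%E] = survival K a n x.
Proof.
move=> ax; rewrite -survivalE//; congr (P _).
by apply/seteqP; split => w; [move/(@hitting_time_gtP n w).1|move/(@hitting_time_gtP n w).2].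
Qed.

End chain.

(** * Choice of the exponents in the four cases *)

Theorem theorem3p4 (R : realType)
    (alpha c_plus c_minus : R) (v_plus v_minus : R -> R)
    (halpha : 1 / 2 < alpha) (hcp : 0 < c_plus) (hcm : 0 < c_minus)
    (hvp : classD alpha c_plus v_plus) (hvm : classD alpha c_minus v_minus)
    (K : R.-pker R ~> R)
    (hK : one_sided_oscillating_kernel v_plus v_minus K)
    (a x : R) (ha : 0 < a) (hx : x \notin `[- a, a])
    (d : measure_display) (T : measurableType d) (P : probability T R)
    (Z : nat -> {RV P >-> R})
    (hZ : markov_chain_from K x Z) :
  (1 <= alpha ->
    forall q : R,
      (q < alpha -> (moment P (hitting_time Z a) q < +oo)%E) /\
      (alpha < q -> moment P (hitting_time Z a) q = +oo%E)) /\
  (1 / 2 < alpha < 1 ->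
    forall q : R,
      (q < 2 - 1 / alpha -> (moment P (hitting_time Z a) q < +oo)%E) /\
      (2 - 1 / alpha < q -> moment P (hitting_time Z a) q = +oo%E)).
Proof.
have ax : a < `|x|.
  move: hx; rewrite in_itv/= negb_and -!ltNge => /orP[xa|].
    by rewrite -normrN (lt_le_trans _ (ler_norm (- x)))// ltrNr.
  by move=> /lt_le_trans; apply; exact: ler_norm.
have a0 : 0 < alpha by lra.
have tail n : (P [set w | (n%:R)%:E < hitting_time Z a w] = survival K a n x)%E.
  exact: (hitting_time_tail hZ n ax).
have mtau := measurable_hitting_time Z a.
have tau01 := hitting_time01 Z a.
have fin C p q : 0 <= C -> 0 < p -> q < p ->
    (forall n, (0 < n)%N -> (survival K a n x <= (C * n%:R `^ (- p))%:E)%E) ->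
    (moment P (hitting_time Z a) q < +oo)%E.
  move=> C0 p0 qp h; apply: (moment_fin mtau tau01 C0 p0 qp) => n n0.
  by rewrite tail h.
have infty (c N p q : R) : 0 < c -> 0 < p -> p < q ->
    (forall n, N <= n%:R -> ((c * n%:R `^ (- p))%:E <= survival K a n x)%E) ->
    moment P (hitting_time Z a) q = +oo%E.
  move=> c0 p0 pq h; apply: (moment_infty mtau tau01 c0 p0 pq (N := N)) => n Nn.
  by rewrite tail h.
split=> [a1 q|/andP[a12 a1] q]; split=> hq.
- have [a1'|a1'] := ltP 1 alpha.
    (* The upper bound requires [1 < g < alpha], whereas [q] may be small or negative. *)
    pose g := (Num.max 1 q + alpha) / 2.
    have mg : Num.max 1 q < alpha by rewrite gt_max a1'.
    have qm : q <= Num.max 1 q by rewrite le_max lexx orbT.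
    have m1 : 1 <= Num.max 1 q by rewrite le_max lexx.
    have g1 : 1 < g by rewrite /g; lra.
    have ga : g < alpha by rewrite /g; lra.
    have qg : q < g by rewrite /g; lra.
    have [C C0 h] := survival_upper_gt1 hvp hvm hK ha g1 ga x.
    by apply: (fin C g) => //; lra.
  have ae : alpha = 1 by apply/eqP; rewrite eq_le a1' a1.
  pose g := (Num.max 0 q + 1) / 2.
  have mg : Num.max 0 q < 1 by rewrite gt_max ltr01 -ae.
  have qm : q <= Num.max 0 q by rewrite le_max lexx orbT.
  have m0 : 0 <= Num.max 0 q by rewrite le_max lexx.
  have g01 : 0 < g < 2 * alpha - 1 by rewrite /g ae; apply/andP; split; lra.
  have [C C0 h] := survival_upper_le1 a0 hcp hcm hvp hvm hK ha halpha a1' g01 x.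
  apply: (fin C (g / alpha)) => //.
    by rewrite divr_gt0//; case/andP: g01.
  by rewrite ae divr1 /g; lra.
- have q0 : 0 < q by exact: lt_trans hq.
  (* Any [s] strictly between [alpha / q] and 1 gives a tail exponent [alpha / s] below [q]. *)
  pose s := (alpha / q + 1) / 2.
  have aq1 : alpha / q < 1 by rewrite ltr_pdivrMr// mul1r.
  have aq0 : 0 < alpha / q by rewrite divr_gt0.
  have s01 : 0 < s < 1 by rewrite /s; apply/andP; split; lra.
  have sa : s < alpha by case/andP: s01 => _ /lt_le_trans; apply.
  have s0 : 0 < s by case/andP: s01.
  have [c [N [c0 _ h]]] := survival_lower_one_jump a0 hcp hcm hvp hvm hK ha s01 sa ax.
  apply: (infty c N (alpha / s)) => //; first by rewrite divr_gt0.
  by rewrite ltr_pdivrMr// mulrC -ltr_pdivrMr// /s; lra.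
- pose g := (Num.max 0 (q * alpha) + (2 * alpha - 1)) / 2.
  have hb : 2 - 1 / alpha = (2 * alpha - 1) / alpha.
    by field; rewrite gt_eqF.
  have qa : q * alpha < 2 * alpha - 1 by rewrite -ltr_pdivlMr// -hb.
  have mg : Num.max 0 (q * alpha) < 2 * alpha - 1.
    by rewrite gt_max qa andbT; lra.
  have qm : q * alpha <= Num.max 0 (q * alpha) by rewrite le_max lexx orbT.
  have m0 : 0 <= Num.max 0 (q * alpha) by rewrite le_max lexx.
  have g01 : 0 < g < 2 * alpha - 1 by rewrite /g; apply/andP; split; lra.
  have [C C0 h] := survival_upper_le1 a0 hcp hcm hvp hvm hK ha halpha (ltW a1) g01 x.
  apply: (fin C (g / alpha)) => //.
    by rewrite divr_gt0//; case/andP: g01.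
  by rewrite ltr_pdivlMr// /g; lra.
- have hb : 2 - 1 / alpha = (2 * alpha - 1) / alpha.
    by field; rewrite gt_eqF.
  have qa : 2 * alpha - 1 < q * alpha by rewrite -ltr_pdivrMr// -hb.
  (* A [g] below [b] satisfies both [g < alpha] and [g / q < alpha]; the second leaves room for an
     [s < alpha] with [g / s < q]. *)
  pose b := Num.min alpha (q * alpha).
  pose g := (2 * alpha - 1 + b) / 2.
  have ba : b <= alpha by rewrite ge_min lexx.
  have bq : b <= q * alpha by rewrite ge_min lexx orbT.
  have b0 : 2 * alpha - 1 < b by rewrite lt_min qa andbT; lra.
  have q0 : 0 < q by rewrite -(pmulr_lgt0 _ a0); lra.
  have gb : 2 * alpha - 1 < g by rewrite /g; lra.
  have ga : g < alpha by rewrite /g; lra.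
  have gqa : g / q < alpha by rewrite ltr_pdivrMr// mulrC /g; lra.
  have gq0 : 0 < g / q by rewrite divr_gt0//; lra.
  pose s := (g / q + alpha) / 2.
  have s0 : 0 < s by rewrite /s; lra.
  have sa : s < alpha by rewrite /s; lra.
  have [c [N [c0 _ h]]] :=
    survival_lower_excursion a0 hcp hcm hvp hvm hK ha a12 a1 gb ga s0 sa ax.
  apply: (infty c N (g / s)) => //; first by rewrite divr_gt0//; lra.
  by rewrite ltr_pdivrMr// mulrC -ltr_pdivrMr// /s; lra.
Qed.
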